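(* (Widom's identity for truncated Toeplitz operators.) Let $u$ be an infinite Blaschke product with partial products $u_n$, and let $a,b\in L^\infty(\mathbb T)$. Then for every $n\ge1$, as operators on $L^2(\mathbb T)$, $$P_{u_n}T_u(ab)P_{u_n}=P_{u_n}T_u(a)P_{u_n}T_u(b)P_{u_n}+P_{u_n}H(a)H(\tilde b)P_{u_n}+R_{u_n}H(\tilde a)H(b)R_{u_n}^*.$$
   Context: $\mathbb T$ is the unit circle with normalized Lebesgue measure, $H^2\subset L^2(\mathbb T)$ the Hardy space, $P$ the orthogonal projection of $L^2(\mathbb T)$ onto $H^2$, $Q:=I-P$. For $a\in L^\infty(\mathbb T)$, $M_a$ is multiplication by $a$ and $\tilde a(t):=a(t^{-1})$. $J$ is the operator on $L^2(\mathbb T)$ given by $(Jf)(t)=t^{-1}f(t^{-1})$. The Hankel operator is $H(a):=PM_aQJ$ (on $H^2$ it coincides with $PM_aJ|_{H^2}$). For an inner function $v$, $K^2_v:=H^2\ominus vH^2$ and $P_v=P-M_vPM_{\bar v}$ is the orthogonal projection of $L^2(\mathbb T)$ onto $K^2_v$. The truncated Toeplitz operator is $T_u(a):=P_uM_a|_{K^2_u}$, regarded here as the operator $P_uM_aP_u$ on $L^2(\mathbb T)$. Blaschke factors: $b_0(z)=z$, $b_\lambda(z)=\frac{\lambda-z}{1-\bar\lambda z}\frac{|\lambda|}{\lambda}$ for $\lambda\ne0$. An infinite Blaschke product is $u=\prod_{k\ge1}b_{\lambda_k}$ with $|\lambda_k|\le|\lambda_{k+1}|$ and $\sum_k(1-|\lambda_k|)<\infty$;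 $u_n:=\prod_{k=1}^nb_{\lambda_k}$ and $P_{u_n}$ is the orthogonal projection onto $K^2_{u_n}$. Finally $R_{u_n}:=P_{u_n}M_{u_n}J$, so $R_{u_n}^*=JM_{\overline{u_n}}P_{u_n}$. *)

(* Defs.v *)
(* MathComp + MathComp-Analysis (R : realType), complex numbers R[i]
   from mathcomp-real-closed. *)
From HB Require Import structures.
From mathcomp Require Import all_boot all_order all_algebra.
From mathcomp Require Import all_classical all_reals all_analysis.
From mathcomp Require Import complex.
From Stdlib Require Import ClassicalEpsilon.
Set Implicit Arguments. Unset Strict Implicit. Unset Printing Implicit Defensive.
Import Order.TTheory GRing.Theory Num.Theory.
Import numFieldNormedType.Exports.
Local Open Scope classical_set_scope.
Local Open Scope ring_scope.
Local Open Scope complex_scope.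

Section Defs.
Variable R : realType.
Local Notation C := R[i].

(* Functions on the unit circle T are represented by functions C -> C;
   only their values on T matter. *)
Definition fT := C -> C.

(* parametrisation of T by [0,1] : t |-> exp(2 pi i t); it pushes
   Lebesgue measure on [0,1] to normalized Lebesgue measure on T *)
Definition eT (t : R) : C := Complex (cos (2 * pi * t)) (sin (2 * pi * t)).
Definition I01 : set R := `[0%R, 1%R].
Definition mu := @lebesgue_measure R.

Definition abs2 (z : C) : R := (complex.Re z ^+ 2 + complex.Im z ^+ 2)%R.

(* measurability on T *)
Definition measT (f : fT) : Prop :=
  measurable_fun I01 (fun t => complex.Re (f (eT t))) /\
  measurable_fun I01 (fun t => complex.Im (f (eT t))).

(* f in L^2(T) *)
Definition L2 (f : fT) : Prop :=
  measT f /\ mu.-integrable I01 (fun t => (abs2 (f (eT t)))%:E).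

(* a in L^oo(T) *)
Definition Linf (a : fT) : Prop :=
  measT a /\ exists M : R, {ae mu, forall t, t \in I01 -> abs2 (a (eT t)) <= M}.

(* equality almost everywhere on T *)
Definition aeT (f g : fT) : Prop :=
  {ae mu, forall t, t \in I01 -> f (eT t) = g (eT t)}.

(* integral over T w.r.t. normalized Lebesgue measure *)
Definition cint (F : fT) : C :=
  Complex (Rintegral mu I01 (fun t => complex.Re (F (eT t))))
          (Rintegral mu I01 (fun t => complex.Im (F (eT t)))).

Definition inner (f g : fT) : C := cint (fun z => f z * (g z)^*).

(* k-th Fourier coefficient *)
Definition fcoef (f : fT) (k : int) : C := cint (fun z => f z * z ^ (- k)).

(* Hardy space H^2 *)
Definition H2 : set fT :=
  [set f | L2 f /\ forall k : int, (k < 0)%R -> fcoef f k = 0].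

(* orthogonal projection onto a (closed) subspace M of L^2(T):
   the element g of M with f - g orthogonal to M *)
Definition oproj (M : set fT) (f : fT) : fT :=
  epsilon (inhabits (fun _ : C => 0))
    (fun g => M g /\ forall h, M h -> inner (fun z => f z - g z) h = 0).

(* operators on functions on T *)
Definition P : fT -> fT := oproj H2.
Definition Qop (f : fT) : fT := fun z => f z - P f z.
Definition Mul (a : fT) (f : fT) : fT := fun z => a z * f z.
Definition Jop (f : fT) : fT := fun z => z^-1 * f (z^-1).
Definition tilde (a : fT) : fT := fun z => a (z^-1).
Definition cconj (a : fT) : fT := fun z => (a z)^*.

(* Hankel operator H(a) = P M_a Q J *)
Definition Hank (a : fT) : fT -> fT := P \o Mul a \o Qop \o Jop.

(* P_v = P - M_v P M_{conj v} *)
Definition Pv (v : fT) (f : fT) : fT :=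
  fun z => P f z - v z * P (Mul (cconj v) f) z.

(* truncated Toeplitz operator T_u(a) = P_u M_a P_u *)
Definition TT (u a : fT) : fT -> fT := Pv u \o Mul a \o Pv u.

(* R_v = P_v M_v J  and  R_v^* = J M_{conj v} P_v *)
Definition Rop (v : fT) : fT -> fT := Pv v \o Mul v \o Jop.
Definition Radj (v : fT) : fT -> fT := Jop \o Mul (cconj v) \o Pv v.

(* Blaschke factors *)
Definition bfactor (l : C) : fT := fun z =>
  if l == 0 then z else (l - z) / (1 - l^* * z) * (`|l| / l).

(* a Blaschke sequence, indexed from 0: lam 0, lam 1, ... *)
Definition blaschke_seq (lam : nat -> C) : Prop :=
  (forall k, `|lam k| < 1) /\
  (forall k, `|lam k| <= `|lam k.+1|) /\
  cvgn (series (fun k => (1 - complex.Re `|lam k|)%R)).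

(* partial products u_n = prod_{k < n} b_{lam k} *)
Definition uprod (lam : nat -> C) (n : nat) : fT :=
  fun z => \prod_(k < n) bfactor (lam k) z.

(* the infinite product in the disc *)
Definition bprodD (lam : nat -> C) : fT := fun z =>
  Complex (limn (fun n => complex.Re (uprod lam n z)))
          (limn (fun n => complex.Im (uprod lam n z))).

(* boundary values on T: radial limits *)
Definition bprodT (lam : nat -> C) : fT := fun z =>
  Complex (lim ((fun r : R => complex.Re (bprodD lam (r%:C * z))) @ at_left 1%R))
          (lim ((fun r : R => complex.Im (bprodD lam (r%:C * z))) @ at_left 1%R)).

Definition fmul (a b : fT) : fT := fun z => a z * b z.
Definition fadd3 (f g h : fT) : fT := fun z => f z + g z + h z.

End Defs.

(* Main.v *)
(* The symbol [u] enters only through its boundary values.  Along indices [n j]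
   whose tails of [sum (1 - |lam k|)] are at most [8^-j], the Poisson kernel
   bounds [1 - Re] of a tail product on a radius by its averages over dyadic
   arcs; weak-type bounds and Borel-Cantelli then show that at almost every
   point of the circle [u_(n j)] converges and [u] has the same limit radially.
   Dominated convergence gives [conj (u_m) u H^2] inside [H^2], hence K_(u_m)
   lies in K_u and [P_(u_m) P_u = P_(u_m)].
   What remains is algebra in L^2 = K_v + conj(z H^2) + v H^2 with [v = u_m]:
   for [F] in K_v split [b F = G + q + v w] accordingly; then the three terms
   of the identity are [P_v a G], [P_v a q] and [P_v a v w]. *)

Require Import Defs.
From HB Require Import structures.
From mathcomp Require Import all_boot all_order all_algebra.
From mathcomp Require Import all_classical all_reals all_analysis.
From mathcomp Require Import complex.
From mathcomp Require Import measurable_realfun.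
From mathcomp Require Import ring lra zify.
From Stdlib Require Import ClassicalEpsilon.
Import Order.TTheory GRing.Theory Num.Theory.
Import numFieldNormedType.Exports.
Set Implicit Arguments. Unset Strict Implicit. Unset Printing Implicit Defensive.

(** * Functions on the circle *)

Section Basics.
Variable R : realType.
Local Notation C := R[i].
Local Notation Re := (@complex.Re R).
Local Notation Im := (@complex.Im R).
Local Notation mu := (@lebesgue_measure R).
Local Notation I := (@I01 R).
Local Open Scope classical_set_scope.
Local Open Scope ring_scope.
Local Notation "x %:C" := (real_complex _ x) : ring_scope.
Implicit Types (z w : C) (f g h a b : fT R) (t s : R).

(** Two features of the definitions shape the proof. [bprodT] is a radial limit taken by a total
    [lim], so neither its existence nor the measurability of [u] is given; the limits superior
    [limsupT] along the fast subsequence supply a measurable representative, and the integral lemmas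
    allow [u] to be replaced by it under the integral sign. [oproj] is a choice by [epsilon]: its
    predicate depends only on the almost everywhere class of the argument, so [P] sends equivalent
    functions to the very same function, but that function is controlled only almost everywhere. The
    rate 8^-j is 4^-j times 2^-j: squared distances of size 8^-j, tested at level 4^-j, leave
    exceptional sets of size 2^-j, and off these the moduli are of size 2^-j; both are summable. The
    same rate serves the completeness of L^2 and the Blaschke tails. Since [H2] is given by Fourier
    coefficients, its orthogonality to [H2m] rests on Fourier uniqueness, which is obtained from
    Poisson integrals at Lebesgue points with the same kernel estimate as the radial limits. *)

Lemma complex_eq z w : Re z = Re w -> Im z = Im w -> z = w.
Proof. by case: z => ? ?; case: w => ? ? /= -> ->. Qed.

Lemma cReD z w : Re (z + w) = Re z + Re w. Proof. by case: z; case: w. Qed.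
Lemma cImD z w : Im (z + w) = Im z + Im w. Proof. by case: z; case: w. Qed.
Lemma cReN z : Re (- z) = - Re z. Proof. by case: z. Qed.
Lemma cImN z : Im (- z) = - Im z. Proof. by case: z. Qed.
Lemma cReM z w : Re (z * w) = Re z * Re w - Im z * Im w.
Proof. by case: z; case: w. Qed.
Lemma cImM z w : Im (z * w) = Re z * Im w + Im z * Re w.
Proof. by case: z; case: w. Qed.
Lemma cReconj z : Re z^* = Re z. Proof. by case: z. Qed.
Lemma cImconj z : Im z^* = - Im z. Proof. by case: z. Qed.
Definition ReImE := (cReD, cImD, cReN, cImN, cReM, cImM, cReconj, cImconj).

Lemma conjcM z w : (z * w)^* = z^* * w^*.
Proof. by apply: complex_eq; rewrite !ReImE; ring. Qed.
Lemma conjcD z w : (z + w)^* = z^* + w^*.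
Proof. by apply: complex_eq; rewrite !ReImE; ring. Qed.
Lemma conjcB z w : (z - w)^* = z^* - w^*.
Proof. by apply: complex_eq; rewrite !ReImE; ring. Qed.

Lemma conjcE z : conjc z = z^*. Proof. by []. Qed.
Lemma conjc_invol z : z^*^* = z.
Proof. by apply: complex_eq; rewrite !ReImE ?opprK. Qed.

Lemma abs2_ge0 z : 0 <= abs2 z.
Proof. by rewrite addr_ge0 ?sqr_ge0. Qed.
Lemma abs2M z w : abs2 (z * w) = abs2 z * abs2 w.
Proof. by rewrite /abs2 !ReImE; ring. Qed.
Lemma abs2_conj z : abs2 z^* = abs2 z.
Proof. by rewrite /abs2 !ReImE; ring. Qed.
Lemma abs2N z : abs2 (- z) = abs2 z.
Proof. by rewrite /abs2 !ReImE; ring. Qed.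
Lemma abs20 : abs2 (0 : C) = 0.
Proof. by rewrite /abs2 /= expr0n addr0. Qed.
Lemma abs21 : abs2 (1 : C) = 1.
Proof. by rewrite /abs2 /= expr1n expr0n addr0. Qed.
Lemma abs2C (x : R) : abs2 x%:C = x ^+ 2.
Proof. by rewrite /abs2 /= expr0n addr0. Qed.
Lemma abs2E z : z * z^* = (abs2 z)%:C.
Proof. by apply: complex_eq; rewrite !ReImE /abs2 /=; ring. Qed.
Lemma abs2_eq0 z : (abs2 z == 0) = (z == 0).
Proof. by rewrite /abs2 paddr_eq0 ?sqr_ge0 // !sqrf_eq0 eq_complex. Qed.
Lemma abs2X z n : abs2 (z ^+ n) = abs2 z ^+ n.
Proof. by elim: n => [|n IH]; rewrite ?expr0 ?abs21 // !exprS abs2M IH. Qed.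
Lemma abs2V z : abs2 z^-1 = (abs2 z)^-1.
Proof.
have [->|z0] := eqVneq z 0; first by rewrite invr0 abs20 invr0.
have z20 : abs2 z != 0 by rewrite abs2_eq0.
by apply: (mulfI z20); rewrite -abs2M !divff // abs21.
Qed.
Lemma abs2_Re z : Re z ^+ 2 <= abs2 z.
Proof. by rewrite lerDl sqr_ge0. Qed.
Lemma abs2_Im z : Im z ^+ 2 <= abs2 z.
Proof. by rewrite lerDr sqr_ge0. Qed.
Lemma abs2D_le z w : abs2 (z + w) <= 2 * abs2 z + 2 * abs2 w.
Proof.
rewrite /abs2 !ReImE; have := sqr_ge0 (Re z - Re w).
have := sqr_ge0 (Im z - Im w); nra.
Qed.
Lemma abs2B_le z w : abs2 (z - w) <= 2 * abs2 z + 2 * abs2 w.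
Proof. by apply: le_trans (abs2D_le _ _) _; rewrite abs2N. Qed.

Lemma unit_inv z : abs2 z = 1 -> z^-1 = z^*.
Proof.
move=> z1; have z0 : z != 0 by rewrite -abs2_eq0 z1 oner_eq0.
by apply: (mulfI z0); rewrite divff // abs2E z1.
Qed.
Lemma unit_neq0 z : abs2 z = 1 -> z != 0.
Proof. by move=> z1; rewrite -abs2_eq0 z1 oner_eq0. Qed.

Lemma abs2_eT t : abs2 (eT t) = 1.
Proof. by rewrite /abs2 /= cos2Dsin2. Qed.
Lemma eTV t : (eT t)^-1 = (eT t)^*. Proof. exact/unit_inv/abs2_eT. Qed.
Lemma eT_onem t : eT (1 - t) = (eT t)^-1.
Proof.
rewrite eTV; apply: complex_eq => /=.
  by rewrite mulrBr mulr1 mulr_natl addrC cosD2pi cosN.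
by rewrite mulrBr mulr1 mulr_natl addrC sinD2pi sinN.
Qed.
Lemma eTB s t : eT s * (eT t)^* = eT (s - t).
Proof. by apply: complex_eq; rewrite !ReImE /= !mulrBr ?cosB ?sinB; ring. Qed.

Lemma continuous_Re_eT : continuous (fun t => Re (eT t)).
Proof.
move=> t /=; apply: (@continuous_comp _ _ _ (fun t => 2 * pi * t) cos).
  exact: mulrl_continuous.
exact: continuous_cos.
Qed.
Lemma continuous_Im_eT : continuous (fun t => Im (eT t)).
Proof.
move=> t /=; apply: (@continuous_comp _ _ _ (fun t => 2 * pi * t) sin).
  exact: mulrl_continuous.
exact: continuous_sin.
Qed.

Lemma measurable_I : measurable I. Proof. exact: measurable_itv. Qed.
Hint Resolve measurable_I : core.
Lemma mu_I : mu I = 1%E.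
Proof. by rewrite /I01 lebesgue_measure_itv /= lte01 oppr0 adde0. Qed.

Lemma measT_id : measT (fun z => z).
Proof.
by split; apply: measurable_funTS; apply: continuous_measurable_fun;
  [exact: continuous_Re_eT|exact: continuous_Im_eT].
Qed.
Lemma measT_cst z : measT (fun _ => z).
Proof. by split; apply: measurable_cst. Qed.
Lemma measT_conj f : measT f -> measT (fun z => (f z)^*).
Proof.
case=> m1 m2; split.
  by under eq_fun do rewrite cReconj.
by under eq_fun do rewrite cImconj; apply: measurable_funN.
Qed.
Lemma measTD f g : measT f -> measT g -> measT (fun z => f z + g z).
Proof.
move=> [f1 f2] [g1 g2]; split.
  by under eq_fun do rewrite cReD; apply: measurable_funD.
by under eq_fun do rewrite cImD; apply: measurable_funD.
Qed.
Lemma measTN f : measT f -> measT (fun z => - f z).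
Proof.
move=> [f1 f2]; split.
  by under eq_fun do rewrite cReN; apply: measurable_funN.
by under eq_fun do rewrite cImN; apply: measurable_funN.
Qed.
Lemma measTB f g : measT f -> measT g -> measT (fun z => f z - g z).
Proof. by move=> mf mg; apply: measTD => //; apply: measTN. Qed.
Lemma measTM f g : measT f -> measT g -> measT (fun z => f z * g z).
Proof.
move=> [f1 f2] [g1 g2]; split.
  by under eq_fun do rewrite cReM; apply: measurable_funB; apply: measurable_funM.
by under eq_fun do rewrite cImM; apply: measurable_funD; apply: measurable_funM.
Qed.
Lemma measT_abs2 f : measT f -> measurable_fun I (fun t => abs2 (f (eT t))).
Proof.
by move=> [f1 f2]; apply: measurable_funD; apply: measurable_funX.
Qed.
Lemma eq_measT f g : (forall z, abs2 z = 1 -> f z = g z) -> measT f -> measT g.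
Proof.
by move=> fg [f1 f2]; split; [move: f1|move: f2]; apply: eq_measurable_fun => t _;
  rewrite fg ?abs2_eT.
Qed.
Lemma measT_Xn n : measT (fun z => z ^+ n).
Proof.
elim: n => [|n IH]; first by under eq_fun do rewrite expr0; exact: measT_cst.
by under eq_fun do rewrite exprS; apply: measTM => //; exact: measT_id.
Qed.
Lemma measT_X (k : int) : measT (fun z => z ^ k).
Proof.
case: k => n; first exact: measT_Xn.
apply: (@eq_measT (fun z => (z ^+ n.+1)^*)); last exact/measT_conj/measT_Xn.
by move=> z z1; rewrite NegzE -exprnN -exprVn unit_inv // rmorphXn.
Qed.

Lemma abs2_Xz z (k : int) : abs2 z = 1 -> abs2 (z ^ k) = 1.
Proof.
move=> z1; case: k => n; first by rewrite -exprnP abs2X z1 expr1n.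
by rewrite NegzE -exprnN abs2V abs2X z1 expr1n invr1.
Qed.

Definition contT f :=
  continuous (fun t => Re (f (eT t))) /\ continuous (fun t => Im (f (eT t))).

Lemma contT_measT f : contT f -> measT f.
Proof. by case=> c1 c2; split; apply: measurable_funTS; exact: continuous_measurable_fun. Qed.
Lemma contT_id : contT (fun z => z).
Proof. by split; [exact: continuous_Re_eT|exact: continuous_Im_eT]. Qed.
Lemma contT_cst z : contT (fun=> z).
Proof. by split=> t; exact: cvg_cst. Qed.
Lemma contTD f g : contT f -> contT g -> contT (fun z => f z + g z).
Proof.
move=> [f1 f2] [g1 g2]; split => t.
  by under eq_fun do rewrite cReD; apply: cvgD; [exact: f1|exact: g1].
by under eq_fun do rewrite cImD; apply: cvgD; [exact: f2|exact: g2].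
Qed.
Lemma contTM f g : contT f -> contT g -> contT (fun z => f z * g z).
Proof.
move=> [f1 f2] [g1 g2]; split => t.
  under eq_fun do rewrite cReM.
  by apply: cvgB; apply: cvgM; [exact: f1|exact: g1|exact: f2|exact: g2].
under eq_fun do rewrite cImM.
by apply: cvgD; apply: cvgM; [exact: f1|exact: g2|exact: f2|exact: g1].
Qed.
Lemma contTB f g : contT f -> contT g -> contT (fun z => f z - g z).
Proof.
move=> cf cg; rewrite (_ : (fun z => _) = (fun z => f z + (-1) * g z)).
  by apply: contTD => //; apply: contTM => //; exact: contT_cst.
by apply/funext => z; rewrite mulN1r.
Qed.
Lemma contT_conj f : contT f -> contT (fun z => (f z)^*).
Proof.
move=> [f1 f2]; split => t; first by under eq_fun do rewrite cReconj; exact: f1.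
by under eq_fun do rewrite cImconj; apply: cvgN; exact: f2.
Qed.
Lemma contT_inv f : (forall z, abs2 z = 1 -> f z != 0) -> contT f ->
  contT (fun z => (f z)^-1).
Proof.
move=> f0 cf; have [f1 f2] := cf.
have cV : contT (fun z => real_complex R (abs2 (f z))^-1).
  split=> t; last exact: cvg_cst.
  apply: cvgV; first by rewrite abs2_eq0 f0 // abs2_eT.
  by apply: cvgD; under eq_fun do rewrite expr2; apply: cvgM;
    [exact: f1|exact: f1|exact: f2|exact: f2].
have [h1 h2] := contTM (contT_conj cf) cV.
suff E t : (f (eT t))^-1 = (f (eT t))^* * (abs2 (f (eT t)))^-1%:C.
  by split => t; under eq_fun do rewrite E; [exact: h1|exact: h2].
have n0 := f0 _ (abs2_eT t).
apply: (mulfI n0); rewrite divff // mulrA abs2E -rmorphM /= divff //.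
by rewrite abs2_eq0.
Qed.

End Basics.

(** * Integrals of almost everywhere equal, possibly nonmeasurable functions *)

Section IntegralAE.
Local Open Scope classical_set_scope.
Local Open Scope ring_scope.
Local Open Scope ereal_scope.
Context d (T : measurableType d) (R : realType).
Variable mu : {measure set T -> \bar R}.

Import HBNNSimple.

(* No measurability is assumed: the library integral of an arbitrary
   nonnegative function is a supremum over simple functions below it.  This
   matters because [bprodT lam] is not known to be measurable. *)
Lemma ge0_le_integral_ae (f g : T -> \bar R) :
  (forall x, 0 <= f x) -> (forall x, 0 <= g x) ->
  {ae mu, forall x, f x = g x} -> \int[mu]_x f x <= \int[mu]_x g x.
Proof.
move=> f0 g0 [N [mN N0 fgN]].
rewrite (ge0_integralTE mu f0); apply: ge_ereal_sup => _ /= [h hf <-].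
have mNC : measurable (~` N) by exact: measurableC.
rewrite (ge0_integralTE mu g0).
(* A simple function below [f], cut to 0 on the null set, lies below [g] and keeps its integral. *)
apply: (@le_trans _ _ (sintegral mu (proj_nnsfun h mNC))); last first.
  apply: ereal_sup_ubound; exists (proj_nnsfun h mNC) => //= x.
  rewrite mindicE; have [xN|xN] := boolP (x \in ~` N).
    rewrite mulr1; apply: le_trans (hf x) _.
    have -> // : f x = g x.
    by apply: contrapT => fgx; move: xN; rewrite inE; apply; exact: fgN.
  by rewrite mulr0.
rewrite -!integralT_nnsfun le_eqVlt; apply/orP; left; apply/eqP.
apply: ae_eq_integral => //.
- by apply/measurable_EFinP.
- by apply/measurable_EFinP.
- exists N; split => // x /= /not_implyP[_]; apply: contra_notP => xN.
  by rewrite mindicE mem_set // mulr1.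
Qed.

(** Positive and negative parts reduce this to the nonnegative case. It lets integrands containing
    [bprodT] be exchanged for measurable ones. *)
Lemma eq_integral_ae (D : set T) (f g : T -> \bar R) :
  {ae mu, forall x, D x -> f x = g x} ->
  \int[mu]_(x in D) f x = \int[mu]_(x in D) g x.
Proof.
move=> fg; rewrite integral_mkcond [RHS]integral_mkcond.
have {}fg : {ae mu, forall x, (f \_ D) x = (g \_ D) x}.
  apply: filterS fg => x fgx; rewrite !patchE; case: ifPn => // xD.
  by apply: fgx; rewrite inE in xD.
have gf : {ae mu, forall x, (g \_ D) x = (f \_ D) x} by apply: filterS fg.
have pos (u v : T -> \bar R) : {ae mu, forall x, u x = v x} ->
    {ae mu, forall x, u^\+ x = v^\+ x}.
  by apply: filterS => x uv; rewrite !funeposE uv.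
have neg (u v : T -> \bar R) : {ae mu, forall x, u x = v x} ->
    {ae mu, forall x, u^\- x = v^\- x}.
  by apply: filterS => x uv; rewrite !funenegE uv.
rewrite integralE [RHS]integralE; congr (_ - _); apply/eqP; rewrite eq_le.
  by rewrite !ge0_le_integral_ae //; exact: pos.
by rewrite !ge0_le_integral_ae //; exact: neg.
Qed.

End IntegralAE.

(** * The reflection t -> 1 - t, which is z -> z^-1 on the circle *)

Section Reflection.
Variable R : realType.
Local Notation mu := (@lebesgue_measure R).
Local Notation I := (@I01 R).
Local Open Scope classical_set_scope.
Local Open Scope ring_scope.

Let rho (t : R) : R := 1 - t.

Lemma measurable_reflect : measurable_fun setT rho.
Proof. by apply: measurable_funB; [exact: measurable_cst|exact: measurable_id]. Qed.

Lemma reflect_I : rho @^-1` I = I.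
Proof.
apply/seteqP; split => t; rewrite /rho /I01 /= !in_itv /=.
  by move=> /andP[? ?]; apply/andP; split; lra.
by move=> /andP[? ?]; apply/andP; split; lra.
Qed.

(** Lebesgue measure is determined by the half-open intervals, and the preimage of ]a, b] is [1 - b,
    1 - a[, of the same length. *)
Lemma lebesgue_measure_reflect (A : set R) : measurable A ->
  mu (rho @^-1` A) = mu A.
Proof.
move=> mA.
have -> : mu (rho @^-1` A) =
    pushforward mu (rho : measurableTypeR R -> measurableTypeR R) A by [].
apply/esym/lebesgue_measure_unique => //=.
  exact: measurable_reflect.
move=> mrho _ [[a b]] _ <-; rewrite /pushforward /=.
have -> : rho @^-1` `]a, b] = `[1 - b, 1 - a[%classic.
  apply/seteqP; split => t; rewrite /rho /= !in_itv /= => /andP[? ?];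
    by apply/andP; split; lra.
rewrite !lebesgue_measure_itv /= !lte_fin.
have -> : (1 - b < 1 - a) = (a < b) by rewrite ltrD2l ltrN2.
by case: ifP => // _; rewrite -!EFinB; congr EFin; ring.
Qed.

Lemma ae_reflect (Q : R -> Prop) : {ae mu, forall t, Q t} -> {ae mu, forall t, Q (1 - t)}.
Proof.
move=> [N [mN N0 QN]]; exists (rho @^-1` N); split.
- by rewrite -[X in measurable X]setTI; exact: measurable_reflect.
- by rewrite lebesgue_measure_reflect.
- by move=> t Qt; apply: QN.
Qed.

Lemma ge0_integral_reflect (f : R -> \bar R) : measurable_fun I f ->
  (forall t, I t -> 0 <= f t)%E ->
  (\int[mu]_(t in I) f (1 - t)%R = \int[mu]_(t in I) f t)%E.
Proof.
move=> mf f0.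
rewrite -[in LHS]reflect_I.
have := @ge0_integral_pushforward _ _ (measurableTypeR R) (measurableTypeR R) R rho measurable_reflect mu I f; rewrite /comp => <- //.
- apply: eq_measure_integral => [|mrho A mA _]; [exact: measurable_reflect|exact: lebesgue_measure_reflect].
- exact: measurable_itv.
- by move=> t; rewrite inE; exact: f0.
Qed.

Lemma measurable_fun_reflect d (T : measurableType d) (f : R -> T) :
  measurable_fun I f -> measurable_fun I (fun t => f (1 - t)).
Proof.
move=> mf; apply: (measurable_comp (measurable_itv _) _ mf).
  by move=> _ [t + <-]; rewrite -[X in X t]reflect_I.
exact: (measurable_funTS measurable_reflect).
Qed.

Lemma integral_reflect (f : R -> \bar R) : measurable_fun I f ->
  (\int[mu]_(t in I) f (1 - t)%R = \int[mu]_(t in I) f t)%E.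
Proof.
move=> mf; rewrite integralE [RHS]integralE; congr (_ - _)%E.
  rewrite -[RHS]ge0_integral_reflect //; last exact: measurable_funepos.
  by apply: eq_integral => t _; rewrite !funeposE.
rewrite -[RHS]ge0_integral_reflect //; last exact: measurable_funeneg.
by apply: eq_integral => t _; rewrite !funenegE.
Qed.

End Reflection.

Section LebesgueAE.
Variable R : realType.
Local Notation mu := (@lebesgue_measure R).

Lemma ae_imp (P Q : R -> Prop) : (forall t, P t -> Q t) ->
  {ae mu, forall t, P t} -> {ae mu, forall t, Q t}.
Proof.
move=> PQ [N [mN N0 PN]]; exists N; split => // t Qt; apply: PN => Pt.
by apply: Qt; exact: PQ.
Qed.

Lemma ae_and (P Q : R -> Prop) : {ae mu, forall t, P t} ->
  {ae mu, forall t, Q t} -> {ae mu, forall t, P t /\ Q t}.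
Proof.
move=> hP hQ; have := @ae_filter_ringOfSetsType _ (measurableTypeR R) R mu.
by move=> F; exact: (@filterI _ _ F _ _ hP hQ).
Qed.

Lemma ae_imp2 (P Q S : R -> Prop) : (forall t, P t -> Q t -> S t) ->
  {ae mu, forall t, P t} -> {ae mu, forall t, Q t} -> {ae mu, forall t, S t}.
Proof. by move=> PQS hP hQ; apply: ae_imp (ae_and hP hQ) => t []; exact: PQS. Qed.

End LebesgueAE.

(** * Square-integrable functions, inner product, Fourier coefficients *)

Section L2theory.
Variable R : realType.
Local Notation C := R[i].
Local Notation Re := (@complex.Re R).
Local Notation Im := (@complex.Im R).
Local Notation mu := (@lebesgue_measure R).
Local Notation I := (@I01 R).
Local Open Scope classical_set_scope.
Local Open Scope ring_scope.
Local Notation "x %:C" := (real_complex _ x) : ring_scope.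
Local Notation int1 phi := (mu.-integrable I (EFin \o phi)).
Implicit Types (z w c : C) (f g h a b F G : fT R) (t s : R) (phi psi : R -> R).

Let mI : measurable I := @measurable_I R.

Lemma int1_meas phi : int1 phi -> measurable_fun I phi.
Proof. by move=> /measurable_int /measurable_EFinP. Qed.

Lemma int1_le phi psi : measurable_fun I phi ->
  (forall t, I t -> `|phi t| <= psi t) -> int1 psi -> int1 phi.
Proof.
move=> mphi le ipsi; apply: le_integrable ipsi => //.
  exact/measurable_EFinP.
by move=> t It /=; rewrite lee_fin (le_trans (le _ It)) // ler_norm.
Qed.

Lemma int1_le_ae phi psi : measurable_fun I phi ->
  {ae mu, forall t, I t -> `|phi t| <= psi t} -> int1 psi -> int1 phi.
Proof.
move=> mphi le ipsi; apply/integrableP; split; first exact/measurable_EFinP.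
case/integrableP: ipsi => mpsi; apply: le_lt_trans.
apply: ae_ge0_le_integral => //.
- by apply: measurableT_comp => //; exact/measurable_EFinP.
- exact: measurableT_comp.
- move: le; apply: ae_imp => t le It /=.
  by rewrite lee_fin (le_trans (le It)) // ler_norm.
Qed.

Lemma int1_cst (x : R) : int1 (fun=> x).
Proof.
apply: measurable_bounded_integrable => //.
- by rewrite [X in (X < _)%E]mu_I ltry.
- exact: bounded_cst.
Qed.

Lemma int1D phi psi : int1 phi -> int1 psi -> int1 (fun t => phi t + psi t).
Proof. exact: integrableD. Qed.
Lemma int1B phi psi : int1 phi -> int1 psi -> int1 (fun t => phi t - psi t).
Proof. exact: integrableB. Qed.
Lemma int1N phi : int1 phi -> int1 (fun t => - phi t).
Proof. exact: integrableN. Qed.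
Lemma int1Z (x : R) phi : int1 phi -> int1 (fun t => x * phi t).
Proof. exact: integrableZl. Qed.

Definition cintegrable F :=
  int1 (fun t => Re (F (eT t))) /\ int1 (fun t => Im (F (eT t))).

Lemma cintegrableD F G : cintegrable F -> cintegrable G ->
  cintegrable (fun z => F z + G z).
Proof.
move=> [F1 F2] [G1 G2]; split; [under eq_fun do rewrite cReD|under eq_fun do rewrite cImD];
  exact: int1D.
Qed.
Lemma cintegrableN F : cintegrable F -> cintegrable (fun z => - F z).
Proof.
move=> [F1 F2]; split; [under eq_fun do rewrite cReN|under eq_fun do rewrite cImN];
  exact: int1N.
Qed.
Lemma cintegrableZ c F : cintegrable F -> cintegrable (fun z => c * F z).
Proof.
move=> [F1 F2]; split; [under eq_fun do rewrite cReM|under eq_fun do rewrite cImM].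
  by apply: int1B; exact: int1Z.
by apply: int1D; exact: int1Z.
Qed.

Lemma cintD F G : cintegrable F -> cintegrable G ->
  cint (fun z => F z + G z) = cint F + cint G.
Proof.
move=> [F1 F2] [G1 G2]; apply: complex_eq; rewrite !ReImE /= -RintegralD //;
  by apply: eq_Rintegral => t _; rewrite !ReImE.
Qed.
Lemma cintZ c F : cintegrable F -> cint (fun z => c * F z) = c * cint F.
Proof.
move=> [F1 F2]; apply: complex_eq; rewrite !ReImE /= -!RintegralZl //.
  rewrite -RintegralB //; [|exact: int1Z|exact: int1Z].
  by apply: eq_Rintegral => t _; rewrite !ReImE.
rewrite -RintegralD //; [|exact: int1Z|exact: int1Z].
by apply: eq_Rintegral => t _; rewrite !ReImE.
Qed.
Lemma cintN F : cintegrable F -> cint (fun z => - F z) = - cint F.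
Proof.
move=> iF; rewrite -mulN1r -cintZ //; congr cint.
by apply/funext => z; rewrite mulN1r.
Qed.
Lemma cintB F G : cintegrable F -> cintegrable G ->
  cint (fun z => F z - G z) = cint F - cint G.
Proof. by move=> iF iG; rewrite cintD ?cintN //; apply: cintegrableN. Qed.
Lemma cint_conj F : cintegrable F -> cint (fun z => (F z)^*) = (cint F)^*.
Proof.
move=> [F1 F2]; apply: complex_eq; rewrite !ReImE /=.
  by apply: eq_Rintegral => t _; rewrite !ReImE.
rewrite -mulN1r -RintegralZl //.
by apply: eq_Rintegral => t _; rewrite !ReImE mulN1r.
Qed.

Lemma aeT_T f g : (forall z, abs2 z = 1 -> f z = g z) -> aeT f g.
Proof. by move=> fg; apply: aeW => t _; rewrite fg ?abs2_eT. Qed.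
Lemma aeT_refl f : aeT f f. Proof. exact: aeT_T. Qed.
Lemma aeT_sym f g : aeT f g -> aeT g f.
Proof. by apply: ae_imp => t fg tI; rewrite fg. Qed.
Lemma aeT_trans g f h : aeT f g -> aeT g h -> aeT f h.
Proof. by apply: ae_imp2 => t fg gh tI; rewrite fg // gh. Qed.
Lemma aeT_map2 (m : C -> C -> C -> C) f f' g g' : aeT f f' -> aeT g g' ->
  aeT (fun z => m z (f z) (g z)) (fun z => m z (f' z) (g' z)).
Proof. by apply: ae_imp2 => t fg gh tI; rewrite fg // gh. Qed.
Lemma aeT_map (m : C -> C -> C) f f' : aeT f f' ->
  aeT (fun z => m z (f z)) (fun z => m z (f' z)).
Proof. by apply: ae_imp => t fg tI; rewrite fg. Qed.

Lemma cint_ae F G : aeT F G -> cint F = cint G.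
Proof.
move=> FG; apply: complex_eq; congr fine; apply: eq_integral_ae;
  by apply: ae_imp FG => t FG It; rewrite FG // inE.
Qed.
Lemma eq_cint F G : (forall z, abs2 z = 1 -> F z = G z) -> cint F = cint G.
Proof. by move=> FG; apply/cint_ae/aeT_T. Qed.

Lemma inner_ae f f' g g' : aeT f f' -> aeT g g' -> inner f g = inner f' g'.
Proof.
by move=> ff' gg'; apply: cint_ae;
  apply: (aeT_map2 (fun _ x y => x * y^*)).
Qed.

(** This is the square of the L^2 norm; all estimates are kept in squared form so that no root
    occurs. *)
Definition nrm f : R := Rintegral mu I (fun t => abs2 (f (eT t))).

Lemma nrm_ge0 f : 0 <= nrm f.
Proof. by apply: Rintegral_ge0 => t _; exact: abs2_ge0. Qed.

Lemma L2_bdd f M : measT f -> (forall z, abs2 z = 1 -> abs2 (f z) <= M) -> L2 f.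
Proof.
move=> mf fM; split=> //; apply: int1_le (int1_cst M); first exact: measT_abs2.
by move=> t _; rewrite ger0_norm ?abs2_ge0 // fM ?abs2_eT.
Qed.
Lemma L2_cst c : L2 (fun=> c).
Proof. exact: L2_bdd (measT_cst c) (fun _ _ => lexx _). Qed.
Lemma L2_X (k : int) : L2 (fun z => z ^ k).
Proof. by apply: (@L2_bdd _ 1 (measT_X R k)) => z z1; rewrite abs2_Xz. Qed.
Lemma eq_L2 f g : (forall z, abs2 z = 1 -> f z = g z) -> L2 f -> L2 g.
Proof.
move=> fg [mf i]; split; first exact: eq_measT mf.
by apply: eq_integrable i => // t _ /=; rewrite fg ?abs2_eT.
Qed.
Lemma L2D f g : L2 f -> L2 g -> L2 (fun z => f z + g z).
Proof.
move=> [mf i] [mg j]; have mfg := measTD mf mg; split => //.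
apply: (int1_le _ _ (int1D (int1Z 2 i) (int1Z 2 j))); first exact: measT_abs2 mfg.
by move=> t _; rewrite ger0_norm ?abs2_ge0 //; exact: abs2D_le.
Qed.
Lemma L2Z c f : L2 f -> L2 (fun z => c * f z).
Proof.
move=> [mf i]; split; first exact: measTM (measT_cst c) mf.
by under eq_fun do rewrite abs2M; exact: int1Z.
Qed.
Lemma L2N f : L2 f -> L2 (fun z => - f z).
Proof.
by move=> [mf i]; split; [exact: measTN|under eq_fun do rewrite abs2N].
Qed.
Lemma L2B f g : L2 f -> L2 g -> L2 (fun z => f z - g z).
Proof. by move=> Lf Lg; apply: L2D => //; exact: L2N. Qed.
Lemma L2_conj f : L2 f -> L2 (fun z => (f z)^*).
Proof.
by move=> [mf i]; split; [exact: measT_conj|under eq_fun do rewrite abs2_conj].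
Qed.
Lemma L2_Linf a f : Linf a -> L2 f -> L2 (fun z => a z * f z).
Proof.
move=> [ma [M aM]] [mf i]; have maf := measTM ma mf; split => //.
apply: (int1_le_ae _ _ (int1Z M i)); first exact: measT_abs2 maf.
apply: ae_imp aM => t aM It; rewrite ger0_norm ?abs2_ge0 // abs2M.
by rewrite ler_wpM2r ?abs2_ge0 // aM // inE.
Qed.
Lemma Linf_bdd a M : measT a -> (forall z, abs2 z = 1 -> abs2 (a z) <= M) -> Linf a.
Proof. by move=> ma aM; split => //; exists M; apply: aeW => t _; rewrite aM ?abs2_eT. Qed.
Lemma Linf_conj a : Linf a -> Linf (fun z => (a z)^*).
Proof.
move=> [ma [M aM]]; split; first exact: measT_conj.
by exists M; apply: ae_imp aM => t; rewrite abs2_conj.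
Qed.

Lemma cintegrableM f g : L2 f -> L2 g -> cintegrable (fun z => f z * g z).
Proof.
move=> [mf i] [mg j]; have [m1 m2] := measTM mf mg; have ij := int1D i j.
(* The arithmetic-geometric mean inequality on each product; it bounds the real and the imaginary
   part of f g by |f|^2 + |g|^2. *)
have h (x y x' y' : R) : `|x * y + x' * y'| <= (x ^+ 2 + x' ^+ 2) + (y ^+ 2 + y' ^+ 2).
  rewrite ler_norml; apply/andP; split.
    by have := sqr_ge0 (x + y); have := sqr_ge0 (x' + y');
      have := sqr_ge0 x; have := sqr_ge0 y; have := sqr_ge0 x';
      have := sqr_ge0 y'; rewrite !expr2; nra.
  by have := sqr_ge0 (x - y); have := sqr_ge0 (x' - y');
    have := sqr_ge0 x; have := sqr_ge0 y; have := sqr_ge0 x';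
    have := sqr_ge0 y'; rewrite !expr2; nra.
split; apply: int1_le ij => // t _.
  by rewrite cReM -mulrN; apply: le_trans (h _ _ _ _) _; rewrite sqrrN.
by rewrite cImM; apply: le_trans (h _ _ _ _) _; rewrite [X in _ + X]addrC.
Qed.
Lemma cintegrable_L2 f : L2 f -> cintegrable f.
Proof.
move=> Lf; have := cintegrableM (L2_cst 1) Lf.
by under eq_fun do rewrite mul1r.
Qed.
Lemma cintegrable_inner f g : L2 f -> L2 g -> cintegrable (fun z => f z * (g z)^*).
Proof. by move=> Lf Lg; apply: cintegrableM => //; exact: L2_conj. Qed.

Lemma innerDl f g h : L2 f -> L2 g -> L2 h ->
  inner (fun z => f z + g z) h = inner f h + inner g h.
Proof.
move=> Lf Lg Lh; rewrite /inner -cintD; try exact: cintegrable_inner.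
by congr cint; apply/funext => z; rewrite mulrDl.
Qed.
Lemma innerBl f g h : L2 f -> L2 g -> L2 h ->
  inner (fun z => f z - g z) h = inner f h - inner g h.
Proof.
move=> Lf Lg Lh; rewrite /inner -cintB; try exact: cintegrable_inner.
by congr cint; apply/funext => z; rewrite mulrBl.
Qed.
Lemma innerZl c f h : L2 f -> L2 h ->
  inner (fun z => c * f z) h = c * inner f h.
Proof.
move=> Lf Lh; rewrite /inner -cintZ; last exact: cintegrable_inner.
by congr cint; apply/funext => z; rewrite mulrA.
Qed.
Lemma inner_conj f g : L2 f -> L2 g -> inner g f = (inner f g)^*.
Proof.
move=> Lf Lg; rewrite /inner -cint_conj; last exact: cintegrable_inner.
by congr cint; apply/funext => z; rewrite conjcM conjc_invol mulrC.
Qed.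
Lemma innerBr f g h : L2 f -> L2 g -> L2 h ->
  inner h (fun z => f z - g z) = inner h f - inner h g.
Proof.
move=> Lf Lg Lh; rewrite (inner_conj (L2B Lf Lg) Lh) innerBl // conjcB.
by rewrite -!inner_conj.
Qed.
Lemma innerZr c f h : L2 f -> L2 h ->
  inner h (fun z => c * f z) = c^* * inner h f.
Proof.
move=> Lf Lh; rewrite (inner_conj (L2Z c Lf) Lh) innerZl // conjcM.
by rewrite -inner_conj.
Qed.
Lemma inner_nrm f : inner f f = (nrm f)%:C.
Proof.
apply: complex_eq => /=.
  by apply: eq_Rintegral => t _; rewrite abs2E.
under eq_Rintegral do rewrite abs2E.
by rewrite Rintegral_cst // mul0r.
Qed.

Lemma nrm0_ae f : L2 f -> nrm f = 0 -> aeT f (fun=> 0).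
Proof.
move=> [mf i] f0; have mf2 := measT_abs2 mf.
have fin : (\int[mu]_(t in I) (abs2 (f (eT t)))%:E)%E \is a fin_num.
  by apply: integrable_fin_num i; exact: measurable_itv.
have h : (\int[mu]_(t in I) `|(abs2 (f (eT t)))%:E|)%E = 0%E.
  under eq_integral do rewrite gee0_abs ?lee_fin ?abs2_ge0 //.
  by rewrite -(fineK fin); congr EFin.
have {h} := (ae_eq_integral_abs mu (measurable_itv _) _).1 h.
move=> /(_ _)/wrap[]; first exact/measurable_EFinP.
apply: ae_imp => t ht; rewrite inE => It; apply/eqP.
by have [/eqP] := ht It; rewrite abs2_eq0.
Qed.

Lemma nrmE f g : L2 f -> L2 g ->
  nrm (fun z => f z - g z) = nrm f - 2 * Re (inner f g) + nrm g.
Proof.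
move=> Lf Lg; have Lfg := L2B Lf Lg.
apply: complexI; rewrite -inner_nrm innerBl // !innerBr // !inner_nrm.
rewrite (inner_conj Lf Lg).
by apply: complex_eq; rewrite !ReImE /=; ring.
Qed.

Lemma nrmZ c f : L2 f -> nrm (fun z => c * f z) = abs2 c * nrm f.
Proof.
move=> [mf i]; rewrite /nrm -RintegralZl //.
by apply: eq_Rintegral => t _; rewrite abs2M.
Qed.

Lemma nrmBZ c f g : L2 f -> L2 g ->
  nrm (fun z => f z - c * g z) = nrm f - 2 * Re (c^* * inner f g) + abs2 c * nrm g.
Proof.
by move=> Lf Lg; rewrite (nrmE Lf (L2Z c Lg)) nrmZ // (innerZr c Lg Lf).
Qed.

(** Nonnegativity of the squared norm of f - s <f,g> g for real s. The value s = 1/|g|^2 gives the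
    inequality; if |g| = 0 the expression is affine in s, and the s chosen below makes it equal to
    -1 unless <f,g> = 0. *)
Lemma cauchy_schwarz f g : L2 f -> L2 g -> abs2 (inner f g) <= nrm f * nrm g.
Proof.
move=> Lf Lg; have := fun c => nrm_ge0 (fun z => f z - c * g z).
move: (nrm_ge0 f) (nrm_ge0 g) (fun c => nrmBZ c Lf Lg).
move: (inner f g) (nrm f) (nrm g) => c A B A0 Bge0 E {}E'.
have key (s : R) : 0 <= A - 2 * s * abs2 c + s ^+ 2 * abs2 c * B.
  have := E' (s%:C * c); rewrite E abs2M abs2C.
  have -> // : 2 * Re ((s%:C * c)^* * c) = 2 * s * abs2 c.
  by rewrite !ReImE /= /abs2; ring.
have c0 := abs2_ge0 c.
have [B0|B0] := eqVneq B 0.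
  rewrite B0 mulr0; rewrite leNgt; apply/negP => cgt.
  have := key ((A + 1) / (2 * abs2 c)).
  rewrite B0 mulr0 addr0.
  have -> : A - 2 * ((A + 1) / (2 * abs2 c)) * abs2 c = -1.
    by field; rewrite gt_eqF.
  by rewrite ler0N1.
have Bp : 0 < B by rewrite lt_def B0.
have := key B^-1; have -> : A - 2 * B^-1 * abs2 c + B^-1 ^+ 2 * abs2 c * B = A - abs2 c / B.
  by field.
by rewrite subr_ge0 ler_pdivrMr.
Qed.

Lemma fcoefE f (k : int) : fcoef f k = inner f (fun z => z ^ k).
Proof.
apply: eq_cint => z z1; congr (_ * _); rewrite -invr_expz unit_inv //.
by rewrite abs2_Xz.
Qed.

Lemma fcoef_ae f g k : aeT f g -> fcoef f k = fcoef g k.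
Proof. by move=> fg; rewrite !fcoefE; apply: inner_ae => //; exact: aeT_refl. Qed.
Lemma fcoefB f g k : L2 f -> L2 g ->
  fcoef (fun z => f z - g z) k = fcoef f k - fcoef g k.
Proof. by move=> Lf Lg; rewrite !fcoefE innerBl //; exact: L2_X. Qed.
Lemma fcoefD f g k : L2 f -> L2 g ->
  fcoef (fun z => f z + g z) k = fcoef f k + fcoef g k.
Proof. by move=> Lf Lg; rewrite !fcoefE innerDl //; exact: L2_X. Qed.
Lemma fcoefZ c f k : L2 f -> fcoef (fun z => c * f z) k = c * fcoef f k.
Proof. by move=> Lf; rewrite !fcoefE innerZl //; exact: L2_X. Qed.

End L2theory.

(** * Poisson kernel and Fourier uniqueness *)

Section DyadicKernel.
Variable R : realType.
Local Notation mu := (@lebesgue_measure R).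
Local Open Scope classical_set_scope.
Local Open Scope ring_scope.

(** The least admissible j: if it is positive, the previous scale fails, which is the second
    alternative. *)
Lemma dyadic_scale (d y : R) : 0 < d -> 0 <= y ->
  exists j, y < 2 ^+ j * d /\ (j = 0%N \/ 2 ^+ j * d <= 2 * y).
Proof.
move=> d0 y0.
have ex : exists j, y < 2 ^+ j * d.
  have [n ny] : exists n : nat, y / d < n%:R by exists (Num.bound (y / d)); apply: archi_boundP; rewrite divr_ge0 // ltW.
  exists n; rewrite -ltr_pdivrMr //; apply: lt_le_trans ny _.
  by rewrite -natrX ler_nat ltnW // ltn_expl.
case: (ex_minnP ex) => j yj jmin; exists j; split => //.
case: j yj jmin => [|j] yj jmin; [by left|right].
rewrite exprS -mulrA ler_pM2l // leNgt; apply/negP => /jmin.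
by rewrite ltnn.
Qed.

Lemma sum_halves (n : nat) : \sum_(j < n) (2 ^- j : R) <= 2.
Proof.
suff -> : \sum_(j < n) (2 ^- j : R) = 2 - 2 * 2 ^- n.
  by rewrite lerBlDr lerDl mulr_ge0 // invr_ge0 exprn_ge0.
elim: n => [|n IH]; first by rewrite big_ord0 expr0 invr1 mulr1 subrr.
rewrite big_ord_recr /= IH exprS invfM; lra.
Qed.

(* Layer-cake domination: [min(1/d, d/|s-t|^2)] is at most a sum of the
   normalised indicators of the balls of radius [2^j d] with weights [2^-j]. *)
Lemma dyadic_kernel_bound (K g : R -> R) (t d c A : R) :
  measurable_fun setT K -> measurable_fun setT g ->
  (forall s, 0 <= g s) -> (forall s, 0 <= K s) ->
  0 < d -> 0 <= c -> 0 <= A ->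
  (forall s, 1 < `|s - t| -> g s = 0) ->
  (forall s, g s != 0 -> K s <= c / d) ->
  (forall s, g s != 0 -> K s * (s - t) ^+ 2 <= c * d) ->
  (forall r, 0 < r -> (\int[mu]_(s in ball t r) (g s)%:E <= (2 * r * A)%:E)%E) ->
  (\int[mu]_s (K s * g s)%:E <= (16 * c * A)%:E)%E.
Proof.
move=> mK mg g0 K0 d0 c0 A0 gsupp K1 K2 avg.
(* Since 2^n >= n > 1/d, the scales 0, ..., n reach beyond distance 1, where [g] vanishes. *)
have [n nd] : exists n : nat, d^-1 < n%:R.
  by exists (Num.bound d^-1); apply: archi_boundP; rewrite invr_ge0 ltW.
pose B (j : nat) := ball t (2 ^+ j * d) : set R.
(* Where |s - t| >= 2^(j-1) d, the decay of [K] gives K <= 4 c 4^-j / d. Over the ball of radius 2^j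
   d this contributes at most 8 c A 2^-j, and the geometric sum yields 16 c A. *)
pose k (j : nat) := 4 * c * 4 ^- j / d.
have k0 j : 0 <= k j.
  by rewrite /k divr_ge0 ?mulr_ge0 ?invr_ge0 ?exprn_ge0 // ltW.
have r0 j : 0 < 2 ^+ j * d by rewrite mulr_gt0 ?exprn_gt0.
have pw s : K s * g s <= \sum_(j < n.+1) k j * (g \_ (B j)) s.
  have S0 : 0 <= \sum_(j < n.+1) k j * (g \_ (B j)) s.
    by apply: sumr_ge0 => j _; rewrite mulr_ge0 // patchE; case: ifP.
  have [gs0|gs0] := eqVneq (g s) 0; first by rewrite gs0 mulr0.
  have y1 : `|s - t| <= 1 by rewrite leNgt; apply/negP => /gsupp /eqP; rewrite (negbTE gs0).
  have [j [yj jcase]] := dyadic_scale d0 (normr_ge0 (s - t)).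
  have jn : (j < n.+1)%N.
    case: jcase => [-> //|jy]; rewrite ltnS leqNgt; apply/negP => nj.
    have : 2 ^+ j * d <= 2 by apply: le_trans jy _; rewrite ler_piMr.
    rewrite leNgt => /negP; apply.
    rewrite -ltr_pdivrMr //; apply: lt_le_trans (_ : 2 * n%:R <= _).
      by rewrite ltr_pM2l.
    case: j nj {yj jy} => // j; rewrite ltnS => nj.
    rewrite exprS ler_pM2l // -natrX ler_nat (leq_trans nj) //.
    by rewrite ltnW // ltn_expl.
  have Bs : s \in B j by rewrite inE /B /ball /= distrC.
  rewrite (bigD1 (Ordinal jn)) //= patchE Bs ler_wpDr //.
    by apply: sumr_ge0 => i _; rewrite mulr_ge0 // patchE; case: ifP.
  rewrite ler_wpM2r //.
  case: jcase => [j0|jy].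
    rewrite /k j0 expr0 invr1 mulr1; apply: le_trans (K1 _ gs0) _.
    by rewrite ler_pM2r ?invr_gt0 // ler_peMl // ler1n.
  have yp : 0 < `|s - t| by have := r0 j; lra.
  have y2 : 0 < (s - t) ^+ 2 by rewrite -real_normK ?num_real // exprn_gt0.
  rewrite -(ler_pM2r y2); apply: le_trans (K2 _ gs0) _.
  have -> : k j * (s - t) ^+ 2 = c / d * (2 * 2 ^- j * `|s - t|) ^+ 2.
    rewrite -(real_normK (num_real (s - t))) /k.
    have -> : (4 : R) ^- j = (2 ^- j) ^+ 2.
      by rewrite exprVn -exprM mulnC exprM; congr (_ ^- _); rewrite -natrX.
    by move: (2 ^- j) => q; ring.
  have -> : c * d = c / d * d ^+ 2 by field; rewrite gt_eqF.
  apply: ler_wpM2l; first by rewrite divr_ge0 // ltW.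
  have le_d : d <= 2 * 2 ^- j * `|s - t|.
    by rewrite mulrAC ler_pdivlMr ?exprn_gt0 // mulrC.
  by rewrite !expr2 ler_pM // ltW.
have mB j : measurable (B j) by exact: measurable_ball.
have mgB j : measurable_fun setT (g \_ (B j)).
  by apply/(measurable_restrictT _ _).1 => //; exact: measurable_funTS.
have mk j : measurable_fun setT (fun s => k j * (g \_ (B j)) s).
  exact: measurable_funM (measurable_cst _) (mgB j).
have mkE (j : nat) : measurable_fun setT (fun s => (k j * (g \_ (B j)) s)%:E).
  exact/measurable_EFinP.
have mgE (j : nat) : measurable_fun setT (fun s => ((g \_ (B j)) s)%:E).
  exact/measurable_EFinP.
have mKg : measurable_fun setT (fun s => (K s * g s)%:E).
  by apply/measurable_EFinP; exact: measurable_funM.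
apply: (@le_trans _ _ (\int[mu]_s (\sum_(j < n.+1) (k j * (g \_ (B j)) s)%:E))%E).
  apply: ge0_le_integral => //.
  - by move=> s _; rewrite lee_fin mulr_ge0.
  - by apply: emeasurable_sum => j; exact: mkE.
  - by move=> s _; rewrite sumEFin lee_fin.
rewrite ge0_integral_sum //; last 2 first.
- by move=> j; exact: mkE.
- by move=> j s _; rewrite lee_fin mulr_ge0 // patchE; case: ifP.
apply: (@le_trans _ _ (\sum_(j < n.+1) (8 * c * A * 2 ^- j)%:E)%E).
  apply: lee_sum => j _.
  under eq_integral do rewrite EFinM.
  rewrite ge0_integralZl_EFin //; last 2 first.
  - by move=> s _; rewrite lee_fin patchE; case: ifP.
  - exact: mgE.
  apply: (@le_trans _ _ ((k j)%:E * (2 * (2 ^+ j * d) * A)%:E)%E).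
    rewrite lee_wpmul2l ?lee_fin //.
    rewrite [X in (X <= _)%E](_ : _ = \int[mu]_(s in B j) (g s)%:E)%E; first exact: avg.
    rewrite [RHS]integral_mkcond; apply: eq_integral => s _.
    by rewrite !patchE; case: ifP.
  rewrite -EFinM lee_fin le_eqVlt; apply/orP; left; apply/eqP.
  have -> : k j = 4 * c / d * (2 ^- j) ^+ 2.
    rewrite /k; have -> : (4 : R) ^- j = (2 ^- j) ^+ 2.
      by rewrite exprVn -exprM mulnC exprM; congr (_ ^- _); rewrite -natrX.
    by rewrite mulrAC.
  by field; apply/andP; split; rewrite ?expf_neq0 // gt_eqF.
rewrite sumEFin lee_fin -mulr_sumr.
have := sum_halves n.+1; have : 0 <= 8 * c * A by rewrite !mulr_ge0.
move=> h /(ler_wpM2l h) /le_trans; apply; lra.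
Qed.
End DyadicKernel.

(** * Comparison of the chord |e_s - e_t| with |s - t| *)

Section Chord.
Variable R : realType.
Local Open Scope classical_set_scope.
Local Open Scope ring_scope.
Implicit Types (s t x y : R).

(** By the mean value theorem sin y = y cos c with 0 < c < y, and cos decreases on [0, pi]. *)
Lemma sin_ge_mul_cos y : 0 <= y -> y <= pi -> y * cos y <= sin y.
Proof.
rewrite le_eqVlt => /predU1P[<- _|y0 ypi]; first by rewrite mul0r sin0.
have [|c] := @MVT _ sin cos 0 y y0 (fun x _ => is_derive_sin x).
  by apply: continuous_subspaceT => x; exact: continuous_sin.
rewrite in_itv /= => /andP[c0 cy]; rewrite sin0 !subr0 => ->.
rewrite mulrC ler_pM2r // leNgt; apply/negP => h.
have cpi : c \in `[0, pi] by rewrite in_itv /= ltW // (le_trans (ltW cy)).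
have yI : y \in `[0, pi] by rewrite in_itv /= ltW.
by move: h; rewrite ltr_cos // ltNge (ltW cy).
Qed.

Lemma abs2_chord s t : abs2 (eT s - eT t) = 4 * sin (pi * (s - t)) ^+ 2.
Proof.
have -> : abs2 (eT s - eT t) = 2 - 2 * cos (2 * pi * s - 2 * pi * t).
  rewrite cosB /abs2 !ReImE /=.
  have := cos2Dsin2 (2 * pi * s); have := cos2Dsin2 (2 * pi * t).
  move: (cos _) (sin _) (cos _) (sin _) => a b c d h1 h2.
  nra.
have -> : 2 * pi * s - 2 * pi * t = (pi * (s - t)) *+ 2 by rewrite mulr2n; ring.
rewrite cos_mulr2n sin2cos2; lra.
Qed.

(** Half angles: for y = pi |s - t| / 2, sin 2y = 2 sin y cos y >= 2 y cos^2 y, and |s - t| <= m =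
    max(t, 1 - t) < 1 keeps y away from pi/2, where the cosine vanishes. For t = 0 or 1 no such
    constant exists, as 0 and 1 give the same point of the circle. *)
Lemma chord_lower t : 0 < t -> t < 1 ->
  exists2 c : R, 0 < c & forall s, 0 <= s <= 1 -> c * (s - t) ^+ 2 <= abs2 (eT s - eT t).
Proof.
move=> t0 t1; pose m := Num.max t (1 - t).
have m1 : m < 1 by rewrite /m gt_max t1 /=; lra.
have m0 : 0 < m by rewrite lt_max t0.
have pi0 := pi_gt0 R.
have kappa0 : 0 < cos (pi * m / 2).
  apply: cos_gt0_pihalf; apply/andP; split.
    by apply: lt_trans (_ : 0 < _); [rewrite oppr_lt0 divr_gt0|rewrite divr_gt0 ?mulr_gt0].
  by rewrite ltr_pM2r ?invr_gt0 // -[ltRHS]mulr1 ltr_pM2l.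
exists (4 * (pi * cos (pi * m / 2) ^+ 2) ^+ 2).
  by rewrite !mulr_gt0 ?exprn_gt0 ?mulr_gt0 ?exprn_gt0.
move=> s /andP[s0 s1]; rewrite abs2_chord -mulrA ler_pM2l // -exprMn.
have xm : `|s - t| <= m.
  rewrite ler_norml /m le_max lerNl le_max; apply/andP; split.
    by apply/orP; left; lra.
  by apply/orP; right; lra.
set x := `|s - t| in xm *; have x0 : 0 <= x := normr_ge0 _.
have -> : sin (pi * (s - t)) ^+ 2 = sin (pi * x) ^+ 2.
  rewrite /x; case: (ger0P (s - t)) => // _.
  by rewrite mulrN sinN sqrrN.
rewrite -[leLHS]real_normK ?num_real // normrM -/x ger0_norm; last first.
  by rewrite mulr_ge0 ?exprn_ge0 // ltW.
set kap := cos (pi * m / 2) in kappa0 *.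
pose y := pi * x / 2.
have y0 : 0 <= y by rewrite /y divr_ge0 // mulr_ge0 // ltW.
have ym : y <= pi * m / 2 by rewrite /y ler_pM2r // ler_pM2l.
have mpi : pi * m / 2 <= pi.
  rewrite ler_pdivrMr //; apply: ler_pM => //; [exact: ltW|exact: ltW|lra].
have yin : y \in `[0, pi] by rewrite in_itv /= y0 (le_trans ym).
have min : pi * m / 2 \in `[0, pi] by rewrite in_itv /= mpi (le_trans y0).
have cosy : kap <= cos y.
  rewrite leNgt; apply/negP => h; move: ym; rewrite leNgt => /negP; apply.
  by rewrite -ltr_cos.
have siny : 0 <= y * cos y by rewrite mulr_ge0 // (le_trans _ cosy) // ltW.
have ypi : y <= pi by exact: le_trans ym mpi.
have := sin_ge_mul_cos y0 ypi.
have -> : pi * x = y *+ 2 by rewrite /y mulr2n; field.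
rewrite sin_mulr2n => sy.
have h : pi * kap ^+ 2 * x <= cos y * sin y *+ 2.
  have -> : pi * kap ^+ 2 * x = (kap * (y * kap)) *+ 2 by rewrite /y mulr2n; field.
  rewrite lerMn2r /= ler_pM ?mulr_ge0 //; try exact: ltW.
  by apply: le_trans sy; rewrite ler_wpM2l.
by rewrite !expr2 ler_pM // !mulr_ge0 // ltW.
Qed.
End Chord.

(** * The Cauchy kernel and its integrals *)

Section CauchyKernel.
Variable R : realType.
Local Notation C := R[i].
Local Notation Re := (@complex.Re R).
Local Notation Im := (@complex.Im R).
Local Notation mu := (@lebesgue_measure R).
Local Notation I := (@I01 R).
Local Open Scope classical_set_scope.
Local Open Scope ring_scope.
Local Notation "x %:C" := (real_complex _ x) : ring_scope.
Implicit Types (z w c q : C) (f g h : fT R) (t s r : R).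

(** The square of |1 - q| >= 1 - |q| >= (1 - |q|^2) / 2, proved without moduli. *)
Lemma abs2_1B_ge q : abs2 q <= 1 -> (1 - abs2 q) ^+ 2 / 4 <= abs2 (1 - q).
Proof.
have a0 := abs2_ge0 q; move=> a1.
have -> : abs2 (1 - q) = 1 + abs2 q - 2 * Re q.
  by rewrite /abs2 !ReImE /=; ring.
have := abs2_Re q; move: (abs2 q) (Re q) a0 a1 => a x a0 a1 xa.
rewrite leNgt; apply/negP => h.
have h1 : (1 + a) - (1 - a) ^+ 2 / 4 < 2 * x by lra.
have h2 : 0 < (1 + a) - (1 - a) ^+ 2 / 4 by nra.
have h3 : ((1 + a) - (1 - a) ^+ 2 / 4) ^+ 2 < (2 * x) ^+ 2.
  by rewrite ltr_pXn2r // nnegrE ltW // (lt_trans h2).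
have h4 : (2 * x) ^+ 2 <= 4 * a by nra.
have h5 : 4 * a <= ((1 + a) - (1 - a) ^+ 2 / 4) ^+ 2.
  have -> : ((1 + a) - (1 - a) ^+ 2 / 4) ^+ 2 =
     4 * a + (1 - a) ^+ 2 * (1 - (1 + a) / 2) + ((1 - a) ^+ 2 / 4) ^+ 2 by field.
  rewrite -addrA lerDl addr_ge0 ?sqr_ge0 // mulr_ge0 ?sqr_ge0 //; lra.
lra.
Qed.

(** J 0 = c^n J n tends to 0. This replaces the expansion of the kernel in a geometric series, so
    that no sum is interchanged with an integral. *)
Lemma geom_rec0 c (J : nat -> C) M : abs2 c < 1 ->
  (forall n, J n = c * J n.+1) -> (forall n, abs2 (J n) <= M) -> J 0%N = 0.
Proof.
move=> c1 Jrec JM; apply/eqP; rewrite -abs2_eq0 eq_le abs2_ge0 andbT.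
have Jn n : J 0%N = c ^+ n * J n.
  by elim: n => [|n IH]; rewrite ?expr0 ?mul1r // IH Jrec exprSr mulrA.
have M0 : 0 <= M := le_trans (abs2_ge0 _) (JM 0%N).
have cv : (abs2 c ^+ n * M) @[n --> \oo] --> (0 : R).
  rewrite -[0](mul0r M); apply: cvgM; last exact: cvg_cst.
  by apply: cvg_expr; rewrite ger0_norm ?abs2_ge0.
apply: (ler_cvg_to (cvg_cst (abs2 (J 0%N))) cv); apply: nearW => n.
by rewrite (Jn n) abs2M abs2X ler_wpM2l ?exprn_ge0 ?abs2_ge0.
Qed.

(** The Cauchy (Szego) kernel: for |w| = 1 and |z| < 1 it is w / (w - z), the sum of z^n
    conj(w)^n. *)
Definition ker z : fT R := fun w => (1 - z * w^*)^-1.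

Lemma ker_den z w : abs2 z < 1 -> abs2 w = 1 -> 1 - z * w^* != 0.
Proof.
move=> z1 w1; apply/eqP => /eqP; rewrite subr_eq0 => /eqP h.
have : abs2 (z * w^*) = abs2 z by rewrite abs2M abs2_conj w1 mulr1.
by rewrite -h abs21 => e; rewrite -e ltxx in z1.
Qed.

Lemma ker_bdd z w : abs2 z < 1 -> abs2 w = 1 -> abs2 (ker z w) <= 4 / (1 - abs2 z) ^+ 2.
Proof.
move=> z1 w1; rewrite /ker abs2V -[leRHS]invrK invf_div.
have e : abs2 (z * w^*) = abs2 z by rewrite abs2M abs2_conj w1 mulr1.
rewrite lef_pV2; first by rewrite -e; apply: abs2_1B_ge; rewrite e ltW.
  by rewrite posrE lt_def abs2_eq0 ker_den // abs2_ge0.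
by rewrite posrE divr_gt0 // exprn_gt0 // subr_gt0.
Qed.

Lemma measT_ker z : abs2 z < 1 -> measT (ker z).
Proof.
move=> z1; apply: contT_measT; apply: contT_inv => [w w1|]; first exact: ker_den.
apply: contTB; first exact: contT_cst.
by apply: contTM; [exact: contT_cst|apply: contT_conj; exact: contT_id].
Qed.

Lemma L2_ker z : abs2 z < 1 -> L2 (ker z).
Proof. by move=> z1; apply: L2_bdd (measT_ker z1) _ => w; exact: ker_bdd. Qed.

Lemma Linf_ker z : abs2 z < 1 -> Linf (ker z).
Proof. by move=> z1; apply: Linf_bdd (measT_ker z1) _ => w; exact: ker_bdd. Qed.

Lemma kerE z w : abs2 z < 1 -> abs2 w = 1 -> ker z w = 1 + z * w^* * ker z w.
Proof.
move=> z1 w1; have := ker_den z1 w1; rewrite /ker => h.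
by field.
Qed.

Lemma Linf_Xn n : Linf (fun w : C => w ^+ n).
Proof.
by apply: (@Linf_bdd _ _ 1 (measT_Xn R n)) => w w1; rewrite abs2X w1 expr1n.
Qed.

Lemma fcoef_nat f (n : nat) : fcoef f n = cint (fun w => f w * (w^*) ^+ n).
Proof.
apply: eq_cint => w w1; congr (_ * _).
by rewrite -exprnN -exprVn unit_inv.
Qed.

(** By [kerE], the integrals J n of f conj(w)^n ker satisfy J n = fcoef f n + z J (n + 1). The
    coefficients vanish, and Cauchy-Schwarz bounds J n independently of n. *)
Lemma cint_ker0 f z : L2 f -> abs2 z < 1 ->
  (forall n : nat, fcoef f n = 0) -> cint (fun w => f w * ker z w) = 0.
Proof.
move=> Lf z1 f0.
pose J n := cint (fun w => f w * ((w^*) ^+ n * ker z w)).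
have LX n : L2 (fun w : C => (w^*) ^+ n * ker z w).
  apply: L2_Linf (L2_ker z1); have := Linf_conj (Linf_Xn n).
  by under eq_fun do rewrite rmorphXn.
have -> : cint (fun w => f w * ker z w) = J 0%N.
  by congr cint; apply/funext => w; rewrite expr0 mul1r.
apply: (@geom_rec0 z J (nrm f * nrm (fun w => (ker z w)^*)) z1) => n.
  have -> : J n = cint (fun w => f w * (w^*) ^+ n + z * (f w * ((w^*) ^+ n.+1 * ker z w))).
    by apply: eq_cint => w w1; rewrite [in LHS]kerE // exprS; ring.
  rewrite cintD ?cintZ.
  - by rewrite -fcoef_nat f0 add0r.
  - exact: cintegrableM.
  - apply: cintegrableM => //; apply: eq_L2 (L2_X R (- n%:Z)) => w w1.
    by rewrite -exprnN -exprVn unit_inv.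
  - by apply: cintegrableZ; exact: cintegrableM.
have -> : J n = inner f (fun w => ((w^*) ^+ n * ker z w)^*).
  by congr cint; apply/funext => w; rewrite conjc_invol.
apply: le_trans (cauchy_schwarz Lf (L2_conj (LX n))) _.
rewrite ler_wpM2l ?nrm_ge0 // le_eqVlt; apply/orP; left; apply/eqP.
apply: eq_Rintegral => t _.
by rewrite !abs2_conj abs2M abs2X abs2_conj abs2_eT expr1n mul1r.
Qed.

Lemma fcoef_conj f (k : int) : L2 f -> fcoef (fun w => (f w)^*) k = (fcoef f (- k))^*.
Proof.
move=> Lf; rewrite /fcoef -cint_conj.
  apply: eq_cint => w w1; rewrite conjcM; congr (_ * _).
  by rewrite opprK -unit_inv ?abs2_Xz // invr_expz.
by apply: cintegrableM => //; exact: L2_X.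
Qed.

Lemma eT_Xn t (n : nat) : eT t ^+ n = eT (n%:R * t).
Proof.
elim: n => [|n IH]; first by apply: complex_eq; rewrite mul0r /= mulr0 ?cos0 ?sin0.
rewrite exprS IH -natr1 mulrDl mul1r.
by apply: complex_eq; rewrite !ReImE /= !mulrDr ?cosD ?sinD; ring.
Qed.

Lemma eT1 : eT 1 = 1 :> C.
Proof.
by rewrite -[1 in LHS]subr0 eT_onem; apply: complex_eq; rewrite eTV ReImE /= mulr0 ?cos0 ?sin0 ?oppr0.
Qed.

Lemma Rintegral_FTC (F G : R -> R) : (forall t, is_derive t 1 F (G t)) ->
  continuous G -> Rintegral mu I G = F 1 - F 0.
Proof.
move=> dF cG; rewrite /Rintegral /I01 (@continuous_FTC2 _ G F) //.
- exact: continuous_subspaceT.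
- have cF : continuous F.
    by move=> t; apply/differentiable_continuous/derivable1_diffP; case: (dF t).
  split => [t _|//|//]; first by case: (dF t).
    exact/cvg_at_right_filter/cF.
  exact/cvg_at_left_filter/cF.
- by move=> t _; rewrite derive1E; case: (dF t).
Qed.

Lemma cint_Xn n : cint (fun w : C => w ^+ n.+1) = 0.
Proof.
pose a : R := 2 * pi * n.+1%:R.
have a0 : a != 0 by rewrite !mulf_neq0 // gt_eqF // pi_gt0.
have eTa t : eT t ^+ n.+1 = Complex (cos (a * t)) (sin (a * t)).
  by rewrite eT_Xn /eT /a mulrA.
have dmul t : is_derive t 1 (fun t => a * t) a.
  by apply: is_derive_eq; rewrite scaler1.
have c1 : cos a = 1 /\ sin a = 0.
  have := eTa 1; rewrite eT1 expr1n mulr1 => -[] -> ->; by [].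
have cmul : continuous (fun t => a * t) by exact: mulrl_continuous.
have dsin t : is_derive t 1 (fun t => a^-1 * sin (a * t)) (cos (a * t)).
  by apply: is_derive_eq; rewrite /GRing.scale /=; field.
have dcos t : is_derive t 1 (fun t => - a^-1 * cos (a * t)) (sin (a * t)).
  by apply: is_derive_eq; rewrite /GRing.scale /=; field.
apply: complex_eq => /=; under eq_Rintegral do rewrite eTa /=.
  rewrite (Rintegral_FTC dsin); first by rewrite mulr1 mulr0 sin0 c1.2 subrr.
  by move=> t; apply: continuous_comp; [exact: cmul|exact: continuous_cos].
rewrite (Rintegral_FTC dcos); first by rewrite mulr1 mulr0 cos0 c1.1 subrr.
by move=> t; apply: continuous_comp; [exact: cmul|exact: continuous_sin].
Qed.

Lemma cint1 : cint (fun _ : C => 1) = 1 :> C.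
Proof.
apply: complex_eq => /=; rewrite Rintegral_cst ?mul0r //; try exact: measurable_itv.
by rewrite [X in fine X]mu_I mulr1.
Qed.

Lemma cint_ker1 z : abs2 z < 1 -> cint (ker z) = 1.
Proof.
move=> z1.
have -> : cint (ker z) = cint (fun w => 1 + z * (w^* * ker z w)).
  by apply: eq_cint => w w1; rewrite [in LHS]kerE // mulrA.
have Lc : L2 (fun w : C => w^*).
  by apply: L2_conj; apply: eq_L2 (L2_X R 1) => w _; rewrite expr1z.
rewrite cintD ?cintZ.
- rewrite cint_ker0 ?mulr0 ?addr0 ?cint1 //.
  have conj0 : (0 : C)^* = 0 by apply: complex_eq; rewrite !ReImE /= ?oppr0.
  move=> n; rewrite fcoef_nat -[RHS]conj0 -(cint_Xn n) -cint_conj.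
    by apply: eq_cint => w w1; rewrite rmorphXn -exprS.
  by apply: cintegrable_L2; exact: (L2_X R n.+1).
- exact: cintegrableM Lc (L2_ker z1).
- by apply: cintegrable_L2; exact: L2_cst.
- by apply: cintegrableZ; exact: cintegrableM Lc (L2_ker z1).
Qed.

End CauchyKernel.

(** * The Poisson kernel and its domination by averages *)

Section Poisson.
Variable R : realType.
Local Notation C := R[i].
Local Notation Re := (@complex.Re R).
Local Notation Im := (@complex.Im R).
Local Notation mu := (@lebesgue_measure R).
Local Notation I := (@I01 R).
Local Open Scope classical_set_scope.
Local Open Scope ring_scope.
Local Notation "x %:C" := (real_complex _ x) : ring_scope.
Implicit Types (z w c q : C) (f g h : fT R) (t s r : R).

Definition pois z w : R := (1 - abs2 z) / abs2 (w - z).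

Lemma abs2_subz z w : abs2 w = 1 -> abs2 (w - z) = abs2 (1 - z * w^*).
Proof.
move=> w1; have -> : w - z = w * (1 - z * w^*); last by rewrite abs2M w1 mul1r.
by rewrite mulrBr mulr1 mulrCA abs2E w1 mulr1.
Qed.

(** Twice the real part of the Cauchy kernel minus 1: a Poisson integral thus becomes two Cauchy
    integrals, which Fourier coefficients control. *)
Lemma poisE z w : abs2 z < 1 -> abs2 w = 1 ->
  (pois z w)%:C = ker z w + (ker z w)^* - 1.
Proof.
move=> z1 w1; have den := ker_den z1 w1.
have den2 : (1 - z * w^*)^* != 0.
  by rewrite -abs2_eq0 abs2_conj abs2_eq0.
have z2 : z * z^* = (z * w^*) * (z * w^*)^*.
  by rewrite conjcM conjc_invol mulrACA [w^* * w]mulrC (abs2E w) w1 mulr1.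
have kc : (ker z w)^* = ((1 - z * w^*)^*)^-1 by rewrite /ker fmorphV.
rewrite kc /pois abs2_subz // rmorphM /= rmorphB /= -abs2E z2.
have -> : (abs2 (1 - z * w^*))^-1%:C = ((1 - z * w^*) * (1 - z * w^*)^*)^-1.
  by rewrite abs2E fmorphV.
rewrite /ker; have e : (1 - z * w^*)^* = 1 - (z * w^*)^*.
  by rewrite conjcB; congr (_ - _); apply: complex_eq; rewrite !ReImE /= ?oppr0.
rewrite e in den2 *; move: (z * w^*) ((z * w^*)^*) den den2 => q q' den den2.
by field; rewrite den den2.
Qed.

Lemma pois_ge0 z w : abs2 z < 1 -> 0 <= pois z w.
Proof. by move=> z1; rewrite divr_ge0 ?abs2_ge0 // subr_ge0 ltW. Qed.

Lemma cint_pois f z : L2 f -> abs2 z < 1 ->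
  cint (fun w => f w * (pois z w)%:C) =
  cint (fun w => f w * ker z w) + cint (fun w => f w * (ker z w)^*) - cint f.
Proof.
move=> Lf z1; have Lk := L2_ker z1; have Lk' := L2_conj Lk.
rewrite -cintD ?cintM; [|exact: cintegrableM|exact: cintegrableM].
rewrite -cintB; last exact: cintegrable_L2.
  by apply: eq_cint => w w1; rewrite poisE //; ring.
by apply: cintegrableD; exact: cintegrableM.
Qed.

Lemma pois_lt1 t r : 0 <= r -> r < 1 -> abs2 (r%:C * eT t) < 1.
Proof. by move=> r0 r1; rewrite abs2M abs2C abs2_eT mulr1 expr_lt1. Qed.

Lemma pois_cont z : abs2 z < 1 -> continuous (fun s => pois z (eT s)).
Proof.
move=> z1.
have [c1 _] : contT (fun w => (w - z)^-1).
  apply: contT_inv; last by apply: contTB; [exact: contT_id|exact: contT_cst].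
  move=> w w1; rewrite -abs2_eq0 abs2_subz // abs2_eq0; exact: ker_den.
have [c2 c3] : contT (fun w => (w - z)^-1).
  apply: contT_inv; last by apply: contTB; [exact: contT_id|exact: contT_cst].
  move=> w w1; rewrite -abs2_eq0 abs2_subz // abs2_eq0; exact: ker_den.
move=> s; apply: cvgM; first exact: cvg_cst.
under eq_fun do rewrite -abs2V /abs2.
rewrite -abs2V; apply: cvgD; under eq_fun do rewrite expr2; apply: cvgM;
  [exact: c2|exact: c2|exact: c3|exact: c3].
Qed.

Lemma pois_int1 z : abs2 z < 1 -> Rintegral mu I (fun s => pois z (eT s)) = 1.
Proof.
move=> z1; have := cint_pois (L2_cst 1) z1.
have -> : cint (fun w => 1 * ker z w) = 1.
  by rewrite -[RHS](cint_ker1 z1); congr cint; apply/funext => w; rewrite mul1r.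
have -> : cint (fun w => 1 * (ker z w)^*) = 1.
  transitivity (cint (ker z))^*.
    rewrite -cint_conj; last exact/cintegrable_L2/L2_ker.
    by congr cint; apply/funext => w; rewrite mul1r.
  by rewrite cint_ker1 //; apply: complex_eq; rewrite !ReImE /= ?oppr0.
rewrite cint1 addrK => /(congr1 Re) /= <-.
by apply: eq_Rintegral => s _; rewrite mul1r mul0r subr0.
Qed.

Lemma pois_bounds t : 0 < t -> t < 1 -> exists2 c : R, 0 < c &
  forall r s, 0 <= r -> r < 1 -> 0 <= s <= 1 ->
  pois (r%:C * eT t) (eT s) <= c / (1 - r) /\
  pois (r%:C * eT t) (eT s) * (s - t) ^+ 2 <= c * (1 - r).
Proof.
move=> t0 t1; have [k k0 hk] := chord_lower t0 t1.
(* With D the denominator, the numerator is at most 2 (1 - r). The bound D >= (1 - r)^2 accounts for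
   2, and 4 D >= |e_s - e_t|^2 >= k (s - t)^2 accounts for 8 / k. *)
exists (2 + 8 / k); first by rewrite addr_gt0 // divr_gt0.
move=> r s r0 r1 sI; have chord := hk s sI.
have num : 1 - abs2 (r%:C * eT t) = (1 - r) * (1 + r).
  by rewrite abs2M abs2C abs2_eT mulr1; ring.
set D := abs2 (eT s - r%:C * eT t).
have D1 : (1 - r) ^+ 2 <= D.
  have -> : D = abs2 (eT (s - t) - r%:C).
    rewrite -eTB -[RHS]mulr1 -(abs2_eT t) -abs2M mulrBl; congr abs2.
    by rewrite -mulrA [_^* * _]mulrC abs2E abs2_eT mulr1.
  have := abs2_eT (s - t); rewrite /abs2 !ReImE /= oppr0 addr0.
  have := cos_le1 (2 * pi * (s - t)); move: (cos _) (sin _) => x y; nra.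
have D2 : abs2 (eT s - eT t) <= 4 * D.
  have -> : eT s - eT t = (eT s - r%:C * eT t) + (r%:C - 1) * eT t by ring.
  apply: le_trans (abs2D_le _ _) _; rewrite abs2M abs2_eT mulr1.
  have -> : abs2 (r%:C - 1) = (1 - r) ^+ 2.
    by rewrite /abs2 !ReImE /=; ring.
  by rewrite -/D; lra.
have d0 : 0 < 1 - r by rewrite subr_gt0.
have Dp : 0 < D by apply: lt_le_trans D1; rewrite exprn_gt0.
have cpos : 0 < 8 / k by rewrite divr_gt0.
rewrite /pois num -/D; split.
  apply: (@le_trans _ _ (2 / (1 - r))); last by rewrite ler_pM2r ?invr_gt0 // lerDl ltW.
  rewrite ler_pdivrMr // mulrAC ler_pdivlMr //.
  by rewrite mulrAC; nra.
have -> : (1 - r) * (1 + r) / D * (s - t) ^+ 2 = (1 - r) * (1 + r) * ((s - t) ^+ 2 / D).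
  by field; rewrite gt_eqF.
apply: (@le_trans _ _ ((1 - r) * 2 * (4 / k))).
  apply: ler_pM.
  - by apply: mulr_ge0; [exact: ltW|rewrite addr_ge0].
  - by rewrite divr_ge0 ?sqr_ge0 // ltW.
  - by rewrite ler_pM2l //; lra.
  - by rewrite ler_pdivrMr // mulrAC ler_pdivlMr // mulrC; lra.
rewrite [leRHS]mulrC -mulrA ler_pM2l //.
by rewrite mulrA; lra.
Qed.

(* The constant depends on [t], since the chord [|e_s - e_t|] is comparable to
   [|s - t|] on the non-periodic interval [0,1] only away from the endpoints. *)
Lemma poisson_le_avg t : 0 < t -> t < 1 -> exists2 c : R, 0 < c &
  forall (g : R -> R) (A r : R), measurable_fun I g -> (forall s, I s -> 0 <= g s) ->
  0 <= A -> 0 <= r -> r < 1 ->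
  (forall e, 0 < e -> (\int[mu]_(s in ball t e) ((g \_ I) s)%:E <= (2 * e * A)%:E)%E) ->
  (\int[mu]_(s in I) (pois (r%:C * eT t) (eT s) * g s)%:E <= (c * A)%:E)%E.
Proof.
move=> t0 t1; have [c c0 hc] := pois_bounds t0 t1.
exists (16 * c); first by rewrite mulr_gt0.
move=> g A r mg g0 A0 r0 r1 avg; have z1 := pois_lt1 t r0 r1.
have mK : measurable_fun setT (fun s => pois (r%:C * eT t) (eT s)).
  exact: continuous_measurable_fun (pois_cont z1).
have mI : measurable I := @measurable_I R.
have mgI : measurable_fun setT (g \_ I) by apply/(measurable_restrictT _ _).1.
have gI s : (g \_ I) s != 0 -> I s.
  by rewrite patchE; case: ifP => [|_ /eqP //]; rewrite inE.
rewrite (_ : (\int[mu]_(s in I) _)%E = (\int[mu]_s (pois (r%:C * eT t) (eT s) * (g \_ I) s)%:E)%E).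
  apply: (@dyadic_kernel_bound R _ _ t (1 - r) c A mK mgI) => //.
  - by move=> s; rewrite patchE; case: ifPn => // /[!inE] /g0.
  - by move=> s; exact: pois_ge0.
  - by rewrite subr_gt0.
  - exact: ltW.
  - move=> s st; rewrite patchE; case: ifPn => // /[!inE].
    rewrite /I01 /= in_itv /= => /andP[s0 s1]; move: st; rewrite ltNge => /negP[].
    by rewrite ler_norml; apply/andP; split; lra.
  - by move=> s /gI sI; have [] := hc r s r0 r1 sI.
  - by move=> s /gI sI; have [] := hc r s r0 r1 sI.
rewrite integral_mkcond; apply: eq_integral => s _.
by rewrite !patchE; case: ifP => // _; rewrite mulr0.
Qed.

End Poisson.

(** * Poisson integrals at Lebesgue points and Fourier uniqueness *)

Section Uniqueness.
Variable R : realType.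
Local Notation C := R[i].
Local Notation Re := (@complex.Re R).
Local Notation Im := (@complex.Im R).
Local Notation mu := (@lebesgue_measure R).
Local Notation I := (@I01 R).
Local Open Scope classical_set_scope.
Local Open Scope ring_scope.
Local Notation int1 phi := (mu.-integrable I (EFin \o phi)).
Local Notation "x %:C" := (real_complex _ x) : ring_scope.
Implicit Types (z w c q : C) (f g h : fT R) (t s r : R).

Let mI : measurable I := @measurable_I R.
Let mI' : @measurable _ (measurableTypeR R) I := @measurable_I R.

(** The coefficients of index n >= 0 remove the integral against [ker], those of index -n the one
    against its conjugate, after conjugating [f]. *)
Lemma cint_pois0 f z : L2 f -> (forall k : int, fcoef f k = 0) -> abs2 z < 1 ->
  cint (fun w => f w * (pois z w)%:C) = 0.
Proof.
move=> Lf f0 z1; rewrite cint_pois // cint_ker0 //.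
have -> : cint f = 0.
  by rewrite -(f0 0); apply: eq_cint => w _; rewrite oppr0 expr0z mulr1.
have conj0 : (0 : C)^* = 0 by apply: complex_eq; rewrite !ReImE /= ?oppr0.
suff -> : cint (fun w => f w * (ker z w)^*) = 0 by rewrite subr0 addr0.
have Lf' := L2_conj Lf; have Lk := L2_ker z1.
transitivity (cint (fun w => (f w)^* * ker z w))^*.
  rewrite -cint_conj; last exact: cintegrableM.
  by congr cint; apply/funext => w; rewrite conjcM conjc_invol.
by rewrite cint_ker0 // => n; rewrite fcoef_conj // f0 conj0.
Qed.

Lemma lebesgue_pt_avg (phi : R -> R) t (eps : R) : lebesgue_pt phi t -> 0 < eps ->
  exists2 eta : R, 0 < eta & forall e, 0 < e -> e < eta ->
  (\int[mu]_(s in ball t e) `|phi s - phi t|%:E <= (2 * e * eps)%:E)%E.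
Proof.
move=> + eps0; rewrite /lebesgue_pt => /fine_cvgP[fin /cvgrPdist_lt /(_ _ eps0) lim].
have [eta /= eta0 h] : \forall e \near (0:R)^'+,
    (davg phi t e \is a fin_num) /\ `|0 - fine (davg phi t e)| < eps.
  by near=> e; split; near: e.
exists eta => // e e0 ee.
have [fn lt] : (davg phi t e \is a fin_num) /\ `|0 - fine (davg phi t e)| < eps.
  by apply: h => //=; rewrite sub0r normrN gtr0_norm.
have {lt} : (davg phi t e <= eps%:E)%E.
  rewrite -(fineK fn) lee_fin; apply: le_trans (ler_norm _) _.
  by move: lt; rewrite sub0r normrN => /ltW.
rewrite /davg /iavg (lebesgue_measure_ball _ (ltW e0)) inver mulrn_eq0 /= gt_eqF //.
rewrite lee_pdivrMl; last by rewrite pmulrn_rgt0.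
rewrite -EFinM /comp /= => le; apply: le_trans le _.
by rewrite lee_fin -[e *+ 2]mulr_natl.
Unshelve. all: by end_near. Qed.

(** The kernel has mean 1 and annihilates [phi], so |phi t| is at most the integral of K |phi - phi
    t|. Inside the ball of radius b this is controlled by averages through [poisson_le_avg], outside
    by the decay of the kernel; each part is at most |phi t| / 4 once r is close to 1. *)
Lemma poisson_lebesgue_pt (phi : R -> R) t : int1 phi -> 0 < t -> t < 1 ->
  lebesgue_pt (phi \_ I) t ->
  (forall r, 0 <= r -> r < 1 ->
     Rintegral mu I (fun s => phi s * pois (r%:C * eT t) (eT s)) = 0) ->
  phi t = 0.
Proof.
move=> iphi t0 t1 leb P0.
have It : I t by rewrite /I01 /= in_itv /= !ltW.
have [c c0 hc] := poisson_le_avg t0 t1.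
have [c' c'0 hc'] := pois_bounds t0 t1.
apply/eqP; rewrite -normr_le0 leNgt; apply/negP => a0.
pose a := `|phi t|; rewrite -/a in a0.
(* The near part is at most c eps = a / 4. *)
pose eps := a / (4 * c); have eps0 : 0 < eps by rewrite divr_gt0 // mulr_gt0.
have [eta eta0 heta] := lebesgue_pt_avg leb eps0.
pose psi s := `|phi s - phi t|.
have ipsi : int1 psi by apply: integrable_norm; apply: int1B => //; exact: int1_cst.
have psi0 s : 0 <= psi s := normr_ge0 _.
have mpsi := int1_meas ipsi.
pose S := Rintegral mu I psi.
have S0 : 0 <= S by apply: Rintegral_ge0.
pose b := eta / 2; have b0 : 0 < b by rewrite divr_gt0.
have beta : b < eta by rewrite /b ltr_pdivrMr // mulr_natr mulr2n ltrDl.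
(* Off the ball K <= c' d / b^2, so the second entry makes the far part at most a / 4; S + 1
   replaces S to keep the denominator positive, and 1/2 ensures r >= 0. *)
pose d := Num.min (1 / 2) (a * b ^+ 2 / (4 * c' * (S + 1))).
have den : 0 < 4 * c' * (S + 1) by rewrite !mulr_gt0 // ltr_wpDl.
have d0 : 0 < d by rewrite lt_min divr_gt0 //= divr_gt0 // mulr_gt0 // exprn_gt0.
have d1 : d <= 1 / 2 by rewrite ge_min lexx.
have d2 : d <= a * b ^+ 2 / (4 * c' * (S + 1)) by rewrite ge_min lexx orbT.
pose r := 1 - d.
have r0 : 0 <= r by rewrite /r; lra.
have r1 : r < 1 by rewrite /r; lra.
have z1 := pois_lt1 t r0 r1.
pose K s := pois (r%:C * eT t) (eT s).
have K0 s : 0 <= K s by exact: pois_ge0.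
have mK : measurable_fun I K.
  exact: measurable_funTS (continuous_measurable_fun (pois_cont z1)).
have Kle s : I s -> K s <= c' / d.
  move=> Is; have [] := hc' r s r0 r1 Is.
  by rewrite /r opprB addrCA subrr addr0.
have iK (u : R -> R) : int1 u -> int1 (fun s => K s * u s).
  move=> iu; apply: (@int1_le _ _ (fun s => c' / d * `|u s|)).
  - by apply: measurable_funM => //; exact: int1_meas.
  - by move=> s Is; rewrite normrM ger0_norm // ler_wpM2r // Kle.
  - exact/int1Z/integrable_norm.
have iK1 : int1 K.
  by apply: int1_le (int1_cst (c' / d)) => // s Is; rewrite ger0_norm // Kle.
have iPK : int1 (fun s => phi s * K s).
  by rewrite (_ : (fun s => _) = (fun s => K s * phi s)); [exact: iK|apply/funext => s; rewrite mulrC].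
pose B : set R := ball t b.
pose g1 : R -> R := psi \_ B; pose g2 : R -> R := psi \_ (~` B).
have g12 s : psi s = g1 s + g2 s.
  rewrite /g1 /g2 !patchE in_setC; case: (s \in B) => /=.
    by rewrite addr0.
  by rewrite add0r.
have g10 s : 0 <= g1 s by rewrite /g1 patchE; case: ifP.
have g20 s : 0 <= g2 s by rewrite /g2 patchE; case: ifP.
have mball : measurable B by exact: measurable_ball.
have mg1 : measurable_fun I g1.
  by apply/measurable_restrict => //; exact: measurable_funS mpsi.
have mg2 : measurable_fun I g2.
  by apply/measurable_restrict => //; [exact: measurableC|exact: measurable_funS mpsi].
have aK : (a%:E <= \int[mu]_(s in I) (K s * psi s)%:E)%E.
  have e1 : Rintegral mu I (fun s => K s * (phi t - phi s)) = phi t.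
    have -> : Rintegral mu I (fun s => K s * (phi t - phi s)) =
        Rintegral mu I (fun s => phi t * K s - phi s * K s).
      by apply: eq_Rintegral => s _; ring.
    rewrite RintegralB //.
    - by rewrite P0 // subr0 RintegralZl // pois_int1 // mulr1.
    - exact: int1Z.
  have iKd : int1 (fun s => K s * (phi t - phi s)).
    by apply/iK/int1B => //; exact: int1_cst.
  have := le_normr_Rintegral mI' iKd; rewrite e1 -/a -lee_fin.
  rewrite [X in (_ <= X)%E -> _](_ : _ = \int[mu]_(s in I) (K s * psi s)%:E)%E //.
  rewrite /Rintegral fineK; last exact: integrable_fin_num (integrable_norm iKd).
  by apply: eq_integral => s _; rewrite normrM ger0_norm // distrC.
have split : (\int[mu]_(s in I) (K s * psi s)%:E =
   \int[mu]_(s in I) (K s * g1 s)%:E + \int[mu]_(s in I) (K s * g2 s)%:E)%E.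
  rewrite -ge0_integralD //.
  - by apply: eq_integral => s _; rewrite g12 mulrDr.
  - by move=> s _; rewrite lee_fin mulr_ge0.
  - by apply/measurable_EFinP; exact: measurable_funM.
  - by move=> s _; rewrite lee_fin mulr_ge0.
  - by apply/measurable_EFinP; exact: measurable_funM.
have nearB : (\int[mu]_(s in I) (K s * g1 s)%:E <= (c * eps)%:E)%E.
  apply: hc => //; first exact: ltW.
  move=> e e0; pose w s := `|(phi \_ I) s - (phi \_ I) t|.
  (* [g1] lives on the ball of radius b < eta, so a larger radius e may be cut down to b, and the
     Lebesgue point estimate below eta covers every radius. *)
  have e'0 : 0 < Num.min e b by rewrite lt_min e0.
  have e'eta : Num.min e b < eta by rewrite gt_min beta orbT.
  have := heta _ e'0 e'eta => {}heta.
  apply: le_trans (le_trans _ heta) _; last first.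
    by rewrite lee_fin ler_pM2r // ler_pM2l // ge_min lexx.
  have mbe : measurable (ball t e : set R) by exact: measurable_ball.
  have mphi : measurable_fun setT (phi \_ I).
    by apply/(measurable_restrictT _ _).1 => //; exact: int1_meas.
  have mw : measurable_fun setT w.
    by apply: measurableT_comp => //; apply: measurable_funB => //; exact: measurable_cst.
  have -> : ball t (Num.min e b) = ball t e `&` B.
    by apply/seteqP; split => s; rewrite /B /ball /= lt_min => /andP.
  rewrite integral_mkcondr; apply: ge0_le_integral => //.
  - by move=> s _; rewrite lee_fin patchE; case: ifP.
  - apply/measurable_EFinP; apply: measurable_funTS.
    by apply/(measurable_restrictT _ _).1.
  - apply: measurable_funTS; apply/(measurable_restrictT _ _).1 => //.
    exact/measurable_EFinP/measurable_funTS.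
  - move=> s _; rewrite !patchE /g1 patchE.
    have [sI|sI] := boolP (s \in I); last by case: ifP => _; rewrite lee_fin /w ?normr_ge0.
    have [sB|sB] := boolP (s \in B); last by rewrite lexx.
    by rewrite /psi /w lee_fin ?patchE ?sI ?(mem_set It).
have farB : (\int[mu]_(s in I) (K s * g2 s)%:E <= (a / 4)%:E)%E.
  apply: (@le_trans _ _ (\int[mu]_(s in I) ((c' * d / b ^+ 2)%:E * (psi s)%:E))%E).
    apply: ge0_le_integral => //.
    - by move=> s _; rewrite lee_fin mulr_ge0.
    - by apply/measurable_EFinP; exact: measurable_funM.
    - apply: emeasurable_funM; first exact: measurable_cst.
      exact/measurable_EFinP.
    move=> s Is; rewrite -EFinM lee_fin /g2 patchE; case: ifPn; last first.
      by rewrite mulr0 mulr_ge0 // divr_ge0 ?sqr_ge0 // mulr_ge0 // ltW.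
    rewrite in_setC => sB; rewrite ler_wpM2r //.
    have [_] := hc' r s r0 r1 Is; rewrite {2}/r opprB addrCA subrr addr0 -/(K s) => h.
    rewrite ler_pdivlMr ?exprn_gt0 //; apply: le_trans h.
    rewrite ler_wpM2l // -[leRHS]real_normK ?num_real // !expr2.
    have bs : b <= `|s - t|.
      by rewrite leNgt; apply: contra sB => h; rewrite inE /B /ball /= distrC.
    by rewrite ler_pM // ltW.
  rewrite ge0_integralZl_EFin //; last 3 first.
  - by move=> s _; rewrite lee_fin.
  - exact/measurable_EFinP.
  - by rewrite divr_ge0 ?sqr_ge0 // mulr_ge0 // ltW.
  have -> : (\int[mu]_(s in I) (psi s)%:E = S%:E)%E.
    by rewrite /S /Rintegral fineK //; exact: integrable_fin_num.
  rewrite -EFinM lee_fin.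
  apply: (@le_trans _ _ (c' * (a * b ^+ 2 / (4 * c' * (S + 1))) / b ^+ 2 * (S + 1))).
    apply: ler_pM => //.
    - by rewrite divr_ge0 ?sqr_ge0 // mulr_ge0 // ltW.
    - by rewrite ler_pM2r ?invr_gt0 ?exprn_gt0 // ler_pM2l.
    - by rewrite lerDl.
  rewrite le_eqVlt; apply/orP; left; apply/eqP; field.
  by rewrite !gt_eqF // ltr_wpDl.
have := aK; rewrite split => /le_trans /(_ (leeD nearB farB)).
rewrite -EFinD lee_fin.
have -> : c * eps = a / 4 by rewrite /eps; field; rewrite gt_eqF.
by lra.
Qed.

Lemma endpoints_ae : {ae mu, forall t, I t -> 0 < t /\ t < 1}.
Proof.
exists ([set 0] `|` [set 1]); split.
- by apply: measurableU; exact: measurable_set1.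
- apply/eqP; rewrite -measure_le0.
  apply: (@le_trans _ _ (mu [set 0%R] + mu [set 1%R])%E).
    by apply: measureU2; exact: measurable_set1.
  by rewrite !lebesgue_measure_set1 adde0.
- move=> t /= /not_implyP[]; rewrite /I01 /= in_itv /= => /andP[t0 t1] h.
  have [t00|t00] := eqVneq t 0; [by left|right].
  apply/eqP; rewrite eq_le t1 leNgt; apply/negP => t11; apply: h.
  by rewrite lt_def t00 t0.
Qed.

(** All Poisson integrals vanish, and by Lebesgue differentiation almost every t is a Lebesgue point
    of the real and of the imaginary part, extended by 0 outside [I]. *)
Lemma fourier_uniqueness f : L2 f -> (forall k : int, fcoef f k = 0) -> aeT f (fun=> 0).
Proof.
move=> Lf f0; have [iRe iIm] := cintegrable_L2 Lf.
have part (phi : R -> R) : int1 phi ->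
    (forall z, abs2 z < 1 -> Rintegral mu I (fun s => phi s * pois z (eT s)) = 0) ->
    {ae mu, forall t, I t -> phi t = 0}.
  move=> iphi phi0.
  have lebphi := lebesgue_differentiation (integrable_locally_restrict mI iphi).
  apply: (ae_imp2 _ endpoints_ae lebphi) => t h lt It.
  have [t0 t1] := h It.
  apply: poisson_lebesgue_pt => // r r0 r1; apply: phi0; exact: pois_lt1.
have aeRe : {ae mu, forall t, I t -> Re (f (eT t)) = 0}.
  apply: part => // z z1; have /(congr1 Re) /= := cint_pois0 Lf f0 z1.
  by move=> h; rewrite -[RHS]h; apply: eq_Rintegral => s _; rewrite !ReImE /= mulr0 subr0.
have aeIm : {ae mu, forall t, I t -> Im (f (eT t)) = 0}.
  apply: part => // z z1; have /(congr1 Im) /= := cint_pois0 Lf f0 z1.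
  by move=> h; rewrite -[RHS]h; apply: eq_Rintegral => s _; rewrite !ReImE /= mulr0 add0r.
apply: ae_imp2 aeRe aeIm => t hRe hIm; rewrite inE => It.
by apply: complex_eq; rewrite ?hRe ?hIm.
Qed.

End Uniqueness.

(** * Completeness and the Hardy projection *)

Section FastLimits.
Variable R : realType.
Local Notation C := R[i].
Local Notation Re := (@complex.Re R).
Local Notation Im := (@complex.Im R).
Local Notation mu := (@lebesgue_measure R).
Local Notation I := (@I01 R).
Local Open Scope classical_set_scope.
Local Open Scope ring_scope.
Implicit Types (z w c q : C) (f g h : fT R) (t s r : R).

Let mI : measurable I := @measurable_I R.
Let mI' : @measurable _ (measurableTypeR R) I := @measurable_I R.

(** Borel-Cantelli: the exceptional points lie in the limit superior of the sets [A], whose measures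
    sum to at most 2 c. *)
Lemma ae_eventually_notin (A : nat -> set R) (c : R) :
  (forall j, measurable (A j)) -> (forall j, (mu (A j) <= (c * 2 ^- j)%:E)%E) ->
  {ae mu, forall t, exists N, forall j, (N <= j)%N -> ~ A j t}.
Proof.
move=> mA Ac; exists (lim_sup_set A); split.
- apply: bigcap_measurable => // k _.
  by apply: bigcup_measurable => j _; exact: mA.
- apply: lim_sup_set_cvg0 => //.
  have c0 : 0 <= c.
    by have := Ac 0%N; rewrite expr0 invr1 mulr1 => /(le_trans (measure_ge0 _ _)).
  apply: (@le_lt_trans _ _ (2 * c)%:E); last exact: ltry.
  apply: lime_le; first by apply: is_cvg_nneseries => n _ _; exact: measure_ge0.
  apply: nearW => n; apply: (@le_trans _ _ (\sum_(0 <= j < n) (c * 2 ^- j)%:E)%E).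
    by apply: lee_sum => j _; exact: Ac.
  rewrite big_mkord sumEFin lee_fin -mulr_sumr mulrC ler_wpM2r //.
  exact: sum_halves.
- move=> t /= h k _; apply: contrapT => h2; apply: h; exists k => j kj Aj.
  by apply: h2; exists j.
Qed.

(** Let e j = 2 K 2^-j be the sum of the increment bounds from j on. From N on, u - e increases and
    u + e decreases, so monotone convergence gives the limit together with the explicit error. *)
Lemma fast_cvg (u : nat -> R) (K : R) (N : nat) :
  (forall j, (N <= j)%N -> `|u j.+1 - u j| <= K * 2 ^- j) ->
  exists l : R, (u n @[n --> \oo] --> l) /\
    forall j, (N <= j)%N -> `|l - u j| <= 2 * K * 2 ^- j.
Proof.
move=> hu.
have K0 : 0 <= K.
  have := le_trans (normr_ge0 _) (hu N (leqnn N)).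
  by rewrite pmulr_lge0 // invr_gt0 exprn_gt0.
pose e (j : nat) : R := 2 * K * 2 ^- j.
have eS j : e j = e j.+1 + K * 2 ^- j.
  by rewrite /e exprS invfM; move: (2 ^- j) => q; field.
pose a j := u (j + N)%N - e (j + N)%N; pose b j := u (j + N)%N + e (j + N)%N.
have ha : nondecreasing_seq a.
  apply/nondecreasing_seqP => j; rewrite /a addSn (eS (j + N)%N).
  have := hu (j + N)%N (leq_addl _ _); rewrite ler_norml => /andP[]; lra.
have hb : nonincreasing_seq b.
  apply/nonincreasing_seqP => j; rewrite /b addSn (eS (j + N)%N).
  have := hu (j + N)%N (leq_addl _ _); rewrite ler_norml => /andP[]; lra.
have e0 j : 0 <= e j by rewrite /e !mulr_ge0 // invr_ge0 exprn_ge0.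
have ab i j : a i <= b j.
  apply: (@le_trans _ _ (a (maxn i j))); first by apply: ha; exact: leq_maxl.
  apply: (@le_trans _ _ (b (maxn i j))); last by apply: hb; exact: leq_maxr.
  by rewrite /a /b lerBlDr -addrA lerDl addr_ge0.
have ca : cvgn a.
  by apply: nondecreasing_is_cvgn => //; exists (b 0%N) => _ [i _ <-].
pose l := limn a.
have al i : a i <= l by exact: nondecreasing_cvgn_le.
have lb j : l <= b j by apply: limr_le => //; apply: nearW.
have bound j : (N <= j)%N -> `|l - u j| <= e j.
  move=> /subnK jN; have := al (j - N)%N; have := lb (j - N)%N.
  by rewrite /a /b jN ler_norml => h1 h2; apply/andP; split; lra.
exists l; split=> //.
have ce : e n @[n --> \oo] --> (0 : R).
  rewrite /e -[0](mulr0 (2 * K)); apply: cvgM; first exact: cvg_cst.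
  under eq_fun do rewrite -exprVn.
  by apply: cvg_expr; rewrite ger0_norm ?invr_ge0 // invf_lt1 // ltr1n.
apply/cvgrPdist_le => eps eps0.
move/cvgrPdist_le : ce => /(_ _ eps0) [M _ hM].
exists (maxn N M) => // j /= NMj.
apply: le_trans (bound _ _) _; first exact: leq_trans (leq_maxl _ _) NMj.
have := hM j (leq_trans (leq_maxr _ _) NMj).
by rewrite /= sub0r normrN => /(le_trans (ler_norm _)).
Qed.

(** Limits superior exist and are measurable without any convergence, and agree with the limit
    wherever there is one; [fine] sends infinite values to 0. *)
Definition limsupT (g : nat -> fT R) : fT R := fun z =>
  Complex (fine (limn_esup (fun j => (Re (g j z))%:E)))
          (fine (limn_esup (fun j => (Im (g j z))%:E))).

Lemma measT_limsup (g : nat -> fT R) : (forall j, measT (g j)) -> measT (limsupT g).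
Proof.
move=> mg; split=> /=.
  apply: (measurableT_comp (@fine_measurable _ _ measurableT)).
  by apply: measurable_fun_limn_esup => n; apply/measurable_EFinP; case: (mg n).
apply: (measurableT_comp (@fine_measurable _ _ measurableT)).
by apply: measurable_fun_limn_esup => n; apply/measurable_EFinP; case: (mg n).
Qed.

Lemma fine_limn_esup (u : nat -> R) (l : R) : u n @[n --> \oo] --> l ->
  fine (limn_esup (fun j => (u j)%:E)) = l.
Proof.
move=> ul; rewrite (_ : limn_esup _ = l%:E) //.
have cE : (u n)%:E @[n --> \oo] --> l%:E by apply: cvg_EFin => //; exact: nearW.
rewrite is_cvg_limn_esupE; last by apply/cvg_ex; exists l%:E.
exact/cvg_lim.
Qed.

Lemma limsupTE (g : nat -> fT R) z w :
  (Re (g n z) @[n --> \oo] --> Re w) -> (Im (g n z) @[n --> \oo] --> Im w) ->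
  limsupT g z = w.
Proof. by move=> h1 h2; apply: complex_eq => /=; exact: fine_limn_esup. Qed.

Lemma abs2_le_sqr_Re z (x : R) : 0 <= x -> abs2 z <= x ^+ 2 -> `|Re z| <= x.
Proof.
move=> x0 zx; rewrite -(ger0_norm x0) -ler_sqr ?nnegrE // !real_normK ?num_real //.
exact: le_trans (abs2_Re z) zx.
Qed.
Lemma abs2_le_sqr_Im z (x : R) : 0 <= x -> abs2 z <= x ^+ 2 -> `|Im z| <= x.
Proof.
move=> x0 zx; rewrite -(ger0_norm x0) -ler_sqr ?nnegrE // !real_normK ?num_real //.
exact: le_trans (abs2_Im z) zx.
Qed.

Lemma fast_cvgC (u : nat -> C) (K : R) (N : nat) : 0 <= K ->
  (forall j, (N <= j)%N -> abs2 (u j.+1 - u j) <= (K * 2 ^- j) ^+ 2) ->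
  exists w : C, [/\ Re (u n) @[n --> \oo] --> Re w, Im (u n) @[n --> \oo] --> Im w &
    forall j, (N <= j)%N -> abs2 (w - u j) <= 2 * (2 * K * 2 ^- j) ^+ 2].
Proof.
move=> K0 hu; have p0 j : 0 <= K * 2 ^- j :> R by rewrite mulr_ge0 // invr_ge0 exprn_ge0.
have [x [ux hx]] : exists l : R, (Re (u n) @[n --> \oo] --> l) /\
    forall j, (N <= j)%N -> `|l - Re (u j)| <= 2 * K * 2 ^- j.
  by apply: fast_cvg => j Nj; rewrite -cReN -cReD; apply: abs2_le_sqr_Re (hu _ Nj).
have [y [uy hy]] : exists l : R, (Im (u n) @[n --> \oo] --> l) /\
    forall j, (N <= j)%N -> `|l - Im (u j)| <= 2 * K * 2 ^- j.
  by apply: fast_cvg => j Nj; rewrite -cImN -cImD; apply: abs2_le_sqr_Im (hu _ Nj).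
exists (Complex x y); split => // j Nj; rewrite /abs2 !ReImE /=.
have q0 : 0 <= 2 * K * 2 ^- j :> R by rewrite -mulrA mulr_ge0.
have sq (v : R) : `|v| <= 2 * K * 2 ^- j -> v ^+ 2 <= (2 * K * 2 ^- j) ^+ 2.
  by move=> h; rewrite -(real_normK (num_real v)) ler_sqr ?nnegrE.
by have := sq _ (hx j Nj); have := sq _ (hy j Nj); lra.
Qed.

Lemma nrm_EFin f : L2 f -> (\int[mu]_(t in I) (abs2 (f (eT t)))%:E)%E = (nrm f)%:E.
Proof. by move=> [mf i]; rewrite /nrm /Rintegral fineK //; exact: integrable_fin_num i. Qed.

(** Chebyshev at level 4^-j leaves sets of measure at most 2^-j, off which consecutive terms differ
    by less than 2^-j in modulus. This gives almost everywhere convergence, and Fatou carries the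
    norm bounds to the limit. *)
Lemma L2_complete (g : nat -> fT R) : (forall j, L2 (g j)) ->
  (forall j k, (j <= k)%N -> nrm (fun z => g k z - g j z) <= 8 ^- j) ->
  exists G : fT R, L2 G /\ forall j, nrm (fun z => g j z - G z) <= 8 ^- j.
Proof.
move=> Lg hg.
have mg j : measT (g j) by case: (Lg j).
pose G := limsupT g; have mG : measT G by exact: measT_limsup.
pose D (j k : nat) t := abs2 (g j (eT t) - g k (eT t)).
have mD j k : measurable_fun I (D j k) by exact: measT_abs2 (measTB (mg j) (mg k)).
pose A j := I `&` [set t | ((4 ^- j)%:E <= `|(D j.+1 j t)%:E|)%E].
have mA j : measurable (A j).
  apply: emeasurable_fun_c_infty => //; apply: measurableT_comp => //.
  exact/measurable_EFinP.
have Acv : {ae mu, forall t, exists N, forall j, (N <= j)%N -> ~ A j t}.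
  apply: (@ae_eventually_notin A 1 mA) => j.
  have := @le_integral_abse _ _ _ mu I mI' (fun t => (D j.+1 j t)%:E) (4 ^- j).
  have p4 : 0 < 4 ^- j :> R by rewrite invr_gt0 exprn_gt0.
  have mDE : measurable_fun I (fun t => (D j.+1 j t)%:E) by exact/measurable_EFinP.
  move=> /(_ mDE p4); rewrite -/(A j) => h.
  have {h} := le_trans h (_ : _ <= (8 ^- j)%:E)%E.
  rewrite -lee_pdivlMl // -EFinM => /(_ _)/wrap[].
    under eq_integral do rewrite gee0_abs ?lee_fin ?abs2_ge0 //.
    by rewrite (nrm_EFin (L2B (Lg j.+1) (Lg j))) lee_fin hg.
  rewrite invrK mul1r.
  have -> // : (4 ^+ j * 8 ^- j : R) = 2 ^- j.
  have -> : (8 : R) = 4 * 2 by rewrite -natrM.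
  by rewrite exprMn invfM mulrA divff ?mul1r // expf_neq0.
have lim : {ae mu, forall t, I t -> (Re (g n (eT t)) @[n --> \oo] --> Re (G (eT t))) /\
    (Im (g n (eT t)) @[n --> \oo] --> Im (G (eT t)))}.
  apply: ae_imp Acv => t [N hN] It.
  have [|w [w1 w2 _]] := @fast_cvgC (fun j => g j (eT t)) 1 N ler01.
    move=> j Nj; rewrite mul1r leNgt; apply/negP => h; apply: (hN j Nj).
    split => //=; rewrite lee_fin ger0_norm ?abs2_ge0 // (le_trans _ (ltW h)) //.
    rewrite exprVn -exprM mulnC exprM; have -> // : (2 : R) ^+ 2 = 4.
    by rewrite -natrX.
  by rewrite /G (limsupTE w1 w2).
have fatouG j : (\int[mu]_(t in I) (abs2 (g j (eT t) - G (eT t)))%:E <= (8 ^- j)%:E)%E.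
  have mDE k : measurable_fun I (fun t => (D j k t)%:E) by exact/measurable_EFinP.
  apply: (@le_trans _ _ (\int[mu]_(t in I) limn_einf (fun k => (D j k t)%:E))%E).
    apply: ae_ge0_le_integral => //.
    - by move=> t _; rewrite lee_fin abs2_ge0.
    - apply/measurable_EFinP; exact: measT_abs2 (measTB (mg j) mG).
    - move=> t _; rewrite limn_einf_lim; apply: lime_ge; first exact: is_cvg_einfs.
      apply: nearW => n; apply: le_ereal_inf_tmp => _ [k _ <-].
      by rewrite lee_fin abs2_ge0.
    - rewrite (_ : (fun t => _) = (fun t => - limn_esup (fun k => - (D j k t)%:E))%E).
        apply: measurableT_comp => //; apply: measurable_fun_limn_esup => k.
        by apply: measurableT_comp => //; exact: mDE.
      apply/funext => t; have := limn_esupN (fun k => (D j k t)%:E).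
      by rewrite /comp => ->; rewrite oppeK.
    - apply: ae_imp lim => t h It; have [h1 h2] := h It.
      have cD : (D j k t)%:E @[k --> \oo] --> (abs2 (g j (eT t) - G (eT t)))%:E.
        apply: cvg_EFin; first by near=> k.
        have cR : (Re (g j (eT t)) - Re (g k (eT t))) @[k --> \oo] -->
            Re (g j (eT t)) - Re (G (eT t)) by apply: cvgB h1; exact: cvg_cst.
        have cI : (Im (g j (eT t)) - Im (g k (eT t))) @[k --> \oo] -->
            Im (g j (eT t)) - Im (G (eT t)) by apply: cvgB h2; exact: cvg_cst.
        rewrite [abs2 _]/abs2 !ReImE !expr2.
        rewrite (_ : fine \o (fun k : nat => (D j k t)%:E) = fun k => (Re (g j (eT t)) - Re (g k (eT t))) * (Re (g j (eT t)) - Re (g k (eT t))) +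
          (Im (g j (eT t)) - Im (g k (eT t))) * (Im (g j (eT t)) - Im (g k (eT t)))).
          exact: cvgD (cvgM cR cR) (cvgM cI cI).
        by apply/funext => k; rewrite /D /abs2 /= !ReImE !expr2.
      rewrite is_cvg_limn_einfE; last by apply/cvg_ex; eexists; exact: cD.
      by rewrite (cvg_lim _ cD).
  apply: le_trans (fatou _ _ _ _) _ => //.
    by move=> k t _; rewrite lee_fin abs2_ge0.
  rewrite limn_einf_lim; apply: lime_le; first exact: is_cvg_einfs.
  (* The infimum over indices from k on is bounded by its value at max(j, k), where the norm
     hypothesis, stated for ordered pairs, applies. *)
  apply: nearW => k; apply: (@le_trans _ _ (\int[mu]_(t in I) (D j (maxn j k) t)%:E)%E).
    by apply: ereal_inf_lbound; exists (maxn j k) => //=; exact: leq_maxr.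
  have -> : (\int[mu]_(t in I) (D j (maxn j k) t)%:E)%E =
     (nrm (fun z => g (maxn j k) z - g j z))%:E.
    rewrite -(nrm_EFin (L2B (Lg (maxn j k)) (Lg j))); apply: eq_integral => t _.
    by rewrite /D -abs2N opprB.
  by rewrite lee_fin hg // leq_maxl.
(* Integrability of |G|^2 is reached through G = g 0 - (g 0 - G), the bracket having finite norm by
   the Fatou bound. *)
have LgG : L2 (fun z => g 0%N z - G z).
  split; first exact: measTB.
  apply/integrableP; split.
    by apply/measurable_EFinP; exact: measT_abs2 (measTB (mg 0%N) mG).
  under eq_integral do rewrite gee0_abs ?lee_fin ?abs2_ge0 //.
  exact: le_lt_trans (fatouG 0%N) (ltry _).
have LG : L2 G.
  apply: eq_L2 (L2B (Lg 0%N) LgG) => z _; by rewrite opprB addrCA subrr addr0.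
exists G; split => // j; rewrite -lee_fin -nrm_EFin //; exact: L2B.
Unshelve. all: try exact: 0%N. all: by end_near. Qed.

End FastLimits.

(** * Fourier remainders and the orthogonality of [H2] and [H2m] *)

Section Hardy.
Variable R : realType.
Local Notation C := R[i].
Local Notation Re := (@complex.Re R).
Local Notation Im := (@complex.Im R).
Local Open Scope classical_set_scope.
Local Open Scope ring_scope.
Local Notation "x %:C" := (real_complex _ x) : ring_scope.
Implicit Types (z w c q : C) (f g h x y : fT R).

Lemma fcoef_X (j k : int) : j != k -> fcoef (fun z : C => z ^ j) k = 0.
Proof.
have pos (n : nat) : fcoef (fun z : C => z ^ (k + n.+1%:Z)) k = 0.
  rewrite -(cint_Xn R n); apply: eq_cint => z z1.
  by rewrite -expfzDr ?unit_neq0 // addrAC subrr add0r.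
have neg (n : nat) : fcoef (fun z : C => z ^ (k - n.+1%:Z)) k = 0.
  have Lz : L2 (fun z : C => z ^ n.+1%:Z) by exact: L2_X.
  have conj0 : (0 : C)^* = 0 by apply: complex_eq; rewrite !ReImE /= ?oppr0.
  rewrite -[RHS]conj0 -(cint_Xn R n) -cint_conj; last exact: cintegrable_L2.
  apply: eq_cint => z z1.
  rewrite -expfzDr ?unit_neq0 // addrAC subrr add0r -invr_expz.
  by rewrite unit_inv ?abs2_Xz.
move=> jk; have [lt|lt|eq] := ltgtP j k; last by rewrite eq eqxx in jk.
  have -> : j = k - (absz (k - j)%R).-1.+1%:Z by lia.
  exact: neg.
have -> : j = k + (absz (j - k)%R).-1.+1%:Z by lia.
exact: pos.
Qed.

Lemma fcoef_X1 (k : int) : fcoef (fun z : C => z ^ k) k = 1.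
Proof.
rewrite -(cint1 R); apply: eq_cint => z z1.
by rewrite -expfzDr ?unit_neq0 // subrr expr0z.
Qed.

Lemma H2_X (n : nat) : H2 (fun z : C => z ^ n).
Proof. by split=> [|k k0]; [exact: L2_X|apply: fcoef_X; rewrite gt_eqF // (lt_le_trans k0)]. Qed.

(** The space conj(z H2), the complement of [H2] in L^2. It is given by coefficients, as [H2] is;
    orthogonality to all of [H2] is [inner_H2m_H2]. *)
Definition H2m f := L2 f /\ forall n : nat, fcoef f n = 0.

Lemma inner_X f (n : nat) : inner f (fun z => z ^ n) = fcoef f n.
Proof. by rewrite fcoefE. Qed.

(** Cauchy-Schwarz bounds the squared error by |x|^2 8^-j, so an eventually constant value passes to
    the limit. *)
Lemma inner_lim_eq x (s : nat -> fT R) h c : L2 x -> L2 h -> (forall j, L2 (s j)) ->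
  (forall j, nrm (fun z => h z - s j z) <= 8 ^- j) ->
  (exists N, forall j, (N <= j)%N -> inner x (s j) = c) -> inner x h = c.
Proof.
move=> Lx Lh Ls sh [N xs]; apply/eqP; rewrite -subr_eq0 -abs2_eq0 eq_le abs2_ge0 andbT.
have cv : nrm x * 8 ^- j @[j --> \oo] --> (0 : R).
  rewrite -[0](mulr0 (nrm x)); apply: cvgM; first exact: cvg_cst.
  under eq_fun do rewrite -exprVn.
  by apply: cvg_expr; rewrite ger0_norm ?invr_ge0 // invf_lt1 // ltr1n.
apply: (ler_cvg_to (cvg_cst _) cv); exists N => // j /= Nj.
rewrite -(xs j Nj) -innerBr //.
apply: le_trans (cauchy_schwarz Lx (L2B Lh (Ls j))) _.
by rewrite ler_wpM2l ?nrm_ge0.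
Qed.

Lemma fcoef_lim_eq x (s : nat -> fT R) (k : int) c : L2 x -> (forall j, L2 (s j)) ->
  (forall j, nrm (fun z => x z - s j z) <= 8 ^- j) ->
  (exists N, forall j, (N <= j)%N -> fcoef (s j) k = c) -> fcoef x k = c.
Proof.
move=> Lx Ls sx [N sk].
have LX := L2_X R k.
rewrite fcoefE (inner_conj LX Lx) -[RHS]conjc_invol; congr (_^*).
apply: (inner_lim_eq (s := s)) => //; exists N => j Nj.
by rewrite (inner_conj (Ls j) LX) -fcoefE sk.
Qed.

(** Only the frequencies 0, ..., N - 1 are removed, so the remainders approach the component of [f]
    in [H2m] and not 0. *)
Fixpoint fourier_rem f (N : nat) : fT R :=
  if N is N'.+1 then fun z => fourier_rem f N' z - fcoef f N' * z ^ N'%:Z else f.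

Lemma L2_fourier_rem f N : L2 f -> L2 (fourier_rem f N).
Proof. by move=> Lf; elim: N => //= N IH; apply: L2B => //; apply: L2Z; exact: L2_X. Qed.

Lemma fcoef_fourier_rem f N (k : int) : L2 f ->
  fcoef (fourier_rem f N) k = if (0 <= k) && (k < N%:Z) then 0 else fcoef f k.
Proof.
move=> Lf; elim: N => [|N IH] /=.
  by case: ifP => // /andP[k0]; rewrite ltNge k0.
rewrite fcoefB ?fcoefZ; [|exact: L2_X|exact: L2_fourier_rem|by apply: L2Z; exact: L2_X].
rewrite IH; have [->|kN] := eqVneq k N.
  by rewrite fcoef_X1 ltxx andbF mulr1 subrr lez_nat ltz_nat ltnSn.
rewrite fcoef_X 1?eq_sym // mulr0 subr0.
suff -> : (k < N.+1%:Z) = (k < N%:Z) by [].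
by apply/idP/idP; lia.
Qed.

Lemma inner_fourier_rem f x N : L2 f -> L2 x -> (forall n : nat, fcoef x n = 0) ->
  inner x (fourier_rem f N) = inner x f.
Proof.
move=> Lf Lx x0; elim: N => //= N IH.
rewrite innerBr //; [|exact: L2_fourier_rem|by apply: L2Z; exact: L2_X].
by rewrite (innerZr _ (L2_X R N) Lx) inner_X x0 mulr0 subr0.
Qed.

Lemma nrm_remS f N : L2 f ->
  nrm (fourier_rem f N.+1) = nrm (fourier_rem f N) - abs2 (fcoef f N).
Proof.
move=> Lf /=; rewrite nrmBZ; [|exact: L2_fourier_rem|exact: L2_X].
rewrite inner_X fcoef_fourier_rem // ltxx andbF.
have -> : nrm (fun z : C => z ^ N%:Z) = 1.
  apply: complexI; rewrite -inner_nrm -[RHS](fcoef_X1 N) fcoefE //.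
by rewrite [_^* * _]mulrC abs2E /=; ring.
Qed.

Lemma nrm_remB f N M : L2 f -> (N <= M)%N ->
  nrm (fun z => fourier_rem f M z - fourier_rem f N z) = nrm (fourier_rem f N) - nrm (fourier_rem f M).
Proof.
move=> Lf; elim: M => [|M IH].
  rewrite leqn0 => /eqP ->; rewrite subrr.
  rewrite -[RHS](mul0r (nrm f)) -(abs20 R) -nrmZ //; congr nrm.
  by apply/funext => z; rewrite subrr mul0r.
rewrite leq_eqVlt => /predU1P[->|].
  rewrite subrr -[RHS](mul0r (nrm f)) -(abs20 R) -nrmZ //; congr nrm.
  by apply/funext => z; rewrite subrr mul0r.
rewrite ltnS => NM; rewrite nrm_remS // opprD addrA -IH //= opprK.
have LN := L2_fourier_rem N Lf; have LM := L2_fourier_rem M Lf; have LX := L2_X R M.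
have -> : (fun z => fourier_rem f M z - fcoef f M * z ^ M%:Z - fourier_rem f N z) =
          (fun z => (fourier_rem f M z - fourier_rem f N z) - fcoef f M * z ^ M%:Z).
  by apply/funext => z; ring.
rewrite nrmBZ //; last exact: L2B.
have -> : inner (fun z => fourier_rem f M z - fourier_rem f N z) (fun z => z ^ M%:Z) = 0.
  by rewrite inner_X fcoefB // !fcoef_fourier_rem // ltxx ltz_nat ltnNge NM andbF subrr.
have -> : nrm (fun z : C => z ^ M%:Z) = 1.
  by apply: complexI; rewrite -inner_nrm -[RHS](fcoef_X1 M) fcoefE.
by rewrite mulr0 /= mulr0 subr0 mulr1.
Qed.

(** Serves twice: for the norms of the Fourier remainders and for the tails of the Blaschke
    series. *)
Lemma nonincreasing_eventually_flat (d : nat -> R) (e : R) :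
  (forall n, 0 <= d n) -> (forall n, d n.+1 <= d n) -> 0 < e ->
  exists N, forall m n, (N <= m)%N -> (m <= n)%N -> d m - d n <= e.
Proof.
move=> d0 dS e0.
have nd : nonincreasing_seq d by apply/nonincreasing_seqP.
have cd : cvgn d.
  by apply: nonincreasing_is_cvgn => //; exists 0 => _ [n _ <-].
have ge n : limn d <= d n by exact: nonincreasing_cvgn_ge.
move/cvgrPdist_le : (cd) => /(_ _ e0)[N _ hN]; exists N => m n Nm mn.
have := hN m Nm; rewrite /= distrC => /(le_trans (ler_norm _)).
have := ge n; lra.
Qed.

(** The squared norms of the remainders decrease, and by Pythagoras ([nrm_remB]) their differences
    are squared distances; hence a subsequence satisfies the hypothesis of [L2_complete]. *)
Lemma riesz_fischer f : L2 f -> exists (n : nat -> nat) (G : fT R),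
  [/\ forall j, (j <= n j)%N, L2 G & forall j, nrm (fun z => G z - fourier_rem f (n j) z) <= 8 ^- j].
Proof.
move=> Lf.
have flat (j : nat) : exists N, forall m n, (N <= m)%N -> (m <= n)%N ->
    nrm (fourier_rem f m) - nrm (fourier_rem f n) <= 8 ^- j.
  apply: nonincreasing_eventually_flat => [n|n|]; first exact: nrm_ge0.
    by rewrite nrm_remS // gerDl oppr_le0 abs2_ge0.
  by rewrite invr_gt0 exprn_gt0.
have [N hN] := boolp.choice flat.
(* Summing the successors makes [n] strictly increasing, at least [N], and at least the identity. *)
pose n (j : nat) := (\sum_(i < j.+1) (N i).+1)%N.
have Nn j : (N j <= n j)%N by rewrite /n big_ord_recr /=; lia.
have nS j : (n j < n j.+1)%N by rewrite {2}/n big_ord_recr /= -/(n j) -addSnnS; lia.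
have nmono j k : (j <= k)%N -> (n j <= n k)%N.
  move=> /subnK <-; elim: (k - j)%N => // i IH.
  by rewrite addSn (leq_trans IH) // ltnW.
have jn j : (j <= n j)%N by elim: j => // j IH; exact: leq_ltn_trans IH (nS j).
have [||G [LG hG]] := @L2_complete R (fun j => fourier_rem f (n j)).
- by move=> j; exact: L2_fourier_rem.
- by move=> j k jk; rewrite nrm_remB ?nmono // hN // nmono.
exists n, G; split => // j.
rewrite (_ : nrm _ = nrm (fun z => fourier_rem f (n j) z - G z)) //.
rewrite -[LHS]mul1r -(abs21 R) -abs2N -nrmZ; last exact: L2B (LG) (L2_fourier_rem _ Lf).
by congr nrm; apply/funext => z; rewrite mulN1r opprB.
Qed.

Lemma fcoef_riesz_fischer f (n : nat -> nat) G (k : int) : L2 f -> L2 G ->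
  (forall j, (j <= n j)%N) -> (forall j, nrm (fun z => G z - fourier_rem f (n j) z) <= 8 ^- j) ->
  fcoef G k = if 0 <= k then 0 else fcoef f k.
Proof.
move=> Lf LG jn hG; apply: (fcoef_lim_eq (s := fun j => fourier_rem f (n j))) => //.
  by move=> j; exact: L2_fourier_rem.
exists `|k|%N.+1 => j kj; rewrite fcoef_fourier_rem //.
case: ifP => [/andP[-> _] //|]; case: ifP => // k0.
by have := jn j; lia.
Qed.

(** A priori x is orthogonal only to the monomials z^n. Removing these from h does not change <x,
    h>, while the remainders of h in [H2] tend to a function all of whose coefficients vanish; by
    Fourier uniqueness that limit is 0. *)
Lemma inner_H2m_H2 x h : H2m x -> H2 h -> inner x h = 0.
Proof.
move=> [Lx x0] [Lh h0]; have [n [G [jn LG hG]]] := riesz_fischer Lh.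
have Gk k := fcoef_riesz_fischer k Lh LG jn hG.
have G0 : aeT G (fun=> 0).
  apply: fourier_uniqueness => // k; rewrite Gk; case: ifP => // /negbT.
  by rewrite -ltNge; exact: h0.
rewrite -(inner_fourier_rem (n 0%N) Lh Lx x0).
have e j : inner x (fourier_rem h (n j)) = inner x h by exact: inner_fourier_rem.
rewrite e -(inner_lim_eq Lx LG (fun j => L2_fourier_rem (n j) Lh) hG (ex_intro _ 0%N (fun j _ => e j))).
rewrite (inner_ae (aeT_refl x) G0) /inner; transitivity (0 * cint x); last by rewrite mul0r.
rewrite -cintZ; last exact: cintegrable_L2.
have conj0 : (0 : C)^* = 0 by apply: complex_eq; rewrite !ReImE /= ?oppr0.
by apply: eq_cint => z _; rewrite conj0 mulr0 mul0r.
Qed.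

End Hardy.

(** * The projection [P] and the flip [Jop] *)

Section Projection.
Variable R : realType.
Local Notation C := R[i].
Local Notation Re := (@complex.Re R).
Local Notation Im := (@complex.Im R).
Local Notation I := (@I01 R).
Local Open Scope classical_set_scope.
Local Open Scope ring_scope.
Local Notation "x %:C" := (real_complex _ x) : ring_scope.
Implicit Types (z w c : C) (f g h q : fT R).

Lemma H2_L2 f : H2 f -> L2 f. Proof. by case. Qed.
Lemma H2m_L2 f : H2m f -> L2 f. Proof. by case. Qed.

Lemma H2D f g : H2 f -> H2 g -> H2 (fun z => f z + g z).
Proof.
move=> [Lf f0] [Lg g0]; split; first exact: L2D.
by move=> k k0; rewrite fcoefD // f0 // g0 // addr0.
Qed.
Lemma H2Z c f : H2 f -> H2 (fun z => c * f z).
Proof.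
move=> [Lf f0]; split; first exact: L2Z.
by move=> k k0; rewrite fcoefZ // f0 // mulr0.
Qed.
Lemma H2B f g : H2 f -> H2 g -> H2 (fun z => f z - g z).
Proof.
move=> [Lf f0] [Lg g0]; split; first exact: L2B.
by move=> k k0; rewrite fcoefB // f0 // g0 // subr0.
Qed.
Lemma H2_ae f g : aeT f g -> L2 g -> H2 f -> H2 g.
Proof. by move=> fg Lg [Lf f0]; split => // k k0; rewrite -(fcoef_ae k fg) f0. Qed.
Lemma eq_H2 f g : (forall z, abs2 z = 1 -> f z = g z) -> H2 f -> H2 g.
Proof. by move=> fg Hf; exact: H2_ae (aeT_T fg) (eq_L2 fg (H2_L2 Hf)) Hf. Qed.
Lemma H2mD f g : H2m f -> H2m g -> H2m (fun z => f z + g z).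
Proof.
move=> [Lf f0] [Lg g0]; split; first exact: L2D.
by move=> k; rewrite fcoefD // f0 // g0 // addr0.
Qed.
Lemma H2mB f g : H2m f -> H2m g -> H2m (fun z => f z - g z).
Proof.
move=> [Lf f0] [Lg g0]; split; first exact: L2B.
by move=> k; rewrite fcoefB // f0 // g0 // subr0.
Qed.
Lemma H2m_ae f g : aeT f g -> L2 g -> H2m f -> H2m g.
Proof. by move=> fg Lg [Lf f0]; split => // k; rewrite -(fcoef_ae k fg) f0. Qed.
Lemma eq_H2m f g : (forall z, abs2 z = 1 -> f z = g z) -> H2m f -> H2m g.
Proof. by move=> fg Hf; exact: H2m_ae (aeT_T fg) (eq_L2 fg (H2m_L2 Hf)) Hf. Qed.

Lemma H2_H2m_ae0 f : H2 f -> H2m f -> aeT f (fun=> 0).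
Proof.
move=> Hf Hm; apply: nrm0_ae; first exact: H2_L2.
by apply: complexI; rewrite -inner_nrm; exact: inner_H2m_H2.
Qed.

Lemma hardy_decomposition f : L2 f -> exists G, H2m G /\ H2 (fun z => f z - G z).
Proof.
move=> Lf; have [n [G [jn LG hG]]] := riesz_fischer Lf.
have Gk k := fcoef_riesz_fischer k Lf LG jn hG.
exists G; split; first by split => // k; rewrite Gk.
split=> [|k k0]; first exact: L2B.
by rewrite fcoefB // Gk leNgt k0 subrr.
Qed.

(** The Hardy decomposition supplies a witness for the choice in [oproj]; testing its orthogonality
    on z^n puts f - P f in [H2m]. *)
Lemma P_spec f : L2 f -> H2 (P f) /\ H2m (fun z => f z - P f z).
Proof.
move=> Lf; have [G [HG HfG]] := hardy_decomposition Lf.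
have [|HP perp] := epsilon_spec (inhabits (fun _ : C => 0 : C))
    (fun g => H2 g /\ forall h, H2 h -> inner (fun z => f z - g z) h = 0).
  exists (fun z => f z - G z); split => // h Hh.
  rewrite -(inner_H2m_H2 HG Hh); apply: inner_ae (aeT_refl h).
  by apply: aeT_T => z _; rewrite opprB addrCA subrr addr0.
split => //; split; first exact: L2B Lf (H2_L2 HP).
by move=> n; rewrite -inner_X; apply: perp; exact: H2_X.
Qed.

(** A genuine equality of functions: the predicates given to [epsilon] are equivalent, hence equal,
    so the same function is chosen. This allows rewriting under further operators. *)
Lemma P_congr f g : aeT f g -> P f = P g.
Proof.
move=> fg; rewrite /P /oproj; congr epsilon; apply/funext => x; apply/propext.
have e h : inner (fun z => f z - x z) h = inner (fun z => g z - x z) h.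
  by apply: inner_ae (aeT_refl h); exact: (aeT_map (fun z y => y - x z)).
by split=> -[Hx perp]; split => // h Hh; [rewrite -e|rewrite e]; exact: perp.
Qed.

Lemma P_decomp f g q : H2 g -> H2m q -> aeT f (fun z => g z + q z) -> aeT (P f) g.
Proof.
move=> Hg Hq fgq; rewrite (P_congr fgq).
have Lgq := L2D (H2_L2 Hg) (H2m_L2 Hq).
have [HP HmP] := P_spec Lgq.
pose d z := P (fun z => g z + q z) z - g z.
have Hd : H2 d by exact: H2B.
have Hmd : H2m d by apply: eq_H2m (H2mB Hq HmP) => z _; rewrite /d; ring.
move: (H2_H2m_ae0 Hd Hmd); apply: ae_imp => t h tI.
by apply/eqP; rewrite -subr_eq0; apply/eqP; exact: h.
Qed.

Lemma measT_refl f : measT f -> measT (fun z => f z^-1).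
Proof.
by move=> [m1 m2]; split; [have := measurable_fun_reflect m1|have := measurable_fun_reflect m2];
  apply: eq_measurable_fun => t _; rewrite eT_onem.
Qed.

Lemma cint_refl f : measT f -> cint (fun z => f z^-1) = cint f.
Proof.
move=> [m1 m2]; apply: complex_eq => /=; congr fine.
  rewrite -[RHS]integral_reflect; last exact/measurable_EFinP.
  by apply: eq_integral => t _; rewrite eT_onem.
rewrite -[RHS]integral_reflect; last exact/measurable_EFinP.
by apply: eq_integral => t _; rewrite eT_onem.
Qed.

Lemma measT_J f : measT f -> measT (Jop f).
Proof.
move=> mf; apply: measTM; last exact: measT_refl.
by apply: eq_measT (measT_X R (-1)) => z z1.
Qed.

Lemma L2_J f : L2 f -> L2 (Jop f).
Proof.
move=> [mf i]; have mJ := measT_J mf; split => //.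
apply/integrableP; split; first by apply/measurable_EFinP; exact: measT_abs2.
have mf2 : measurable_fun I (fun t => (abs2 (f (eT t)))%:E).
  by apply/measurable_EFinP; exact: measT_abs2.
rewrite (_ : integral _ _ _ = \int[@lebesgue_measure R]_(t in I) (abs2 (f (eT t)))%:E)%E.
  by rewrite nrm_EFin // ltry.
rewrite -[RHS]integral_reflect //; apply: eq_integral => t _.
by rewrite gee0_abs ?lee_fin ?abs2_ge0 // /Jop abs2M abs2V abs2_eT invr1 mul1r eT_onem.
Qed.

Lemma J_congr f g : aeT f g -> aeT (Jop f) (Jop g).
Proof.
move=> /ae_reflect; apply: ae_imp => t fg; rewrite /Jop inE => It; congr (_ * _).
rewrite -eT_onem fg // inE; move: It; rewrite /I01 /= !in_itv /= => /andP[? ?].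
by apply/andP; split; lra.
Qed.

Lemma JK f z : abs2 z = 1 -> Jop (Jop f) z = f z.
Proof. by move=> z1; rewrite /Jop invrK mulrA mulVf ?mul1r // unit_neq0. Qed.

(** The map k -> -k - 1 exchanges nonnegative and negative integers, which is why [Jop] swaps [H2]
    and [H2m]. *)
Lemma fcoef_J f (k : int) : L2 f -> fcoef (Jop f) k = fcoef f (- k - 1).
Proof.
move=> [mf _]; rewrite /fcoef -[RHS]cint_refl.
  apply: eq_cint => z z1; rewrite /Jop mulrAC mulrC; congr (_ * _).
  by rewrite exprz_inv opprK expfzDr ?unit_neq0 // exprN1 mulrC.
by apply: measTM => //; exact: measT_X.
Qed.

Lemma J_H2 f : H2 f -> H2m (Jop f).
Proof.
move=> [Lf f0]; split; first exact: L2_J.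
by move=> n; rewrite fcoef_J // f0 //; lia.
Qed.

Lemma J_H2m f : H2m f -> H2 (Jop f).
Proof.
move=> [Lf f0]; split; first exact: L2_J.
move=> k k0; rewrite fcoef_J //.
have -> : - k - 1 = (absz k).-1%:Z by lia.
exact: f0.
Qed.

End Projection.

(** * Blaschke products and their radial limits *)

Section Blaschke.
Variable R : realType.
Local Notation C := R[i].
Local Notation Re := (@complex.Re R).
Local Notation Im := (@complex.Im R).
Local Notation I := (@I01 R).
Local Open Scope classical_set_scope.
Local Open Scope ring_scope.
Local Notation "x %:C" := (real_complex _ x) : ring_scope.
Implicit Types (z w c l : C) (f g h q v : fT R).

(** Plays the part of membership in H^infinity. Stability under products and differences is
    immediate, and a Blaschke factor is built from constants, z and a conjugate Cauchy kernel. *)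
Definition H2mult v := forall f, H2 f -> H2 (fun z => v z * f z).

Lemma fcoef_shift f (m k : int) : fcoef (fun w => w ^ m * f w) k = fcoef f (k - m).
Proof.
apply: eq_cint => w w1; rewrite mulrAC mulrC; congr (_ * _).
by rewrite -expfzDr ?unit_neq0 // opprB addrC.
Qed.

Lemma L2_Xmul f (m : int) : L2 f -> L2 (fun w => w ^ m * f w).
Proof.
apply: L2_Linf; apply: (@Linf_bdd _ _ 1 (measT_X R m)) => w w1.
by rewrite abs2_Xz.
Qed.

Lemma H2mult_id : H2mult (fun z => z).
Proof.
move=> f [Lf f0]; apply: (@eq_H2 _ (fun w => w ^ 1 * f w)).
  by move=> w _; rewrite expr1z.
split; first exact: L2_Xmul.
by move=> k k0; rewrite fcoef_shift f0 //; lia.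
Qed.

Lemma H2mult_cst c : H2mult (fun=> c).
Proof. by move=> f; exact: H2Z. Qed.

Lemma H2multM v v' : H2mult v -> H2mult v' -> H2mult (fun z => v z * v' z).
Proof. by move=> hv hw f /hw /hv; apply: eq_H2 => z _; rewrite mulrA. Qed.

Lemma H2multB v v' : H2mult v -> H2mult v' -> H2mult (fun z => v z - v' z).
Proof. by move=> hv hw f Hf; apply: eq_H2 (H2B (hv f Hf) (hw f Hf)) => z _; rewrite mulrBl. Qed.

Lemma eq_H2mult v v' : (forall z, abs2 z = 1 -> v z = v' z) -> H2mult v -> H2mult v'.
Proof. by move=> vw hv f /hv; apply: eq_H2 => z z1; rewrite vw. Qed.

(** A coefficient of index k < 0 of the product is the conjugate of a Cauchy integral of conj(w^-k
    f), whose coefficients of index n >= 0 vanish, so [cint_ker0] applies. *)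
Lemma H2mult_kerc l : abs2 l < 1 -> H2mult (fun z => (ker l z)^*).
Proof.
move=> l1 f Hf; have Lf := H2_L2 Hf; have Lkf := L2_Linf (Linf_conj (Linf_ker l1)) Lf.
split=> // k k0; pose g : fT R := fun w => w ^ (- k) * f w.
have Lg : L2 g by exact: L2_Xmul.
have conj0 : (0 : C)^* = 0 by apply: complex_eq; rewrite !ReImE /= ?oppr0.
transitivity (cint (fun w => (g w)^* * ker l w))^*; last first.
  rewrite cint_ker0 ?conj0 //; first exact: L2_conj.
  move=> n; rewrite fcoef_conj // /g fcoef_shift.
  by case: Hf => _ -> //; lia.
rewrite -cint_conj; last by apply: cintegrableM; [exact: L2_conj|exact: L2_ker].
by apply: eq_cint => w _; rewrite conjcM conjc_invol /g; ring.
Qed.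

Lemma H2_mean0 f : H2 f -> cint (fun w => w * f w) = 0.
Proof.
move=> [Lf f0]; rewrite -(f0 (-1)) //; apply: eq_cint => w _.
by rewrite opprK expr1z mulrC.
Qed.

Lemma kercE l z : (ker l z)^* = (1 - l^* * z)^-1.
Proof.
have conj1 : (1 : C)^* = 1 by apply: complex_eq; rewrite !ReImE /= ?oppr0.
have -> : (ker l z)^* = ((1 - l * z^*)^*)^-1 by exact: fmorphV.
by rewrite conjcB conj1 conjcM conjc_invol.
Qed.

Lemma norm_lt1 l : `|l| < 1 -> abs2 l < 1.
Proof.
move=> l1; have : `|l| ^+ 2 < 1 by rewrite expr_lt1.
by rewrite -add_Re2_Im2 -(ltcR (abs2 l)).
Qed.

Lemma norm_Re l : `|l| = (Re `|l|)%:C.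
Proof. by apply: complex_eq => //=; rewrite ger0_Im. Qed.

Lemma abs2_norm l : abs2 `|l| = abs2 l.
Proof.
by rewrite norm_Re abs2C; apply: complexI; rewrite rmorphXn /= -norm_Re -add_Re2_Im2.
Qed.

Definition phase l := `|l| / l.

Lemma abs2_phase l : l != 0 -> abs2 (phase l) = 1.
Proof.
move=> l0; have l2 : abs2 l != 0 by rewrite abs2_eq0.
by rewrite /phase abs2M abs2V abs2_norm divff.
Qed.

Lemma bfactorE l z : l != 0 -> bfactor l z = phase l * ((l - z) * (1 - l^* * z)^-1).
Proof. by move=> l0; rewrite /bfactor (negbTE l0) mulrC. Qed.

Lemma abs2_bfactor_id l z :
  abs2 (1 - l^* * z) - abs2 (l - z) = (1 - abs2 l) * (1 - abs2 z).
Proof. by rewrite /abs2 !ReImE /=; ring. Qed.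

Lemma bfactor_den l z : abs2 l < 1 -> abs2 z <= 1 -> 0 < abs2 (1 - l^* * z).
Proof.
move=> l1 z1; rewrite lt_def abs2_ge0 andbT abs2_eq0; apply/eqP => /eqP.
rewrite subr_eq0 => /eqP /(congr1 (@abs2 R)); rewrite abs21 abs2M abs2_conj.
have := abs2_ge0 l; have := abs2_ge0 z; nra.
Qed.

Lemma abs2_bfactor l z : abs2 l < 1 -> abs2 z = 1 -> abs2 (bfactor l z) = 1.
Proof.
move=> l1 z1; have [->|l0] := eqVneq l 0; first by rewrite /bfactor eqxx.
have den : 0 < abs2 (1 - l^* * z) by rewrite bfactor_den // z1.
rewrite bfactorE // abs2M abs2_phase // mul1r abs2M abs2V.
have := abs2_bfactor_id l z; rewrite z1 subrr mulr0 => /eqP; rewrite subr_eq0 => /eqP <-.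
by rewrite divff // gt_eqF.
Qed.

Lemma abs2_bfactor_le1 l z : abs2 l < 1 -> abs2 z <= 1 -> abs2 (bfactor l z) <= 1.
Proof.
move=> l1 z1; have [->|l0] := eqVneq l 0; first by rewrite /bfactor eqxx.
have den := bfactor_den l1 z1.
rewrite bfactorE // abs2M abs2_phase // mul1r abs2M abs2V ler_pdivrMr // mul1r.
by rewrite -subr_ge0 abs2_bfactor_id mulr_ge0 // subr_ge0 // ltW.
Qed.

Lemma contT_bfactor l : abs2 l < 1 -> contT (bfactor l).
Proof.
move=> l1; rewrite /bfactor; case: eqP => _; first exact: contT_id.
apply: contTM; last exact: contT_cst.
apply: contTM; first by apply: contTB; [exact: contT_cst|exact: contT_id].
apply: contT_inv.
  by move=> z z1; rewrite -abs2_eq0 gt_eqF // bfactor_den // z1.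
by apply: contTB; [|apply: contTM]; try exact: contT_cst; exact: contT_id.
Qed.

Lemma H2mult_bfactor l : abs2 l < 1 -> H2mult (bfactor l).
Proof.
move=> l1; have [->|l0] := eqVneq l 0.
  by apply: (eq_H2mult _ H2mult_id) => z _; rewrite /bfactor eqxx.
apply: (@eq_H2mult (fun z => phase l * ((l - z) * (ker l z)^*))).
  by move=> z _; rewrite bfactorE // kercE.
apply: H2multM; first exact: H2mult_cst.
apply: H2multM; last exact: H2mult_kerc.
by apply: H2multB; [exact: H2mult_cst|exact: H2mult_id].
Qed.

Lemma bfactor0 l : bfactor l 0 = `|l|.
Proof.
have [->|l0] := eqVneq l 0; first by rewrite /bfactor eqxx normr0.
by rewrite bfactorE // /phase subr0 mulr0 subr0 invr1 mulr1 divfK.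
Qed.

(** Since ker z w = w / (w - z), the two sides differ by the integral of w f(w) times the divided
    difference of the factor at w and z. That difference is a multiple of the conjugate kernel at
    [l] (constant if l = 0), so the integrand is w times a function in [H2] and has mean 0. *)
Lemma cauchy_bfactor l f z : abs2 l < 1 -> abs2 z < 1 -> H2 f ->
  cint (fun w => bfactor l w * f w * ker z w) = bfactor l z * cint (fun w => f w * ker z w).
Proof.
move=> l1 z1 Hf; have Lf := H2_L2 Hf; have Lk := L2_ker z1.
have Hbf := H2mult_bfactor l1 Hf; have Lbf := H2_L2 Hbf.
rewrite -cintZ; last exact: cintegrableM.
apply/eqP; rewrite -subr_eq0 -cintB; [|exact: cintegrableM|]; last first.
  by apply: cintegrableZ; exact: cintegrableM.
have kerw w : abs2 w = 1 -> (w - z) * ker z w = w.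
  move=> w1; have den := ker_den z1 w1; have w0 := unit_neq0 w1.
  rewrite /ker; move: den; rewrite -(unit_inv w1) => den.
  have -> : w - z = w * (1 - z * w^-1) by rewrite mulrBr mulr1 mulrCA divff ?mulr1.
  by rewrite mulfK.
apply/eqP; have [->|l0] := eqVneq l 0.
  rewrite -[RHS](H2_mean0 Hf); apply: eq_cint => w w1.
  rewrite /bfactor eqxx; transitivity ((w - z) * ker z w * f w); first by ring.
  by rewrite kerw.
(* From (l - w)(1 - conj(l) z) - (l - z)(1 - conj(l) w) = (w - z)(|l|^2 - 1). *)
pose c := phase l * ((abs2 l)%:C - 1) / (1 - l^* * z).
transitivity (c * cint (fun w => w * ((ker l w)^* * f w))).
  rewrite -cintZ; last first.
    apply: cintegrable_L2; apply: eq_L2 (L2_Xmul 1 (H2_L2 (H2mult_kerc l1 Hf))) => w _.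
    by rewrite expr1z.
  apply: eq_cint => w w1; rewrite kercE.
  transitivity (c * (((w - z) * ker z w) * ((1 - l^* * w)^-1 * f w))); last by rewrite kerw.
  rewrite !bfactorE // /c -abs2E.
  have d1 : 1 - l^* * z != 0 by rewrite -abs2_eq0 gt_eqF // bfactor_den // ltW.
  have d2 : 1 - l^* * w != 0 by rewrite -abs2_eq0 gt_eqF // bfactor_den // w1.
  by field; rewrite d1 d2.
by rewrite H2_mean0 ?mulr0 //; exact: H2mult_kerc.
Qed.

End Blaschke.

(** * Finite tail products: Cauchy and Poisson formulas, distance to 1 *)

Section PartialProducts.
Variable R : realType.
Local Notation C := R[i].
Local Notation Re := (@complex.Re R).
Local Notation Im := (@complex.Im R).
Local Notation mu := (@lebesgue_measure R).
Local Notation I := (@I01 R).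
Local Open Scope classical_set_scope.
Local Open Scope ring_scope.
Local Notation "x %:C" := (real_complex _ x) : ring_scope.
Local Notation int1 phi := (mu.-integrable I (EFin \o phi)).
Implicit Types (z w c l : C) (f g h q v : fT R) (n m : nat).

Let mI : measurable I := @measurable_I R.

Variable lam : nat -> C.
Hypothesis lam1 : forall k, abs2 (lam k) < 1.

(** For n <= m this is the quotient u_m / u_n, written as a product so that it also makes sense at
    the zeros of u_n. *)
Definition vprod n m : fT R := fun z => \prod_(n <= k < m) bfactor (lam k) z.

Lemma uprodE n z : uprod lam n z = vprod 0 n z.
Proof. by rewrite /vprod big_mkord. Qed.

Lemma vprod_cat n m z : (n <= m)%N -> uprod lam m z = uprod lam n z * vprod n m z.
Proof. by move=> nm; rewrite !uprodE /vprod (big_cat_nat _ nm). Qed.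

Lemma vprod_ind (K : fT R -> Prop) n m : K (fun=> 1) ->
  (forall k v, K v -> K (fun z => bfactor (lam k) z * v z)) ->
  K (vprod n m).
Proof.
move=> K1 KS; elim: m => [|m IH].
  by rewrite (_ : vprod n 0 = fun=> 1) //; apply/funext => z; rewrite /vprod big_geq.
have [mn|nm] := ltnP m n.
  by rewrite (_ : vprod n m.+1 = fun=> 1) //; apply/funext => z; rewrite /vprod big_geq.
rewrite (_ : vprod n m.+1 = fun z => bfactor (lam m) z * vprod n m z); first exact: KS.
by apply/funext => z; rewrite /vprod big_nat_recr //= mulrC.
Qed.

Lemma contT_vprod n m : contT (vprod n m).
Proof.
apply: vprod_ind => [|k v cv]; first exact: contT_cst.
exact: contTM (contT_bfactor (lam1 k)) cv.
Qed.

Lemma H2mult_vprod n m : H2mult (vprod n m).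
Proof.
apply: vprod_ind => [|k v hv]; first exact: H2mult_cst.
exact: H2multM (H2mult_bfactor (lam1 k)) hv.
Qed.

Lemma abs2_vprod n m z : abs2 z = 1 -> abs2 (vprod n m z) = 1.
Proof.
move=> z1; apply: (@vprod_ind (fun v => abs2 (v z) = 1)) => [|k v hv]; first exact: abs21.
by rewrite abs2M hv mulr1 abs2_bfactor.
Qed.

Lemma abs2_vprod_le1 n m z : abs2 z <= 1 -> abs2 (vprod n m z) <= 1.
Proof.
move=> z1; apply: (@vprod_ind (fun v => abs2 (v z) <= 1)) => [|k v hv].
  by rewrite abs21.
by rewrite abs2M mulr_ile1 ?abs2_ge0 // abs2_bfactor_le1.
Qed.

Lemma H2_1 : H2 (fun _ : C => 1 : C).
Proof. by apply: eq_H2 (H2_X R 0) => z _; rewrite expr0z. Qed.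

Lemma H2_vprod n m : H2 (vprod n m).
Proof. by apply: eq_H2 (H2mult_vprod n m H2_1) => z _; rewrite mulr1. Qed.

Lemma L2_vprod n m : L2 (vprod n m). Proof. by case: (H2_vprod n m). Qed.

Lemma cauchy_vprod n m z : abs2 z < 1 ->
  cint (fun w => vprod n m w * ker z w) = vprod n m z.
Proof.
move=> z1.
suff [] : H2 (vprod n m) /\ cint (fun w => vprod n m w * ker z w) = vprod n m z by [].
apply: (@vprod_ind (fun v => H2 v /\ cint (fun w => v w * ker z w) = v z)) => [|k v [Hv IH]].
  split; first exact: H2_1.
  transitivity (cint (ker z)); last exact: cint_ker1.
  by congr cint; apply/funext => w; rewrite mul1r.
split; first exact: H2mult_bfactor.
by rewrite cauchy_bfactor // IH.
Qed.

(** On T, conj(ker z w) - 1 = conj(z) w conj(ker z w), so the difference is the mean of w times a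
    function in [H2]. *)
Lemma cint_kerc f z : H2 f -> abs2 z < 1 -> cint (fun w => f w * (ker z w)^*) = cint f.
Proof.
move=> Hf z1; have Lf := H2_L2 Hf; have Lk := L2_conj (L2_ker z1).
have Hkf := H2mult_kerc z1 Hf.
apply/eqP; rewrite -subr_eq0 -cintB; [|exact: cintegrableM|exact: cintegrable_L2].
apply/eqP; transitivity (z^* * cint (fun w => w * ((ker z w)^* * f w))).
  rewrite -cintZ; last by apply: cintegrable_L2; exact: H2_L2 (@H2mult_id R _ Hkf).
  apply: eq_cint => w w1.
  have conj1 : (1 : C)^* = 1 by apply: complex_eq; rewrite !ReImE /= ?oppr0.
  rewrite [in LHS]kerE // conjcD conj1 !conjcM conjc_invol; ring.
by rewrite H2_mean0 // mulr0.
Qed.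

Lemma pois_vprod n m z : abs2 z < 1 ->
  cint (fun w => vprod n m w * (pois z w)%:C) = vprod n m z.
Proof.
move=> z1; rewrite cint_pois ?cauchy_vprod ?cint_kerc ?addrK //.
  exact: H2_vprod.
exact: L2_vprod.
Qed.

(** A substitute for |1 - v|^2, which is at most 2 (1 - Re v) when |v| <= 1: it is nonnegative,
    linear in v, and therefore reproduced by the Poisson kernel inside the disc. *)
Definition defect n m (s : R) : R := 1 - Re (vprod n m (eT s)).

Lemma defect_ge0 n m s : 0 <= defect n m s.
Proof.
rewrite subr_ge0; have := abs2_Re (vprod n m (eT s)); rewrite abs2_vprod ?abs2_eT //.
by move=> h; nra.
Qed.

Lemma int1_defect n m : int1 (defect n m).
Proof.
apply: int1B; first exact: int1_cst.
by case: (cintegrable_L2 (L2_vprod n m)).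
Qed.

Lemma int1_pois z : abs2 z < 1 -> exists2 M : R, 0 <= M &
  (forall s, 0 <= pois z (eT s) <= M) .
Proof.
move=> z1; exists (4 / (1 - abs2 z) ^+ 2) => [|s].
  by rewrite divr_ge0 // sqr_ge0.
have a0 := abs2_ge0 z.
rewrite pois_ge0 //=; have := ker_bdd z1 (abs2_eT s).
rewrite /pois abs2_subz ?abs2_eT // /ker abs2V => h.
apply: le_trans h; rewrite -[leRHS]mul1r ler_wpM2r ?invr_ge0 ?abs2_ge0 //.
by rewrite gerBl.
Qed.

Lemma defect_pois n m z : abs2 z < 1 ->
  1 - Re (vprod n m z) = Rintegral mu I (fun s => pois z (eT s) * defect n m s).
Proof.
move=> z1; have [M M0 hM] := int1_pois z1.
have mP : measurable_fun I (fun s => pois z (eT s)).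
  exact: measurable_funTS (continuous_measurable_fun (pois_cont z1)).
have iP : int1 (fun s => pois z (eT s)).
  apply: int1_le (int1_cst M) => // s _; have /andP[? ?] := hM s.
  by rewrite ger0_norm.
have [iv _] := cintegrable_L2 (L2_vprod n m).
have iPv : int1 (fun s => Re (vprod n m (eT s)) * pois z (eT s)).
  apply: (@int1_le _ _ (fun s => M * `|Re (vprod n m (eT s))|)).
  - by apply: measurable_funM => //; exact: int1_meas.
  - move=> s _; have /andP[p0 pM] := hM s.
    by rewrite normrM mulrC (ger0_norm p0) ler_wpM2r.
  - by apply: int1Z; exact: (integrable_norm iv).
have -> : Re (vprod n m z) = Rintegral mu I (fun s => Re (vprod n m (eT s)) * pois z (eT s)).
  rewrite -{1}(pois_vprod n m z1) /=; apply: eq_Rintegral => s _.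
  by rewrite !ReImE /= mulr0 subr0.
rewrite -(pois_int1 z1) -RintegralB //.
by apply: eq_Rintegral => s _; rewrite /defect; ring.
Qed.

Lemma defect_mean n m : Rintegral mu I (defect n m) = 1 - Re (vprod n m 0).
Proof.
rewrite defect_pois ?abs20 ?ltr01 //; apply: eq_Rintegral => s _.
by rewrite /pois abs20 !subr0 abs2_eT divr1 mul1r.
Qed.

Definition tail n m : R := \sum_(n <= k < m) (1 - Re `|lam k|).

Lemma Re_norm_itv k : 0 <= Re `|lam k| <= 1.
Proof.
have : 0 <= (Re `|lam k|)%:C by rewrite -norm_Re.
rewrite ler0c => r0; rewrite r0 /=.
have := lam1 k; rewrite -abs2_norm norm_Re abs2C => h.
by rewrite -(expr_le1 (ltn0Sn 1)) // ltW.
Qed.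

(** The phases of the factors make the value at 0 the product of the moduli r_k, and 1 - prod r_k <=
    sum (1 - r_k) for r_k in [0, 1]. *)
Lemma vprod0_ge n m : 1 - Re (vprod n m 0) <= tail n m.
Proof.
have -> : Re (vprod n m 0) = \prod_(n <= k < m) Re `|lam k|.
  rewrite /vprod; apply: complexI; rewrite rmorph_prod /=.
  have -> : \prod_(n <= i < m) (Re `|lam i|)%:C = \prod_(n <= k < m) bfactor (lam k) 0.
    by apply: eq_bigr => k _; rewrite bfactor0 -norm_Re.
  rewrite -(RRe_real (x := \prod_(n <= k < m) bfactor (lam k) 0)) //.
  by apply: rpred_prod => k _; rewrite bfactor0 normr_real.
rewrite /tail; elim: m => [|m IH]; first by rewrite !big_geq // subrr.
have [mn|nm] := ltnP m n; first by rewrite !big_geq // subrr.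
have -> : \prod_(n <= k < m.+1) Re `|lam k| = \prod_(n <= k < m) Re `|lam k| * Re `|lam m|.
  by rewrite big_nat_recr.
have -> : \sum_(n <= k < m.+1) (1 - Re `|lam k|) =
    \sum_(n <= k < m) (1 - Re `|lam k|) + (1 - Re `|lam m|) by rewrite big_nat_recr.
have /andP[r0 r1] := Re_norm_itv m.
have : 0 <= \prod_(n <= k < m) Re `|lam k| <= 1.
  rewrite prodr_ge0 ?prodr_ile1 // => k _; have /andP[//] := Re_norm_itv k.
move=> /andP[p0 p1]; move: IH p0 p1; set p := \prod_(n <= k < m) _; set r := Re _ in r0 r1 *.
move=> IH p0 p1; have : 0 <= (1 - p) * (1 - r) by rewrite mulr_ge0 // subr_ge0.
set S := \sum_(n <= k < m) _ in IH *; nra.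
Qed.

Lemma abs2_1B_vprod n m z : abs2 z <= 1 ->
  abs2 (1 - vprod n m z) <= 2 * (1 - Re (vprod n m z)).
Proof.
move=> z1; have := abs2_vprod_le1 n m z1; rewrite /abs2 !ReImE /=.
by move: (Re _) (Im _) => x y; nra.
Qed.

(** A Harnack estimate: the Poisson kernel at z is bounded by some M, so 1 - Re v(z) is at most M
    times its value at the origin, which the tail dominates. *)
Lemma abs2_1B_vprod_tail z : abs2 z < 1 -> exists2 K : R, 0 <= K &
  forall n m, abs2 (1 - vprod n m z) <= K * tail n m.
Proof.
move=> z1; have [M M0 hM] := int1_pois z1; exists (2 * M); first by rewrite mulr_ge0.
move=> n m; apply: le_trans (abs2_1B_vprod n m (ltW z1)) _.
rewrite -mulrA ler_pM2l // defect_pois //.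
apply: (@le_trans _ _ (M * Rintegral mu I (defect n m))); last first.
  by rewrite ler_wpM2l // defect_mean vprod0_ge.
rewrite -RintegralZl //; last exact: int1_defect.
have mP : measurable_fun I (fun s => pois z (eT s)).
  exact: measurable_funTS (continuous_measurable_fun (pois_cont z1)).
have iMd : int1 (fun s => M * defect n m s) by apply: int1Z; exact: int1_defect.
apply: le_Rintegral => //.
  apply: int1_le iMd.
    by apply: measurable_funM => //; exact: int1_meas (int1_defect n m).
  move=> s _; have /andP[p0 pM] := hM s.
  rewrite ger0_norm; first by apply: ler_wpM2r => //; exact: defect_ge0.
  by apply: mulr_ge0 => //; exact: defect_ge0.
move=> s _; have /andP[p0 pM] := hM s.
by apply: ler_wpM2r => //; exact: defect_ge0.
Qed.

End PartialProducts.

(** * Complex limits by components *)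

Section ComplexLimits.
Variable R : realType.
Local Notation C := R[i].
Local Notation Re := (@complex.Re R).
Local Notation Im := (@complex.Im R).
Local Open Scope classical_set_scope.
Local Open Scope ring_scope.
Context {T : Type} {F : set_system T} {FF : Filter F}.
Implicit Types (f g : T -> C) (z w c l : C).

(** Componentwise, as [bprodD] and [bprodT] take their limits; the filter is arbitrary because both
    n -> oo and r -> 1 from the left occur. *)
Definition ccvg f w :=
  (Re (f x) @[x --> F] --> Re w) /\ (Im (f x) @[x --> F] --> Im w).

Lemma ccvg_cst c : ccvg (fun=> c) c.
Proof. by split; exact: cvg_cst. Qed.

Lemma ccvgD f g z w : ccvg f z -> ccvg g w -> ccvg (fun x => f x + g x) (z + w).
Proof.
move=> [f1 f2] [g1 g2]; split.
  by under eq_fun do rewrite cReD; rewrite cReD; exact: cvgD.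
by under eq_fun do rewrite cImD; rewrite cImD; exact: cvgD.
Qed.

Lemma ccvgM f g z w : ccvg f z -> ccvg g w -> ccvg (fun x => f x * g x) (z * w).
Proof.
move=> [f1 f2] [g1 g2]; split.
  under eq_fun do rewrite cReM; rewrite cReM; apply: cvgB; exact: cvgM.
under eq_fun do rewrite cImM; rewrite cImM; apply: cvgD; exact: cvgM.
Qed.

Lemma ccvgB f g z w : ccvg f z -> ccvg g w -> ccvg (fun x => f x - g x) (z - w).
Proof.
move=> hf hg; rewrite -mulN1r (_ : (fun x => _) = (fun x => f x + (-1) * g x)).
  exact: ccvgD hf (ccvgM (ccvg_cst _) hg).
by apply/funext => x; rewrite mulN1r.
Qed.

Lemma ccvgV f z : z != 0 -> ccvg f z -> ccvg (fun x => (f x)^-1) z^-1.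
Proof.
move=> z0 [f1 f2].
have invE w : w^-1 = Complex (Re w / abs2 w) (- (Im w / abs2 w)).
  by case: w => a b; rewrite /abs2 /=.
have cabs : abs2 (f x) @[x --> F] --> abs2 z.
  by rewrite /abs2 !expr2; under eq_fun do rewrite !expr2; apply: cvgD; exact: cvgM.
have cV : (abs2 (f x))^-1 @[x --> F] --> (abs2 z)^-1.
  by apply: cvgV => //; rewrite abs2_eq0.
split; rewrite invE /=; under eq_fun do rewrite invE /=.
  exact: cvgM.
by apply: cvgN; exact: cvgM.
Qed.

Lemma ccvgP f w :
  ccvg f w <-> forall e : R, 0 < e -> \forall x \near F, abs2 (f x - w) <= e.
Proof.
split=> [[f1 f2] e e0|h].
  have e2 : 0 < Num.sqrt (e / 2) by rewrite sqrtr_gt0 divr_gt0.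
  have sq (y : R) : `|y| <= Num.sqrt (e / 2) -> y ^+ 2 <= e / 2.
    have s2 : Num.sqrt (e / 2) ^+ 2 = e / 2 by rewrite sqr_sqrtr // ltW // divr_gt0.
    move=> yh; rewrite -(real_normK (num_real y)) -s2.
    by rewrite ler_sqr ?nnegrE ?sqrtr_ge0.
  move/cvgrPdist_le : f1 => /(_ _ e2) h1; move/cvgrPdist_le : f2 => /(_ _ e2) h2.
  near=> x; rewrite /abs2 !ReImE.
  have /sq k1 : `|Re w - Re (f x)| <= Num.sqrt (e / 2) by near: x.
  have /sq k2 : `|Im w - Im (f x)| <= Num.sqrt (e / 2) by near: x.
  by nra.
split; apply/cvgrPdist_le => e e0; have := h (e ^+ 2) (exprn_gt0 2 e0);
  apply: filterS => x hx; rewrite distrC.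
  by rewrite -cReN -cReD; apply: abs2_le_sqr_Re hx; exact: ltW.
by rewrite -cImN -cImD; apply: abs2_le_sqr_Im hx; exact: ltW.
Unshelve. all: by end_near. Qed.

End ComplexLimits.

(** * Interchange of the limits n -> oo and r -> 1 *)

Section RadialLimits.
Variable R : realType.
Local Notation C := R[i].
Local Notation Re := (@complex.Re R).
Local Notation Im := (@complex.Im R).
Local Notation mu := (@lebesgue_measure R).
Local Notation I := (@I01 R).
Local Open Scope classical_set_scope.
Local Open Scope ring_scope.
Local Notation "x %:C" := (real_complex _ x) : ring_scope.
Local Notation int1 phi := (mu.-integrable I (EFin \o phi)).
Implicit Types (z w c l : C) (f g h q v : fT R) (n m : nat).

Let mI : measurable I := @measurable_I R.

Variable lam : nat -> C.
Hypothesis lam1 : forall k, abs2 (lam k) < 1.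
Hypothesis lam_sum : cvgn (series (fun k => (1 - Re `|lam k|)%R)).

Lemma tail_small (e : R) : 0 < e ->
  exists N, forall n m, (N <= n)%N -> (n <= m)%N -> tail lam n m <= e.
Proof.
move=> e0; pose a := (fun k => (1 - Re `|lam k|)%R); have ca : cvgn (series a) by exact: lam_sum.
have a0 k : 0 <= a k by have /andP[_ r1] := Re_norm_itv lam1 k; rewrite subr_ge0.
have nd : nondecreasing_seq (series a).
  apply/nondecreasing_seqP => n; rewrite !seriesEnat /= big_nat_recr //=.
  by rewrite lerDl.
have [|n|N hN] := @nonincreasing_eventually_flat R (fun n => limn (series a) - series a n) e _ _ e0.
- by move=> n; rewrite subr_ge0; exact: nondecreasing_cvgn_le.
- by rewrite lerD2l lerN2; apply: nd.
exists N => n m Nn nm; have := hN n m Nn nm.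
have -> : limn (series a) - series a n - (limn (series a) - series a m) =
    series a m - series a n by ring.
suff -> : tail lam n m = series a m - series a n by [].
by rewrite !seriesEnat /= (big_cat_nat _ nm) //= addrAC subrr add0r.
Qed.

Lemma fast_indices : exists n : nat -> nat,
  [/\ forall j, (j <= n j)%N, forall j, (n j <= n j.+1)%N &
      forall j m, (n j <= m)%N -> tail lam (n j) m <= 8 ^- j].
Proof.
have flat (j : nat) : exists N, forall n m, (N <= n)%N -> (n <= m)%N -> tail lam n m <= 8 ^- j.
  by apply: tail_small; rewrite invr_gt0 exprn_gt0.
have [N hN] := boolp.choice flat.
pose n (j : nat) := (\sum_(i < j.+1) (N i).+1)%N.
have Nn j : (N j <= n j)%N by rewrite /n big_ord_recr /=; lia.
have nS j : (n j < n j.+1)%N by rewrite {2}/n big_ord_recr /= -/(n j) -addSnnS; lia.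
exists n; split => [j|j|j m nm].
- by elim: j => // j IH; exact: leq_ltn_trans IH (nS j).
- exact: ltnW (nS j).
- exact: hN (Nn j) nm.
Qed.

Lemma ccvg_radial_vprod n m t :
  ccvg (F := at_left (1 : R)) (fun r => vprod lam n m (r%:C * eT t)) (vprod lam n m (eT t)).
Proof.
have cr : ccvg (F := at_left (1 : R)) (fun r => r%:C * eT t) (eT t).
  rewrite -[X in ccvg _ X]mul1r; apply: ccvgM; last exact: ccvg_cst.
  by split => /=; [exact/cvg_at_left_filter/cvg_id|exact: cvg_cst].
apply: (@vprod_ind R lam (fun v => ccvg (F := at_left (1 : R)) (fun r => v (r%:C * eT t)) (v (eT t)))) => [|k v hv].
  exact: ccvg_cst.
apply: ccvgM hv; rewrite /bfactor; case: eqP => // _.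
apply: ccvgM; last exact: ccvg_cst.
apply: ccvgM; first exact: ccvgB (ccvg_cst _) cr.
apply: ccvgV; first by rewrite -abs2_eq0 gt_eqF // bfactor_den // abs2_eT.
exact: ccvgB (ccvg_cst _) (ccvgM (ccvg_cst _) cr).
Qed.

Section FastSubsequence.
Variable n : nat -> nat.
Hypothesis n_ge : forall j, (j <= n j)%N.
Hypothesis n_mono : forall j, (n j <= n j.+1)%N.
Hypothesis n_tail : forall j m, (n j <= m)%N -> tail lam (n j) m <= 8 ^- j.

Lemma pow8_le (j : nat) (K : R) : 0 <= K -> K * 8 ^- j <= ((1 + K) * 2 ^- j) ^+ 2.
Proof.
move=> K0; rewrite exprMn.
have -> : (2 ^- j : R) ^+ 2 = 4 ^- j.
  by rewrite exprVn -exprM mulnC exprM; congr (_ ^- _); rewrite -natrX.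
apply: ler_pM => //; first by nra.
rewrite lef_pV2 ?posrE ?exprn_gt0 //; apply: lerXn2r; rewrite ?nnegrE //.
by rewrite ler_nat.
Qed.

Lemma uprod_diff z n1 n2 : abs2 z <= 1 -> (n1 <= n2)%N ->
  abs2 (uprod lam n2 z - uprod lam n1 z) <= abs2 (1 - vprod lam n1 n2 z).
Proof.
move=> z1 nm; rewrite (vprod_cat lam z nm).
have -> : uprod lam n1 z * vprod lam n1 n2 z - uprod lam n1 z =
  - (uprod lam n1 z * (1 - vprod lam n1 n2 z)) by ring.
rewrite abs2N abs2M uprodE ler_piMl ?abs2_ge0 //.
exact: abs2_vprod_le1.
Qed.

(** [bprodD] is a limit over all indices, so every m >= n j is compared with n j, whose tail bound
    is uniform in m. *)
Lemma ccvg_uprod_disc z : abs2 z < 1 ->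
  exists w, ccvg (F := \oo) (fun m => uprod lam m z) w.
Proof.
move=> z1; have [K K0 hK] := abs2_1B_vprod_tail lam1 z1.
have diff j m : (n j <= m)%N ->
    abs2 (uprod lam m z - uprod lam (n j) z) <= ((1 + K) * 2 ^- j) ^+ 2.
  move=> nm; apply: le_trans (uprod_diff (ltW z1) nm) _.
  apply: le_trans (hK _ _) _; apply: le_trans (pow8_le j K0).
  by rewrite ler_wpM2l // n_tail.
have K1 : 0 <= 1 + K by rewrite addr_ge0.
have [|w [_ _ hw]] := @fast_cvgC R (fun j => uprod lam (n j) z) (1 + K) 0 K1.
  by move=> j _; exact: diff.
exists w; apply/ccvgP => e e0.
(* 18 = 2 + 2 * 8: the distance from u_m to u_(n j), and the one from u_(n j) to the limit given by
   [fast_cvgC]. *)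
have cv : 18 * (1 + K) ^+ 2 * 4 ^- j @[j --> \oo] --> (0 : R).
  rewrite -[0](mulr0 (18 * (1 + K) ^+ 2)); apply: cvgM; first exact: cvg_cst.
  under eq_fun do rewrite -exprVn.
  by apply: cvg_expr; rewrite ger0_norm ?invr_ge0 // invf_lt1 // ltr1n.
move/cvgrPdist_le : cv => /(_ _ e0) [j _ /(_ j (leqnn j))] /=.
rewrite sub0r normrN => /(le_trans (ler_norm _)) je.
exists (n j) => // m /= nm; apply: le_trans je.
have -> : uprod lam m z - w = (uprod lam m z - uprod lam (n j) z) - (w - uprod lam (n j) z).
  by ring.
apply: le_trans (abs2B_le _ _) _.
have h1 := diff j m nm; have h2 := hw j (leq0n j).
have e4 : (4 ^- j : R) = (2 ^- j) ^+ 2.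
  by rewrite exprVn -exprM mulnC exprM; congr (_ ^- _); rewrite -natrX.
rewrite e4; move: h1 h2; set x := abs2 _; set y := abs2 _; move: (2 ^- j) => p.
by nra.
Qed.

(** The maximal function of the boundary defect bounds all averages at t at once, hence the Poisson
    integrals along the entire radius. This uniformity in r is what permits the later interchange of
    limits; the bound K may depend on t. *)
Lemma fast_radial_ae : {ae mu, forall t, I t -> exists (K : R) (N : nat), 0 <= K /\
  forall r j, 0 <= r -> r <= 1 -> (N <= j)%N ->
  abs2 (1 - vprod lam (n j) (n j.+1) (r%:C * eT t)) <= (K * 2 ^- j) ^+ 2}.
Proof.
pose g j := defect lam (n j) (n j.+1).
(* The defect has integral at most 8^-j, so the weak-type inequality with constant 3 gives measure
   at most 3 * 4^j * 8^-j = 3 * 2^-j. *)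
pose A j := [set t | ((4 ^- j)%:E < HL_maximal (g j \_ I) t)%E].
have ig j : int1 (g j) by exact: int1_defect.
have lg j : locally_integrable setT (g j \_ I) := integrable_locally_restrict mI (ig j).
have mA j : measurable (A j).
  rewrite /A -[X in measurable X]setTI; apply: emeasurable_fun_o_infty => //.
  exact: measurable_HL_maximal.
have muA j : (mu (A j) <= (3 * 2 ^- j)%:E)%E.
  have p4 : 0 < 4 ^- j :> R by rewrite invr_gt0 exprn_gt0.
  apply: le_trans (maximal_inequality (lg j) p4) _.
  have -> : (\int[mu]_s `|((g j \_ I) s)%:E| = (Rintegral mu I (g j))%:E)%E.
    rewrite /Rintegral fineK; last exact: integrable_fin_num (ig j).
    rewrite [RHS]integral_mkcond; apply: eq_integral => s _.
    rewrite !patchE; case: ifP => _; last by rewrite abse0.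
    by rewrite gee0_abs // lee_fin defect_ge0.
  rewrite -EFinM lee_fin defect_mean // invrK -mulrA ler_pM2l //.
  apply: (@le_trans _ _ (4 ^+ j * 8 ^- j)).
    rewrite ler_pM2l ?exprn_gt0 //; apply: le_trans (vprod0_ge lam1 _ _) _.
    exact: n_tail.
  have -> : (8 : R) = 4 * 2 by rewrite -natrM.
  by rewrite exprMn invfM mulrA divff ?mul1r // expf_neq0.
apply: ae_imp2 (ae_eventually_notin mA muA) (endpoints_ae R) => t [N hN] ht It.
have [t0 t1] := ht It.
have [c c0 hc] := poisson_le_avg t0 t1.
(* 2 c <= (1 + 2 c)^2 turns the bound 2 c 4^-j for r < 1 into a square; the outer factor 2 pays for
   the passage to r = 1. *)
exists (2 * (1 + 2 * c)), N; split; first by rewrite mulr_ge0 // addr_ge0 // mulr_ge0 // ltW.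
have lt1 (r : R) j : 0 <= r -> r < 1 -> (N <= j)%N ->
  abs2 (1 - vprod lam (n j) (n j.+1) (r%:C * eT t)) <= ((1 + 2 * c) * 2 ^- j) ^+ 2.
  move=> r0 r1 Nj; have z1 := pois_lt1 t r0 r1.
  apply: le_trans (abs2_1B_vprod lam1 _ _ (ltW z1)) _.
  rewrite defect_pois //.
  have le4 : Rintegral mu I (fun s => pois (r%:C * eT t) (eT s) * g j s) <= c * 4 ^- j.
    have HL : (HL_maximal (g j \_ I) t <= (4 ^- j)%:E)%E.
      by rewrite leNgt; apply/negP; exact: hN.
    have bnd : (\int[mu]_(s in I) (pois (r%:C * eT t) (eT s) * g j s)%:E <= (c * 4 ^- j)%:E)%E.
      apply: hc r0 r1 _ => //; first exact: int1_meas (ig j).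
      - by move=> s _; exact: defect_ge0.
      move=> e e0.
      have : (iavg (g j \_ I) (ball t e) <= (4 ^- j)%:E)%E.
        apply: le_trans HL; apply: ereal_sup_ubound; exists e => //.
        by rewrite /= in_itv /= e0.
      rewrite /iavg (lebesgue_measure_ball _ (ltW e0)) inver mulrn_eq0 /= gt_eqF //.
      rewrite lee_pdivrMl; last by rewrite pmulrn_rgt0.
      rewrite -EFinM -[e *+ 2]mulr_natl; apply: le_trans.
      rewrite le_eqVlt; apply/orP; left; apply/eqP; apply: eq_integral => s _.
      by rewrite /= ger0_norm // patchE; case: ifP => // _; exact: defect_ge0.
    rewrite -lee_fin /Rintegral fineK // ge0_fin_numE.
      exact: le_lt_trans bnd (ltry _).
    by apply: integral_ge0 => s _; rewrite lee_fin mulr_ge0 ?pois_ge0 ?defect_ge0.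
  apply: (@le_trans _ _ (2 * (c * 4 ^- j))); first by rewrite ler_pM2l.
  rewrite exprMn.
  have -> : (2 ^- j : R) ^+ 2 = 4 ^- j.
    by rewrite exprVn -exprM mulnC exprM; congr (_ ^- _); rewrite -natrX.
  by rewrite mulrA ler_wpM2r ?invr_ge0 ?exprn_ge0 //; nra.
move=> r j r0 r1 Nj; have [rlt|rge] := ltP r 1.
  apply: le_trans (lt1 r j r0 rlt Nj) _; rewrite -mulrA ler_sqr ?nnegrE.
  - by rewrite ler_peMl // ?ler1n // mulr_ge0 ?invr_ge0 ?exprn_ge0 // addr_ge0 // mulr_ge0 // ltW.
  - by rewrite mulr_ge0 ?invr_ge0 ?exprn_ge0 // addr_ge0 // mulr_ge0 // ltW.
  - by rewrite !mulr_ge0 ?invr_ge0 ?exprn_ge0 // addr_ge0 // mulr_ge0 // ltW.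
have {r0 r1 rge} -> : r = 1 by apply/le_anti; rewrite r1.
(* At r = 1, the finite product is radially continuous, and |y|^2 <= 2 |x|^2 + 2 |x - y|^2 with x
   taken inside the disc. *)
rewrite rmorph1 mul1r; set B := (1 + 2 * c) * 2 ^- j in lt1 *.
have : ccvg (F := at_left (1 : R)) (fun r => 1 - vprod lam (n j) (n j.+1) (r%:C * eT t))
    (1 - vprod lam (n j) (n j.+1) (eT t)).
  by apply: ccvgB; [exact: ccvg_cst|exact: ccvg_radial_vprod].
move=> /ccvgP cv; apply/ler_addgt0Pr => e e0.
have e2 : 0 < e / 2 by rewrite divr_gt0.
have {}cv := cv _ e2.
near (at_left (1 : R)) => q.
have q0 : 0 <= q by near: q; apply: nbhs_left_ge.
have q1 : q < 1 by near: q; exact: nbhs_left_lt.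
have : abs2 (1 - vprod lam (n j) (n j.+1) (q%:C * eT t) - (1 - vprod lam (n j) (n j.+1) (eT t))) <= e / 2.
  by near: q.
have := lt1 q j q0 q1 Nj; rewrite -/B.
set x := 1 - vprod _ _ _ (q%:C * _); set y := 1 - vprod _ _ _ _.
move=> xB xy; have -> : y = x - (x - y) by ring.
apply: le_trans (abs2B_le _ _) _; rewrite -mulrA -/B.
have : (2 * B) ^+ 2 = 4 * B ^+ 2 by ring.
by have := abs2_ge0 x; lra.
Unshelve. all: by end_near. Qed.

(** The convergence of u_(n j) is uniform in r on [0, 1], endpoint included, and each u_(n j) is
    radially continuous. A three-term comparison then shows that the radial limit of the infinite
    product exists and is the limit on the circle. *)
Lemma radial_limit_ae : aeT (bprodT lam) (limsupT (fun j => uprod lam (n j))) /\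
  {ae mu, forall t, I t -> ccvg (F := \oo) (fun j => uprod lam (n j) (eT t))
    (limsupT (fun j => uprod lam (n j)) (eT t))}.
Proof.
suff key : {ae mu, forall t, I t -> exists w, bprodT lam (eT t) = w /\
    ccvg (F := \oo) (fun j => uprod lam (n j) (eT t)) w}.
  split.
    apply: ae_imp key => t h; rewrite inE => /h [w [-> [w1 w2]]].
    by rewrite (limsupTE w1 w2).
  apply: ae_imp key => t h /h [w [_ [w1 w2]]].
  by rewrite (limsupTE w1 w2).
apply: ae_imp fast_radial_ae => t h /h {h} [K [N [K0 hK]]].
have le1 r : 0 <= r -> r <= 1 -> abs2 (r%:C * eT t) <= 1.
  by move=> r0 r1; rewrite abs2M abs2C abs2_eT mulr1 expr_le1.
have lim r : 0 <= r -> r <= 1 -> exists w,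
    ccvg (F := \oo) (fun j => uprod lam (n j) (r%:C * eT t)) w /\
    forall j, (N <= j)%N -> abs2 (w - uprod lam (n j) (r%:C * eT t)) <= 2 * (2 * K * 2 ^- j) ^+ 2.
  move=> r0 r1; have [|w [w1 w2 hw]] := @fast_cvgC R (fun j => uprod lam (n j) (r%:C * eT t)) K N K0.
    move=> j Nj; apply: le_trans (hK r j r0 r1 Nj).
    exact: uprod_diff (le1 r r0 r1) (n_mono j).
  by exists w.
have [w [cw hw]] := lim 1 ler01 (lexx 1).
have E1 : (1 : R)%:C * eT t = eT t by rewrite rmorph1 mul1r.
rewrite E1 in cw hw.
exists w; split => //.
have n_oo : n j @[j --> \oo] --> \oo.
  move=> S [M _ MS]; exists M => // j Mj; apply: MS => /=.
  exact: leq_trans Mj (n_ge j).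
have disc r : 0 <= r -> r < 1 -> forall j, (N <= j)%N ->
    abs2 (bprodD lam (r%:C * eT t) - uprod lam (n j) (r%:C * eT t)) <= 2 * (2 * K * 2 ^- j) ^+ 2.
  move=> r0 r1; have [w' [cw' hw']] := lim r r0 (ltW r1).
  have [w2 [c1 c2]] := ccvg_uprod_disc (pois_lt1 t r0 r1).
  have -> : bprodD lam (r%:C * eT t) = w2.
    by apply: complex_eq; rewrite /bprodD /=; exact: cvg_lim.
  have -> : w2 = w'; last exact: hw'.
  case: cw' => d1 d2.
  have s1 : Re (uprod lam (n j) (r%:C * eT t)) @[j --> \oo] --> Re w2 := cvg_comp _ _ n_oo c1.
  have s2 : Im (uprod lam (n j) (r%:C * eT t)) @[j --> \oo] --> Im w2 := cvg_comp _ _ n_oo c2.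
  by apply: complex_eq; [rewrite -(cvg_lim _ s1) // (cvg_lim _ d1)
    |rewrite -(cvg_lim _ s2) // (cvg_lim _ d2)].
have main : ccvg (F := at_left (1 : R)) (fun r => bprodD lam (r%:C * eT t)) w.
  apply/ccvgP => e e0.
  (* The comparison costs 64 K^2 4^-j + e / 4 in squared modulus; 48 K^2 4^-j <= e / 2 makes the
     first term at most 2 e / 3. *)
  have cv : 48 * K ^+ 2 * 4 ^- j @[j --> \oo] --> (0 : R).
    rewrite -[0](mulr0 (48 * K ^+ 2)); apply: cvgM; first exact: cvg_cst.
    under eq_fun do rewrite -exprVn.
    by apply: cvg_expr; rewrite ger0_norm ?invr_ge0 // invf_lt1 // ltr1n.
  have e2 : 0 < e / 2 by rewrite divr_gt0.
  move/cvgrPdist_le : cv => /(_ _ e2) [M _ hM].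
  pose j := maxn M N; have Mj : (M <= j)%N := leq_maxl _ _; have Nj : (N <= j)%N := leq_maxr _ _.
  have := hM j Mj; rewrite /= sub0r normrN => /(le_trans (ler_norm _)) je.
  have e8 : 0 < e / 8 by rewrite divr_gt0.
  have := ccvg_radial_vprod 0 (n j) t => /ccvgP /(_ _ e8) cv.
  near=> r.
  have r0 : 0 <= r by near: r; apply: nbhs_left_ge.
  have r1 : r < 1 by near: r; exact: nbhs_left_lt.
  have h1 : abs2 (uprod lam (n j) (r%:C * eT t) - uprod lam (n j) (eT t)) <= e / 8.
    by rewrite !uprodE; near: r.
  have h2 := disc r r0 r1 j Nj; have h3 := hw j Nj.
  set a := bprodD _ _ in h2 *; set b := uprod _ _ _ in h1 h2; set c := uprod _ _ _ in h1 h3.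
  have -> : a - w = ((a - b) - (w - c)) + (b - c) by ring.
  apply: le_trans (abs2D_le _ _) _.
  have h4 := abs2B_le (a - b) (w - c).
  have e4 : (4 ^- j : R) = (2 ^- j) ^+ 2.
    by rewrite exprVn -exprM mulnC exprM; congr (_ ^- _); rewrite -natrX.
  have e5 : 2 * (2 * K * 2 ^- j) ^+ 2 = 8 * (K ^+ 2 * 4 ^- j) by rewrite e4; ring.
  rewrite e5 in h2 h3; rewrite -mulrA in je.
  by move: (K ^+ 2 * 4 ^- j) je h1 h2 h3 h4 => p; lra.
case: main => m1 m2.
by apply: complex_eq; rewrite /bprodT /=; exact: cvg_lim.
Unshelve. all: by end_near. Qed.

End FastSubsequence.
End RadialLimits.

(** * Widom's identity *)

Section ModelSpace.
Variable R : realType.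
Local Notation C := R[i].
Local Open Scope classical_set_scope.
Local Open Scope ring_scope.
Implicit Types (z : C) (f g h q w F G : fT R).

Lemma Mul_congr a f g : aeT f g -> aeT (Mul a f) (Mul a g).
Proof. exact: (aeT_map (fun z y => a z * y)). Qed.

Lemma Pv_congr v f g : aeT f g -> Pv v f = Pv v g.
Proof.
by move=> fg; rewrite /Pv (P_congr fg) (P_congr (Mul_congr (cconj v) fg)).
Qed.

Lemma TT_congr u a f g : aeT f g -> TT u a f = TT u a g.
Proof. by move=> fg; rewrite /TT /= (Pv_congr u fg). Qed.

Lemma P_H2 f : H2 f -> aeT (P f) f.
Proof.
move=> Hf; have Hm : H2m (fun _ : C => 0 : C).
  have [HP HmP] := P_spec (H2_L2 Hf).
  by apply: eq_H2m (H2mB HmP HmP) => z _; rewrite subrr.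
by apply: P_decomp Hf Hm _; apply: aeT_T => z _; rewrite addr0.
Qed.

Variable v : fT R.
Hypothesis mv : measT v.
Hypothesis v1 : forall z, abs2 z = 1 -> abs2 (v z) = 1.
Hypothesis H2v : H2mult v.

Lemma Linf_v : Linf v.
Proof. by apply: (@Linf_bdd _ _ 1) => // z z1; rewrite v1. Qed.

Lemma vK z : abs2 z = 1 -> (v z)^* * v z = 1.
Proof. by move=> z1; rewrite mulrC abs2E v1. Qed.

Lemma inner_move a f g : inner (fun z => (a z)^* * f z) g = inner f (fun z => a z * g z).
Proof. by apply: eq_cint => z _; rewrite conjcM; ring. Qed.

(** The adjoint of multiplication by v: <conj(v) q, z^n> = <q, v z^n>. *)
Lemma H2m_conjv q : H2m q -> H2m (fun z => (v z)^* * q z).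
Proof.
move=> Hq; split; first exact: L2_Linf (Linf_conj Linf_v) (H2m_L2 Hq).
move=> n; rewrite -inner_X inner_move; apply: inner_H2m_H2 => //.
by apply: H2v; exact: H2_X.
Qed.

(** The model space K_v: orthogonality of g to v H2 is the same as orthogonality of conj(v) g to H2,
    that is membership in [H2m]. *)
Definition inK g := H2 g /\ H2m (fun z => (v z)^* * g z).

(** The uniqueness half of the decomposition, and the rule by which [Pv] is computed: P drops q,
    while conj(v) sends g and q into [H2m], so that P (conj(v) x) is w. *)
Lemma Pv_decomp x g q w : inK g -> H2m q -> H2 w ->
  aeT x (fun z => g z + q z + v z * w z) -> aeT (Pv v x) g.
Proof.
move=> [Hg Hvg] Hq Hw xE; have Hvw := H2v Hw.
have h1 : aeT (P x) (fun z => g z + v z * w z).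
  apply: (@P_decomp _ _ _ q) => //; first exact: H2D.
  by apply: aeT_trans xE _; apply: aeT_T => z _; ring.
have h2 : aeT (P (Mul (cconj v) x)) w.
  apply: (@P_decomp _ _ _ (fun z => (v z)^* * g z + (v z)^* * q z)) => //.
    by apply: H2mD => //; exact: H2m_conjv.
  apply: aeT_trans (Mul_congr (cconj v) xE) _; apply: aeT_T => z z1.
  rewrite /Mul /cconj conjcE.
  transitivity ((v z)^* * v z * w z + ((v z)^* * g z + (v z)^* * q z)); first by ring.
  by rewrite vK // mul1r.
apply: aeT_trans (aeT_map2 (fun z a b => a - v z * b) h1 h2) _.
by apply: aeT_T => z _; rewrite addrK.
Qed.

(** The existence half, with q = x - P x and w = P (conj(v) x). The equality is pointwise because
    [Pv] is an explicit formula in these two. *)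
Lemma Pv_exact x : L2 x -> exists q w, [/\ inK (Pv v x), H2m q, H2 w &
  forall z, abs2 z = 1 -> x z = Pv v x z + q z + v z * w z].
Proof.
move=> Lx; have [HP HmP] := P_spec Lx.
have Lvx : L2 (Mul (cconj v) x) by exact: L2_Linf (Linf_conj Linf_v) Lx.
have [HP' HmP'] := P_spec Lvx.
exists (fun z => x z - P x z), (P (Mul (cconj v) x)); split => //; last first.
  by move=> z _; rewrite /Pv; ring.
split; first exact: H2B HP (H2v HP').
apply: eq_H2m (H2mB HmP' (H2m_conjv HmP)) => z z1.
rewrite /Pv /Mul /cconj conjcE.
transitivity ((v z)^* * P x z - 1 * P (fun z => (v z)^* * x z) z); first by rewrite mul1r; ring.
by rewrite -(vK z1); ring.
Qed.

Lemma inKD g h : inK g -> inK h -> inK (fun z => g z + h z).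
Proof.
move=> [Hg Hvg] [Hh Hvh]; split; first exact: H2D.
by apply: eq_H2m (H2mD Hvg Hvh) => z _; rewrite mulrDr.
Qed.

(** As [P] is a choice, additivity is obtained only almost everywhere, by adding two
    decompositions. *)
Lemma PvD x y : L2 x -> L2 y ->
  aeT (Pv v (fun z => x z + y z)) (fun z => Pv v x z + Pv v y z).
Proof.
move=> /Pv_exact [q [w [Kx Hq Hw xE]]] /Pv_exact [q' [w' [Ky Hq' Hw' yE]]].
apply: (@Pv_decomp _ _ (fun z => q z + q' z) (fun z => w z + w' z)).
- exact: inKD.
- exact: H2mD.
- exact: H2D.
- by apply: aeT_T => z z1; rewrite xE // yE //; ring.
Qed.

Lemma Pv_kill x y q w : L2 x -> H2m q -> H2 w ->
  aeT y (fun z => x z + q z + v z * w z) -> aeT (Pv v y) (Pv v x).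
Proof.
move=> /Pv_exact [q' [w' [Kx Hq' Hw' xE]]] Hq Hw yE.
apply: (@Pv_decomp _ _ (fun z => q' z + q z) (fun z => w' z + w z)) => //.
- exact: H2mD.
- exact: H2D.
- by apply: aeT_trans yE _; apply: aeT_T => z z1; rewrite {1}xE //; ring.
Qed.

Lemma PvP x : L2 x -> aeT (Pv v (P x)) (Pv v x).
Proof.
move=> Lx; have [HP HmP] := P_spec Lx.
have Z : H2 (fun _ : C => 0 : C) by apply: eq_H2 (H2B HP HP) => z _; rewrite subrr.
apply: aeT_sym; apply: (@Pv_kill _ _ (fun z => x z - P x z) (fun=> 0)) => //.
  exact: H2_L2.
by apply: aeT_T => z _; rewrite mulr0 addr0; ring.
Qed.

(** * Symbols divisible by v, and the algebra of the identity *)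

Section Dominated.
(** [u] is the symbol as it is defined, [U] a measurable representative. Divisibility of [U] by v is
    expressed by conj(v) U mapping [H2] into itself. *)
Variables u U : fT R.
Hypothesis uU : aeT u U.
Hypothesis LU : Linf U.
Hypothesis H2U : forall h, H2 h -> H2 (fun z => (v z)^* * (U z * h z)).

Lemma UE h z : abs2 z = 1 -> U z * h z = v z * ((v z)^* * (U z * h z)).
Proof. by move=> z1; rewrite mulrA [v z * _]mulrC vK ?mul1r. Qed.

(** Inside the projection [u] may be replaced by [U] with true equality, by [P_congr]; the outer
    factor stays [u]. *)
Lemma Pv_ae_symbol f : L2 f ->
  Pv u f = fun z => P f z - u z * P (fun z => (U z)^* * f z) z.
Proof.
move=> Lf; rewrite /Pv; apply/funext => z; congr (_ - _ * _).
suff -> : P (Mul (cconj u) f) = P (fun z => (U z)^* * f z) by [].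
by apply: P_congr; rewrite /Mul /cconj; exact: (aeT_map (fun z y => y^* * f z) uU).
Qed.

(** K_v lies in K_u: <conj(U) x, z^n> = <conj(v) x, conj(v) U z^n>, which pairs [H2m] with [H2]. *)
Lemma Pu_inK x : inK x -> aeT (Pv u x) x.
Proof.
move=> [Hx Hvx]; have Lx := H2_L2 Hx.
have LUx : L2 (fun z => (U z)^* * x z) := L2_Linf (Linf_conj LU) Lx.
have HmU : H2m (fun z => (U z)^* * x z).
  split=> // n; rewrite -inner_X inner_move.
  rewrite -(inner_H2m_H2 Hvx (H2U (H2_X R n))) inner_move.
    apply: inner_ae (aeT_refl x) _; apply: aeT_T => z z1.
  exact: (UE (fun z => z ^ n%:Z)).
have Z : H2 (fun _ : C => 0 : C) by apply: eq_H2 (H2B Hx Hx) => z _; rewrite subrr.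
have PU0 : aeT (P (fun z => (U z)^* * x z)) (fun=> 0).
  by apply: P_decomp Z HmU _; apply: aeT_T => z _; rewrite add0r.
rewrite Pv_ae_symbol //.
apply: aeT_trans (aeT_map2 (fun z a b => a - u z * b) (P_H2 Hx) PU0) _.
by apply: aeT_T => z _; rewrite mulr0 subr0.
Qed.

(** The term subtracted by [Pv u] is U w = v (conj(v) U w) almost everywhere, an element of v H2,
    which [Pv v] annihilates. *)
Lemma Pv_Pu x : L2 x -> aeT (Pv v (Pv u x)) (Pv v x).
Proof.
move=> Lx; have [HP HmP] := P_spec Lx.
have LUx : L2 (fun z => (U z)^* * x z) := L2_Linf (Linf_conj LU) Lx.
have [HPU _] := P_spec LUx; set w := P (fun z => (U z)^* * x z) in HPU.
apply: aeT_trans _ (PvP Lx).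
have Zm : H2m (fun _ : C => 0 : C) by apply: eq_H2m (H2mB HmP HmP) => z _; rewrite subrr.
have HUw := H2U HPU.
apply: (@Pv_kill _ _ (fun=> 0) (fun z => - 1 * ((v z)^* * (U z * w z)))) => //.
- exact: H2_L2.
- exact: H2Z.
rewrite Pv_ae_symbol // -/w.
apply: aeT_trans (aeT_map (fun z y => P x z - y * w z) uU) _.
by apply: aeT_T => z z1; rewrite {1}(UE w z1); ring.
Qed.

(** On K_v the inner P_u acts as the identity and the outer one is absorbed by P_v; the infinite
    product thereby disappears from the computation. *)
Lemma Pv_TT c x : Linf c -> inK x ->
  aeT (Pv v (TT u c x)) (Pv v (fun z => c z * x z)).
Proof.
move=> Lc Kx; rewrite /TT /= (Pv_congr u (Mul_congr c (Pu_inK Kx))).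
by apply: Pv_Pu; apply: L2_Linf Lc (H2_L2 Kx.1).
Qed.

Lemma Q_H2m (x : fT R) : H2m x -> aeT (Qop x) x.
Proof.
move=> Hx.
have Z : H2 (fun _ : C => 0 : C).
  by apply: eq_H2 (H2Z 0 (H2_1 R)) => z _; rewrite mul0r.
have P0 : aeT (P x) (fun=> 0).
  by apply: P_decomp Z Hx _; apply: aeT_T => z _; rewrite add0r.
apply: aeT_trans (aeT_map (fun z y => x z - y) P0) _.
by apply: aeT_T => z _; rewrite subr0.
Qed.

Lemma J_P_J (x : fT R) : L2 x -> aeT (Jop (P (Jop x))) (Qop x).
Proof.
move=> Lx; have [HP HmP] := P_spec Lx.
have h : aeT (P (Jop x)) (Jop (Qop x)).
  apply: (P_decomp (J_H2m HmP) (J_H2 HP)); apply: aeT_T => z _.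
  by rewrite /Jop /Qop; ring.
apply: aeT_trans (J_congr h) _; apply: aeT_T => z z1; exact: JK.
Qed.

(* Conjugation by [J] exchanges [P] and [Q]: [Q J P J b F] ~ [Q b F]. *)
Lemma Hank_tilde a b F : Linf b -> H2 F ->
  Hank a (Hank (tilde b) F) = P (fun z => a z * Qop (fun z => b z * F z) z).
Proof.
move=> Lb HF; have LbF := L2_Linf Lb (H2_L2 HF).
have e1 : Hank (tilde b) F = P (Jop (fun z => b z * F z)).
  apply: P_congr; apply: aeT_trans (Mul_congr (tilde b) (Q_H2m (J_H2 HF))) _.
  by apply: aeT_T => z _; rewrite /Mul /tilde /Jop; ring.
rewrite e1 /Hank /=; apply: P_congr; apply: Mul_congr.
have h := J_P_J LbF; have [HP HmP] := P_spec LbF.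
have e2 : Qop (Jop (P (Jop (fun z => b z * F z)))) =
    fun z => Jop (P (Jop (fun z => b z * F z))) z - P (Qop (fun z => b z * F z)) z.
  by rewrite /Qop (P_congr h).
rewrite e2; apply: aeT_trans (aeT_map (fun z y => y - P (Qop (fun z => b z * F z)) z) h) _.
exact: (Q_H2m HmP).
Qed.

(** The mirror image of [Hank_tilde], on [H2m]: conjugation by [Jop] turns the outer P into Q. With
    G = conj(v) F it produces the term containing [Rop]. *)
Lemma Hank_tilde_l a b G : Linf a -> Linf b -> H2m G ->
  aeT (Jop (Hank (tilde a) (Hank b (Jop G))))
      (Qop (fun z => a z * P (fun z => b z * G z) z)).
Proof.
move=> La Lb HG; have LbG := L2_Linf Lb (H2m_L2 HG).
have e1 : Hank b (Jop G) = P (fun z => b z * G z).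
  apply: P_congr; apply: Mul_congr.
  have JJ : aeT (Jop (Jop G)) G by apply: aeT_T => z z1; exact: JK.
  rewrite /Qop (P_congr JJ).
  apply: aeT_trans (aeT_map (fun z y => y - P G z) JJ) _; exact: Q_H2m HG.
have [HP _] := P_spec LbG.
rewrite e1 /Hank /=.
rewrite (_ : P (Mul (tilde a) (Qop (Jop (P (fun z => b z * G z))))) =
             P (Jop (fun z => a z * P (fun z => b z * G z) z))).
  by apply: J_P_J; exact: L2_Linf La (H2_L2 HP).
apply: P_congr; apply: aeT_trans (Mul_congr (tilde a) (Q_H2m (J_H2 HP))) _.
by apply: aeT_T => z _; rewrite /Mul /tilde /Jop; ring.
Qed.

Lemma widom a b f : Linf a -> Linf b -> Linf (fmul a b) -> L2 f ->
  aeT ((Pv v \o TT u (fmul a b) \o Pv v) f)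
      (fadd3 ((Pv v \o TT u a \o Pv v \o TT u b \o Pv v) f)
             ((Pv v \o Hank a \o Hank (tilde b) \o Pv v) f)
             ((Rop v \o Hank (tilde a) \o Hank b \o Radj v) f)).
Proof.
move=> La Lb Lab Lf; rewrite /=; set F := Pv v f.
have [_ [_ [KF _ _ _]]] := Pv_exact Lf; rewrite -/F in KF.
have HF := KF.1; have LF := H2_L2 HF.
pose bF z := b z * F z; have LbF : L2 bF := L2_Linf Lb LF.
pose G := Pv v bF.
have [_ [_ [KG _ _ _]]] := Pv_exact LbF; rewrite -/G in KG.
have LG := H2_L2 KG.1.
pose q := Qop bF; have [HPbF HmQ] := P_spec LbF.
have LvbF : L2 (fun z => (v z)^* * bF z) := L2_Linf (Linf_conj Linf_v) LbF.
pose w := P (fun z => (v z)^* * bF z); have [Hw _] := P_spec LvbF; rewrite -/w in Hw.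
have wE : P (Mul (cconj v) bF) = w.
  by apply: P_congr; apply: aeT_T => z _; rewrite /Mul /cconj conjcE.
have bFE z : abs2 z = 1 -> bF z = G z + q z + v z * w z.
  by move=> _; rewrite /G /q /Pv wE /Qop; ring.
have LaG : L2 (fun z => a z * G z) := L2_Linf La LG.
have Laq : L2 (fun z => a z * q z) := L2_Linf La (H2m_L2 HmQ).
have Law : L2 (fun z => a z * w z) := L2_Linf La (H2_L2 Hw).
have Lavw : L2 (fun z => v z * (a z * w z)) := L2_Linf Linf_v Law.
have lhs : aeT (Pv v (TT u (fmul a b) F))
    (fun z => Pv v (fun z => a z * G z) z + Pv v (fun z => a z * q z) z +
              Pv v (fun z => v z * (a z * w z)) z).
  apply: aeT_trans (Pv_TT Lab KF) _.
  rewrite (@Pv_congr v _ (fun z => (a z * G z + a z * q z) + v z * (a z * w z))); last first.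
    apply: aeT_T => z z1; rewrite /fmul -mulrA -/(bF z) bFE //; ring.
  apply: aeT_trans (PvD (L2D LaG Laq) Lavw) _.
  exact: (aeT_map (fun z y => y + Pv v (fun z => v z * (a z * w z)) z) (PvD LaG Laq)).
have t1 : aeT (Pv v (TT u a (Pv v (TT u b F)))) (Pv v (fun z => a z * G z)).
  have e := Pv_TT Lb KF; rewrite (TT_congr u a e).
  exact: Pv_TT.
have t2 : aeT (Pv v (Hank a (Hank (tilde b) F))) (Pv v (fun z => a z * q z)).
  by rewrite Hank_tilde //; exact: PvP.
have t3 : aeT (Rop v (Hank (tilde a) (Hank b (Radj v f)))) (Pv v (fun z => v z * (a z * w z))).
  rewrite /Rop /Radj /= -/F.
  have HmG : H2m (Mul (cconj v) F) by exact: KF.2.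
  have e := Hank_tilde_l La Lb HmG.
  have ew : P (fun z => b z * Mul (cconj v) F z) = w.
    by apply: P_congr; apply: aeT_T => z _; rewrite /Mul /cconj conjcE /bF; ring.
  rewrite ew in e; rewrite (Pv_congr v (Mul_congr v e)).
  have [HPa HmPa] := P_spec Law.
  apply: aeT_sym.
  have Zm : H2m (fun _ : C => 0 : C) by apply: eq_H2m (H2mB HmQ HmQ) => z _; rewrite subrr.
  (* v a w = v Q(a w) + v P(a w), and the second summand lies in v H2. *)
  apply: (@Pv_kill _ _ (fun=> 0) (P (fun z => a z * w z))) => //.
    exact: L2_Linf Linf_v (H2m_L2 HmPa).
  by apply: aeT_T => z _; rewrite /Mul /Qop; ring.
apply: aeT_trans lhs _; apply: aeT_sym; rewrite /fadd3.
pose T3 := Rop v (Hank (tilde a) (Hank b (Radj v f))).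
apply: aeT_trans (aeT_map2 (fun z x y => x + y + T3 z) t1 t2) _.
exact: (aeT_map (fun z y => Pv v (fun z => a z * G z) z + Pv v (fun z => a z * q z) z + y) t3).
Qed.

End Dominated.
End ModelSpace.

(** * The boundary function of the infinite product is divisible by each u_m *)

Section BoundaryProduct.
Variable R : realType.
Local Notation C := R[i].
Local Notation Re := (@complex.Re R).
Local Notation Im := (@complex.Im R).
Local Notation mu := (@lebesgue_measure R).
Local Notation I := (@I01 R).
Local Open Scope classical_set_scope.
Local Open Scope ring_scope.
Local Notation int1 phi := (mu.-integrable I (EFin \o phi)).
Implicit Types (f g h a b F : fT R).

Let mI : measurable I := @measurable_I R.
Let mI' : @measurable _ (measurableTypeR R) I := @measurable_I R.

Lemma Rintegral_lim0 (s : nat -> R -> R) (l g : R -> R) :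
  (forall j, measurable_fun I (s j)) -> measurable_fun I l -> int1 g ->
  (forall j t, I t -> `|s j t| <= g t) -> (forall j, Rintegral mu I (s j) = 0) ->
  {ae mu, forall t, I t -> s j t @[j --> \oo] --> l t} -> Rintegral mu I l = 0.
Proof.
move=> ms ml ig sg s0 sl.
have is_ j : int1 (s j) by apply: int1_le ig => // t; exact: sg.
have mse j : measurable_fun I (EFin \o s j) by exact/measurable_EFinP.
have mle : measurable_fun I (EFin \o l) by exact/measurable_EFinP.
have [||il _ cl] := @dominated_convergence _ (measurableTypeR R) R mu I mI'
  (fun j => EFin \o s j) (EFin \o l) (EFin \o g) mse mle _ ig.
- by apply: ae_imp sl => t cs It; apply: cvg_EFin; [exact: nearW|exact: cs].
- by apply: aeW => t j It /=; rewrite lee_fin sg.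
have int0 j : (\int[mu]_(t in I) (s j t)%:E = 0)%E.
  by apply/eqP; rewrite -fine_eq0; [apply/eqP; exact: s0|exact: (integrable_fin_num mI' (is_ j))].
rewrite /Rintegral (_ : (\int[mu]_(t in I) (l t)%:E)%E = 0%E) //.
rewrite -(cvg_lim _ cl) // (_ : [sequence _]_j = cst 0%E); first exact: lim_cst.
by apply/funext => j /=; exact: int0.
Qed.

(** The domination is in squared modulus; |x| <= 1 + x^2 turns it into the integrable majorant 1 +
    |h|^2. *)
Lemma cint_lim0 (G : nat -> fT R) F h : (forall j, measT (G j)) -> measT F -> L2 h ->
  (forall j z, abs2 z = 1 -> abs2 (G j z) <= abs2 (h z)) ->
  (forall j, cint (G j) = 0) ->
  {ae mu, forall t, I t -> ccvg (F := \oo) (fun j => G j (eT t)) (F (eT t))} ->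
  cint F = 0.
Proof.
move=> mG [mF1 mF2] [_ ih] Gh G0 cG.
have ig : int1 (fun t => 1 + abs2 (h (eT t))) by apply: int1D => //; exact: int1_cst.
have le (x y : R) : x ^+ 2 <= y -> `|x| <= 1 + y.
  by rewrite -real_normK ?num_real //; have := normr_ge0 x; nra.
apply: complex_eq => /=.
- apply: (Rintegral_lim0 (s := fun j t => Re (G j (eT t))) _ mF1 ig).
  + by move=> j; case: (mG j).
  + by move=> j t _; apply: le; apply: le_trans (abs2_Re _) (Gh _ _ (abs2_eT t)).
  + by move=> j; have /(congr1 Re) := G0 j.
  + by apply: ae_imp cG => t cG It; case: (cG It).
- apply: (Rintegral_lim0 (s := fun j t => Im (G j (eT t))) _ mF2 ig).
  + by move=> j; case: (mG j).
  + by move=> j t _; apply: le; apply: le_trans (abs2_Im _) (Gh _ _ (abs2_eT t)).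
  + by move=> j; have /(congr1 Im) := G0 j.
  + by apply: ae_imp cG => t cG It; case: (cG It).
Qed.

Lemma LinfM a b : Linf a -> Linf b -> Linf (fmul a b).
Proof.
move=> [ma [M aM]] [mb [N bN]]; split; first exact: measTM.
exists (M * N); apply: ae_imp2 aM bN => t aM bN tI.
by rewrite /fmul abs2M ler_pM ?abs2_ge0 ?aM ?bN.
Qed.

Variable lam : nat -> C.
Hypothesis lam1 : forall k, abs2 (lam k) < 1.

Lemma abs2_uprod n z : abs2 z = 1 -> abs2 (uprod lam n z) = 1.
Proof. by rewrite uprodE; exact: abs2_vprod. Qed.

Lemma measT_uprod n : measT (uprod lam n).
Proof. by apply: eq_measT (contT_measT (contT_vprod lam1 0 n)) => z _; rewrite uprodE. Qed.

Lemma H2mult_uprod n : H2mult (uprod lam n).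
Proof. by apply: eq_H2mult (H2mult_vprod lam1 0 n) => z _; rewrite uprodE. Qed.

Variables (n : nat -> nat) (U : fT R) (m : nat).
Hypothesis n_ge : forall j, (j <= n j)%N.
Hypothesis mU : measT U.
Hypothesis cvgU : {ae mu, forall t, I t ->
  ccvg (F := \oo) (fun j => uprod lam (n j) (eT t)) (U (eT t))}.

Lemma Linf_boundary : Linf U.
Proof.
(* 4 = 2 + 2, from |U|^2 <= 2 |u_n|^2 + 2 |u_n - U|^2 at one index where the last squared distance
   is at most 1. *)
split=> //; exists 4; apply: ae_imp cvgU => t cU; rewrite inE => It.
have /ccvgP /(_ 1 ltr01) [N _ hN] := cU It.
have := hN N (leqnn N); have := abs2_uprod (n N) (abs2_eT t).
set u := uprod _ _ _ => u1 uU; have := abs2B_le u (u - U (eT t)).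
by rewrite opprB addrC subrK; lra.
Qed.

(* [conj (u_m) U h] is the limit of [(u_(n j) / u_m) h], dominated by [h]. *)
Lemma H2_boundary_quotient h : H2 h ->
  H2 (fun z => (uprod lam m z)^* * (U z * h z)).
Proof.
move=> Hh; have Lh := H2_L2 Hh; set v := uprod lam m.
have Lv : Linf v.
  by apply: (@Linf_bdd _ _ 1 (measT_uprod m)) => z z1; rewrite abs2_uprod.
have LF : L2 (fun z => (v z)^* * (U z * h z)).
  exact: L2_Linf (Linf_conj Lv) (L2_Linf Linf_boundary Lh).
split=> // k k0; have mX := measT_X R (- k).
(* The shift j + m guarantees n (j + m) >= m, so that the quotient by u_m is the finite product
   [vprod]. *)
pose G j : fT R := fun z => ((v z)^* * (uprod lam (n (j + m)) z * h z)) * z ^ (- k).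
have GE j z : abs2 z = 1 -> G j z = vprod lam m (n (j + m)) z * h z * z ^ (- k).
  move=> z1; rewrite /G (@vprod_cat _ lam m); last exact: leq_trans (leq_addl _ _) (n_ge _).
  congr (_ * _); rewrite -[RHS]mul1r -(_ : (v z)^* * v z = 1) /v; first by ring.
  by rewrite mulrC abs2E abs2_uprod.
apply: (@cint_lim0 G _ h) => //.
- move=> j; apply: measTM mX; apply: measTM; first by case: (Linf_conj Lv).
  by apply: measTM; [exact: measT_uprod|case: Lh].
- by apply: measTM mX; case: LF.
- by move=> j z z1; rewrite GE // !abs2M abs2_vprod // abs2_Xz // mul1r mulr1.
- move=> j; rewrite (eq_cint (GE j)).
  by case: (H2mult_vprod lam1 m (n (j + m)) Hh) => _; apply.
- apply: ae_imp cvgU => t cU It; apply: ccvgM; last exact: ccvg_cst.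
  apply: ccvgM; first exact: ccvg_cst; apply: ccvgM; last exact: ccvg_cst.
  have [c1 c2] := cU It; split.
    by rewrite (cvg_shiftn m (fun j => Re (uprod lam (n j) (eT t)))).
  by rewrite (cvg_shiftn m (fun j => Im (uprod lam (n j) (eT t)))).
Qed.

End BoundaryProduct.

Local Open Scope ring_scope.

Theorem theorem2p2 (R : realType) (lam : nat -> R[i]) (a b : fT R) :
  blaschke_seq lam -> Linf a -> Linf b ->
  forall n : nat, (1 <= n)%N ->
  let u := bprodT lam in
  let un := uprod lam n in
  forall f : fT R, L2 f ->
  aeT ((Pv un \o TT u (fmul a b) \o Pv un) f)
      (fadd3 ((Pv un \o TT u a \o Pv un \o TT u b \o Pv un) f)
             ((Pv un \o Hank a \o Hank (tilde b) \o Pv un) f)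
             ((Rop un \o Hank (tilde a) \o Hank b \o Radj un) f)).
Proof.
move=> [lam_lt1 [_ lam_sum]] La Lb m _ u un f Lf.
have lam1 k := norm_lt1 (lam_lt1 k).
(* From here on [m] is the index of the statement and [n] the auxiliary fast subsequence. *)
have [n [n_ge n_mono n_tail]] := fast_indices lam1 lam_sum.
have [uU cU] := radial_limit_ae lam1 n_ge n_mono n_tail.
have mU := measT_limsup (fun j => measT_uprod lam1 (n j)).
apply: (widom (measT_uprod lam1 m) (abs2_uprod lam1 m) (H2mult_uprod lam1 m) uU) => //.
- exact: (Linf_boundary lam1 mU cU).
- by move=> h; exact: (H2_boundary_quotient lam1 m n_ge mU cU).
- exact: LinfM.
Qed.
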